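(* For every $\varepsilon>0$ there exist infinitely many positive integers $n$ such that $\tau(n)\neq 0$ and $$P(\tau(n)) \geq (\log n)^{33/31-\varepsilon}.$$ (Equivalently, in the paper's notation: there are infinitely many $n$ with $\tau(n)\ne 0$ and $P(\tau(n))\ge (\log n)^{33/31+o(1)}$.)
   Context: $\tau(n)$ denotes the Ramanujan function, defined by the power series identity $X\prod_{n=1}^\infty(1-X^n)^{24}=\sum_{n=1}^\infty \tau(n)X^n$ for $|X|<1$. For an integer $m$, $P(m)$ denotes the largest prime factor of $m$, with the convention $P(0)=P(\pm1)=1$. *)

(* Defs.v *)
From HB Require Import structures.
From mathcomp Require Import all_boot all_order all_algebra.
From mathcomp Require Import all_classical all_reals all_analysis.

Set Implicit Arguments.
Unset Strict Implicit.
Unset Printing Implicit Defensive.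

Import Order.TTheory GRing.Theory Num.Theory.
Import numFieldNormedType.Exports.

Local Open Scope classical_set_scope.
Local Open Scope ring_scope.

Definition tau_poly (N : nat) : {poly int} :=
  'X * \prod_(1 <= k < N.+1) (1 - 'X^k) ^+ 24.

(* The factors with k > n do not affect the coefficient of 'X^n, so this is
   the n-th coefficient of the infinite product; [tau_generating] below shows
   that it satisfies the defining power series identity of Ramanujan's tau. *)
Definition tau (n : nat) : int := (tau_poly n)`_n.

Section GeneratingSeries.

Let F (s : int) (N : nat) : {poly int} :=
  'X * \prod_(1 <= k < N.+1) (1 + s *: 'X^k) ^+ 24.

Let FS s N : F s N.+1 = F s N * (1 + s *: 'X^(N.+1)) ^+ 24.
Proof. by rewrite /F big_nat_recr //= mulrA. Qed.

Let tau_polyE N : tau_poly N = F (-1) N.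
Proof. by rewrite /tau_poly /F; under [in RHS]eq_bigr do rewrite scaleN1r. Qed.

Let coef_step (p : {poly int}) s m i :
  (p * (1 + s *: 'X^m))`_i = p`_i + s * (if (i < m)%N then 0 else p`_(i - m)).
Proof. by rewrite mulrDr mulr1 -scalerAr coefD coefZ coefMXn. Qed.

Let coef_stepX (p : {poly int}) s m i j : (i < m)%N ->
  (p * (1 + s *: 'X^m) ^+ j)`_i = p`_i.
Proof.
move=> im; elim: j => [|j IH]; first by rewrite expr0 mulr1.
by rewrite exprSr mulrA coef_step im mulr0 addr0.
Qed.

Let F_stable s n N : (n <= N)%N -> (F s N)`_n = (F s n)`_n.
Proof.
elim: N => [|N IH]; first by rewrite leqn0 => /eqP ->.
rewrite leq_eqVlt => /predU1P[->//|nN].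
by rewrite FS coef_stepX // IH.
Qed.

Let dom_stepX (p q : {poly int}) m j : (forall i, `|p`_i| <= q`_i) ->
  forall i, `|(p * (1 + (-1) *: 'X^m) ^+ j)`_i| <= (q * (1 + 1 *: 'X^m) ^+ j)`_i.
Proof.
move=> pq; elim: j => [|j IH] i; first by rewrite !expr0 !mulr1.
rewrite !exprSr !mulrA !coef_step mulN1r mul1r.
apply: le_trans (ler_normB _ _) _; apply: lerD; first exact: IH.
by case: ifP => _; [rewrite normr0|exact: IH].
Qed.

Let F_dom N i : `|(F (-1) N)`_i| <= (F 1 N)`_i.
Proof.
elim: N i => [|N IH] i; first by rewrite /F !big_geq // mulr1 coefX; case: eqP.
by rewrite !FS; exact: dom_stepX.
Qed.

Let F1_ge0 N i : 0 <= (F 1 N)`_i.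
Proof. exact: le_trans (normr_ge0 _) (F_dom N i). Qed.

Let mono_stepX (p : {poly int}) m j : (forall i, 0 <= p`_i) ->
  forall i, p`_i <= (p * (1 + 1 *: 'X^m) ^+ j)`_i.
Proof.
move=> p0; elim: j => [|j IH] i; first by rewrite expr0 mulr1.
rewrite exprSr mulrA coef_step mul1r; apply: le_trans (IH i) _.
rewrite lerDl; case: ifP => // _; exact: le_trans (p0 _) (IH _).
Qed.

Let F1_le N i : (F 1 N)`_i <= (F 1 i)`_i.
Proof.
have [iN|Ni] := leqP i N; first by rewrite (F_stable _ iN).
have mono M : (N <= M)%N -> (F 1 N)`_i <= (F 1 M)`_i.
  elim: M => [|M IH]; first by rewrite leqn0 => /eqP ->.
  rewrite leq_eqVlt => /predU1P[->//|NM].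
  by apply: le_trans (IH NM) _; rewrite FS; exact: mono_stepX.
exact/mono/ltnW.
Qed.

Variables (R : realType) (x : R).
Hypothesis x1 : `|x| < 1.

Let ev (y : R) (p : {poly int}) : R := (map_poly intr p).[y].

Let evF y s N :
  ev y (F s N) = y * \prod_(1 <= k < N.+1) (1 + s%:~R * y ^+ k) ^+ 24.
Proof.
elim: N => [|N IH].
  by rewrite /ev /F !big_geq // !mulr1 map_polyX hornerX.
rewrite big_nat_recr //= mulrA -IH FS /ev rmorphM hornerM rmorphXn horner_exp /=.
by rewrite rmorphD rmorph1 /= map_polyZ map_polyXn !hornerE.
Qed.

Let evE y (p : {poly int}) M : (size p <= M)%N ->
  ev y p = \sum_(0 <= i < M) (p`_i)%:~R * y ^+ i.
Proof.
move=> pM; rewrite /ev (horner_coef_wide _ (n := M)); last first.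
  by apply: leq_trans pM; exact: size_poly.
by rewrite big_mkord; apply: eq_bigr => i _; rewrite coef_map.
Qed.

Let b n : R := ((F 1 n)`_n)%:~R * `|x| ^+ n.

Let b_ge0 n : 0 <= b n.
Proof. by rewrite mulr_ge0 ?exprn_ge0 // ler0z F1_ge0. Qed.

Let b_bound N : series b N <= expR (24 / (1 - `|x|)).
Proof.
have x10 : 0 < 1 - `|x| by rewrite subr_gt0.
have geo M : \sum_(1 <= k < M.+1) `|x| ^+ k <= (1 - `|x|)^-1.
  rewrite -[leRHS]mul1r ler_pdivlMr //.
  apply: (@le_trans _ _ ((\sum_(0 <= k < M.+1) `|x| ^+ k) * (1 - `|x|))).
    rewrite ler_pM2r // [leRHS]big_ltn // lerDr.
    exact: exprn_ge0.
  rewrite big_mkord mulrC -opprB mulNr -subrX1 opprB.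
  by rewrite lerBlDr lerDl exprn_ge0.
apply: (@le_trans _ _ (ev `|x| (F 1 N))).
  rewrite (evE _ (M := maxn (size (F 1 N)) N)) ?leq_maxl //.
  rewrite (big_cat_nat (n := N)) ?leq_maxr //=.
  rewrite /series /= -[leLHS]addr0 lerD //.
    rewrite big_nat [leRHS]big_nat; apply: ler_sum => i /andP[_ iN].
    by rewrite /b (F_stable _ (ltnW iN)).
  by apply: sumr_ge0 => i _; rewrite mulr_ge0 ?exprn_ge0 // ler0z F1_ge0.
rewrite evF.
apply: (@le_trans _ _ (\prod_(1 <= k < N.+1) expR (24 * `|x| ^+ k))).
  rewrite -[leRHS]mul1r ler_pM ?(ltW x1) //.
    by apply: prodr_ge0 => k _; rewrite exprn_ge0 // mul1r addr_ge0 ?exprn_ge0.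
  apply: ler_prod => k _; rewrite mul1r exprn_ge0 ?addr_ge0 ?exprn_ge0 //=.
  by rewrite expRM_natl lerXn2r ?nnegrE ?addr_ge0 ?exprn_ge0 ?expR_ge0 ?expR_ge1Dx.
rewrite -expR_sum ler_expR -mulr_sumr ler_pM2l //.
Qed.

Let b_cvg : cvgn (series b).
Proof.
apply: nondecreasing_is_cvgn.
  by apply/nondecreasing_seqP => n; rewrite /series /= big_nat_recr //= lerDl.
by exists (expR (24 / (1 - `|x|))) => _ [N _ <-]; exact: b_bound.
Qed.

Let t n : R := (tau n)%:~R * x ^+ n.

Let t_le n : `|t n| <= b n.
Proof.
rewrite /t normrM normrX ler_wpM2r ?exprn_ge0 //.
by rewrite -intr_norm ler_int /tau tau_polyE F_dom.
Qed.

Let partial_le N : `|ev x (tau_poly N) - series t N| <= limn (series b) - series b N.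
Proof.
set M := maxn (size (tau_poly N)) N.
have NM : (N <= M)%N by exact: leq_maxr.
rewrite (evE _ (M := M)) ?leq_maxl // (big_cat_nat (n := N)) //=.
have -> : \sum_(0 <= i < N) ((tau_poly N)`_i)%:~R * x ^+ i = series t N.
  rewrite /series /= big_nat [RHS]big_nat; apply: eq_bigr => i /andP[_ iN].
  by rewrite /t /tau !tau_polyE (F_stable _ (ltnW iN)).
rewrite addrAC subrr add0r.
apply: le_trans (ler_norm_sum _ _ _) _.
apply: (@le_trans _ _ (series b M - series b N)).
  rewrite sub_series_geq //; apply: ler_sum => i _.
  rewrite normrM normrX ler_wpM2r ?exprn_ge0 // -intr_norm ler_int tau_polyE.
  exact: le_trans (F_dom _ _) (F1_le _ _).
rewrite lerD2r; apply: nondecreasing_cvgn_le (b_cvg) _.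
by apply/nondecreasing_seqP => n; rewrite /series /= big_nat_recr //= lerDl.
Qed.

Lemma tau_generating :
  cvgn (series (fun n => (tau n)%:~R * x ^+ n)) /\
  (fun N : nat => x * \prod_(1 <= k < N.+1) (1 - x ^+ k) ^+ 24) @ \oo -->
    limn (series (fun n => (tau n)%:~R * x ^+ n)).
Proof.
have tc : cvgn (series t).
  by apply: normed_cvg; apply: series_le_cvg b_cvg => // n /=.
split; first exact: tc.
rewrite (_ : (fun N => _) = (fun N => series t N + (ev x (tau_poly N) - series t N))); last first.
  apply/funext => N; rewrite addrC subrK tau_polyE evF; congr (_ * _).
  by apply: eq_bigr => k _; rewrite mulrN1z mulN1r.
rewrite -[X in _ --> X]addr0; apply: cvgD; first exact: tc.
apply/cvgr0Pnorm_le => //= e e0.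
have : (fun N => limn (series b) - series b N) @ \oo --> (0 : R).
  by rewrite -[X in _ --> X](subrr (limn (series b))); apply: cvgB => //; exact: cvg_cst.
move=> /cvgr0_norm_le /(_ _ e0); apply: filterS => N.
by move=> /(le_trans (ler_norm _)); exact: le_trans (partial_le N).
Qed.

End GeneratingSeries.

(* Main.v *)
(** If tau(n) were (log n)^A-smooth for all large n with tau(n) <> 0 and some
    A < 33/31, then for almost all primes p <= x both tau(p) and
    tau(p^2) = tau(p)^2 - p^11 would be (2 log x)^A-smooth.  They determine p, and
    they are at most x^(11/2 + e) and 2 x^(11 + 2e).  Rankin's trick gives at most
    X^(1 - 1/A + o(1)) smooth integers up to X, so the number of primes up to x
    would be at most x^(33/2 (1 - 1/A) + o(1)), which saves a power of x;
    Rankin's trick for all integers up to x refutes this.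

    Instead of Deligne's bound, the mean square sum_(n <= N) tau(n)^2 = O(N^12)
    bounds tau(p) for all but O(x^(1 - 2e)) primes; it comes from Parseval's
    identity and the boundedness of |Delta(z)| (Im z)^6.  The transformation law
    Delta(-1/z) = z^12 Delta(z) is obtained by integrating the logarithmic
    derivative of the partial products of Delta along the segment from i to z:
    partial fraction expansions of cot and 1/sin^2 turn the quasi-modularity of the
    weight two Eisenstein series into an estimate with error O(1/N).  Hecke's
    relation holds because the difference T_p Delta - tau(p) Delta vanishes to
    order two at the cusp, and a cusp form of weight 12 of order two is zero. *)

From HB Require Import structures.
Require Import Defs.
From mathcomp Require Import all_boot all_order all_algebra.
From mathcomp Require Import all_classical all_reals all_analysis.
From mathcomp Require Import complex ring lra zify.

Set Implicit Arguments.
Unset Strict Implicit.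
Unset Printing Implicit Defensive.

Import Order.TTheory GRing.Theory Num.Theory.
Import numFieldNormedType.Exports.

Local Open Scope classical_set_scope.
Local Open Scope ring_scope.

(** * Complex numbers and sequences *)

(** The exponent 33/31 solves 33/2 (1 - 1/A) = 1, where 33/2 = 11/2 + 11 adds the sizes of tau(p)
    and tau(p^2). Both values must be nonzero for the smoothness hypothesis to apply: tau(p^2) = 0
    would make p^11 a square, and tau(p) = 0 would leave tau(p^2) = -p^11, whose prime factor p is
    too large.

    On the analytic side only finite products are differentiated, along a real segment, so neither
    holomorphy nor a branch of the logarithm intervenes; limits are taken at the end. The obstacle
    is that the weight two Eisenstein series converges only conditionally: exchanging the order of
    summation changes its value, and the discrepancy, obtained with an explicit error, is what
    produces the factor z^12. That a form of order two vanishes is shown by a contraction: its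
    invariant size |f(z)| (Im z)^6 is bounded, and any bound M improves to 19/20 M by comparing the
    heights y and 3y/4. *)

Notation cabs := (@Normc.normc _).

Section ComplexNorm.
Variable R : realType.
Implicit Types (x y z : R[i]) (u v : nat -> R[i]).

Lemma cabsE z : cabs z = Num.sqrt (complex.Re z ^+ 2 + complex.Im z ^+ 2) :> R.
Proof. by case: z. Qed.

Lemma cabs_sqr z : cabs z ^+ 2 = complex.Re z ^+ 2 + complex.Im z ^+ 2 :> R.
Proof. by rewrite cabsE sqr_sqrtr // addr_ge0 ?sqr_ge0. Qed.

Lemma cabs_ge0 z : 0 <= cabs z :> R.
Proof. by rewrite cabsE sqrtr_ge0. Qed.

Lemma cabs0 : cabs (0 : R[i]) = 0 :> R.
Proof. exact: Normc.normc0. Qed.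

Lemma cabs1 : cabs (1 : R[i]) = 1 :> R.
Proof. exact: Normc.normc1. Qed.

Lemma cabsM x y : cabs (x * y) = cabs x * cabs y.
Proof. exact: Normc.normcM. Qed.

Lemma cabsV x : cabs x^-1 = (cabs x)^-1.
Proof. exact: Normc.normcV. Qed.

Lemma cabsX x n : cabs (x ^+ n) = cabs x ^+ n.
Proof. by elim: n => [|n IH]; rewrite ?cabs1 // !exprS cabsM IH. Qed.

Lemma cabsD x y : cabs (x + y) <= cabs x + cabs y.
Proof. exact: le_normcD. Qed.

Lemma cabsN x : cabs (- x) = cabs x.
Proof. exact: normcN. Qed.

Lemma cabsB x y : cabs (x - y) <= cabs x + cabs y.
Proof. by rewrite -(cabsN y) cabsD. Qed.

Lemma cabs_subC x y : cabs (x - y) = cabs (y - x).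
Proof. by rewrite -cabsN opprB. Qed.

Lemma cabs_eq0 x : (cabs x == 0) = (x == 0).
Proof. by apply/eqP/eqP => [/Normc.eq0_normc//|->]; rewrite cabs0. Qed.

Lemma cabs_gt0 x : (0 < cabs x) = (x != 0).
Proof. by rewrite lt_neqAle cabs_ge0 andbT eq_sym cabs_eq0. Qed.

Lemma cabs_real (a : R) : cabs a%:C%C = `|a|.
Proof. by rewrite cabsE /= expr0n addr0 sqrtr_sqr. Qed.

Lemma complex_natE n : (n%:R : R[i]) = (n%:R)%:C%C.
Proof. by rewrite rmorph_nat. Qed.

Lemma complex_intE (n : int) : (n%:~R : R[i]) = (n%:~R)%:C%C.
Proof. by rewrite rmorph_int. Qed.

Lemma cabs_nat n : cabs (n%:R : R[i]) = n%:R.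
Proof. by rewrite complex_natE cabs_real normr_nat. Qed.

Lemma cabs_i : cabs ('i%C : R[i]) = 1.
Proof. by rewrite cabsE /= expr0n expr1n add0r sqrtr1. Qed.

Lemma cabs_sum (I : Type) (r : seq I) (P : pred I) (F : I -> R[i]) :
  cabs (\sum_(i <- r | P i) F i) <= \sum_(i <- r | P i) cabs (F i).
Proof.
elim/big_rec2: _ => [|i a b _ ab]; first by rewrite cabs0.
by apply: le_trans (cabsD _ _) _; rewrite lerD2l.
Qed.

Lemma cabs_Re z : `|complex.Re z| <= cabs z.
Proof. by rewrite cabsE -sqrtr_sqr ler_wsqrtr // lerDl sqr_ge0. Qed.

Lemma cabs_Im z : `|complex.Im z| <= cabs z.
Proof. by rewrite cabsE -sqrtr_sqr ler_wsqrtr // lerDr sqr_ge0. Qed.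

Lemma cabs_le_ReIm z : cabs z <= `|complex.Re z| + `|complex.Im z|.
Proof.
have h : 0 <= `|complex.Re z| + `|complex.Im z| by rewrite addr_ge0.
rewrite -(@ler_pXn2r _ 2) ?nnegrE ?cabs_ge0 // cabs_sqr sqrrD !real_normK ?num_real //.
by rewrite lerD2r lerDl mulrn_wge0 // mulr_ge0.
Qed.

Lemma cabs_lbD x y : cabs x - cabs y <= cabs (x + y).
Proof.
rewrite lerBlDr; apply: le_trans (cabsB _ _).
by rewrite addrK.
Qed.

Lemma cReD x y : complex.Re (x + y) = complex.Re x + complex.Re y.
Proof. by case: x; case: y. Qed.
Lemma cImD x y : complex.Im (x + y) = complex.Im x + complex.Im y.
Proof. by case: x; case: y. Qed.
Lemma cReN x : complex.Re (- x) = - complex.Re x.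
Proof. by case: x. Qed.
Lemma cImN x : complex.Im (- x) = - complex.Im x.
Proof. by case: x. Qed.
Lemma cReM x y : complex.Re (x * y) =
  complex.Re x * complex.Re y - complex.Im x * complex.Im y.
Proof. by case: x; case: y. Qed.
Lemma cImM x y : complex.Im (x * y) =
  complex.Re x * complex.Im y + complex.Im x * complex.Re y.
Proof. by case: x => ? ?; case: y => ? ?; rewrite /= addrC addrC. Qed.
Lemma cRe_nat n : complex.Re (n%:R : R[i]) = n%:R.
Proof. by rewrite complex_natE. Qed.
Lemma cIm_nat n : complex.Im (n%:R : R[i]) = 0.
Proof. by rewrite complex_natE. Qed.
Lemma cRe_int (n : int) : complex.Re (n%:~R : R[i]) = n%:~R.
Proof. by rewrite complex_intE. Qed.
Lemma cIm_int (n : int) : complex.Im (n%:~R : R[i]) = 0.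
Proof. by rewrite complex_intE. Qed.
Lemma cReV z : complex.Re z^-1 = complex.Re z / cabs z ^+ 2.
Proof. by rewrite cabs_sqr; case: z => a b. Qed.
Lemma cImV z : complex.Im z^-1 = - complex.Im z / cabs z ^+ 2.
Proof. by rewrite cabs_sqr; case: z => a b /=; rewrite mulNr. Qed.

Lemma complex_eqP x y :
  complex.Re x = complex.Re y -> complex.Im x = complex.Im y -> x = y.
Proof. by case: x => a b; case: y => c d /= -> ->. Qed.

(* The library norm of [R[i]] takes values in [R[i]]; the modulus [cabs] takes
   values in [R]. *)
Definition ccvg u (l : R[i]) :=
  forall e : R, 0 < e -> exists N, forall n, (N <= n)%N -> cabs (u n - l) < e.

Lemma ccvg_ext u v l N : (forall n, (N <= n)%N -> u n = v n) -> ccvg u l -> ccvg v l.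
Proof.
move=> uv ul e /ul[M hM]; exists (maxn N M) => n; rewrite geq_max => /andP[Nn Mn].
by rewrite -uv // hM.
Qed.

Lemma ccvg_cst l : ccvg (fun=> l) l.
Proof. by move=> e e0; exists 0%N => n _; rewrite subrr cabs0. Qed.

Lemma ccvgD u v a b : ccvg u a -> ccvg v b -> ccvg (fun n => u n + v n) (a + b).
Proof.
move=> ua vb e e0; have e20 : 0 < e / 2 by rewrite divr_gt0.
have [N hN] := ua _ e20; have [M hM] := vb _ e20.
exists (maxn N M) => n; rewrite geq_max => /andP[Nn Mn].
have -> : u n + v n - (a + b) = (u n - a) + (v n - b) by ring.
apply: le_lt_trans (cabsD _ _) _; have := hN _ Nn; have := hM _ Mn; lra.
Qed.

Lemma ccvg_bounded u a : ccvg u a -> exists2 K : R, 0 < K &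
  exists N, forall n, (N <= n)%N -> cabs (u n) <= K.
Proof.
move=> ua; have [N hN] := ua 1 ltr01; exists (cabs a + 1).
  by rewrite ltr_wpDl ?cabs_ge0.
exists N => n /hN h; have -> : u n = a + (u n - a) by ring.
by apply: le_trans (cabsD _ _) _; rewrite lerD2l ltW.
Qed.

Lemma ccvgM0 u v K N : (forall n, (N <= n)%N -> cabs (v n) <= K) -> ccvg u 0 ->
  ccvg (fun n => u n * v n) 0.
Proof.
move=> vK u0 e e0.
have K1 : 0 < `|K| + 1 by rewrite ltr_wpDl.
have [M hM] := u0 _ (divr_gt0 e0 K1).
exists (maxn N M) => n; rewrite geq_max => /andP[Nn Mn].
rewrite subr0 cabsM; have := hM _ Mn; rewrite subr0 ltr_pdivlMr // => h.
apply: le_lt_trans h; rewrite ler_wpM2l ?cabs_ge0 //.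
by apply: le_trans (vK _ Nn) _; apply: le_trans (ler_norm _) _; rewrite lerDl.
Qed.

Lemma ccvg_sub0 u a : ccvg u a <-> ccvg (fun n => u n - a) 0.
Proof. by split => h e /h[N hN]; exists N => n /hN; rewrite subr0. Qed.

Lemma ccvgM u v a b : ccvg u a -> ccvg v b -> ccvg (fun n => u n * v n) (a * b).
Proof.
move=> ua vb; apply/ccvg_sub0.
have [K K0 [N hN]] := ccvg_bounded vb.
have h1 := ccvgM0 hN ((ccvg_sub0 _ _).1 ua).
have h2 : ccvg (fun n => (v n - b) * a) 0.
  by apply: (@ccvgM0 _ _ (cabs a) 0 (fun _ _ => lexx _)); apply/(ccvg_sub0 v b).
have := ccvgD h1 h2; rewrite addr0; apply: (ccvg_ext (N := 0)) => n _; ring.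
Qed.

Lemma ccvgZ c u a : ccvg u a -> ccvg (fun n => c * u n) (c * a).
Proof. by move=> ua; apply: ccvgM => //; exact: ccvg_cst. Qed.

Lemma ccvgN u a : ccvg u a -> ccvg (fun n => - u n) (- a).
Proof.
move=> /(ccvgZ (-1)); rewrite mulN1r.
by apply: (ccvg_ext (N := 0)) => n _; rewrite mulN1r.
Qed.

Lemma ccvgB u v a b : ccvg u a -> ccvg v b -> ccvg (fun n => u n - v n) (a - b).
Proof. by move=> ua /ccvgN; exact: ccvgD. Qed.

Lemma ccvgX u a k : ccvg u a -> ccvg (fun n => u n ^+ k) (a ^+ k).
Proof.
move=> ua; elim: k => [|k IH]; first exact: ccvg_cst.
rewrite exprS; apply: (ccvg_ext (N := 0)) (ccvgM ua IH) => n _.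
by rewrite exprS.
Qed.

Lemma ccvgV u a : a != 0 -> ccvg u a -> ccvg (fun n => (u n)^-1) a^-1.
Proof.
move=> a0 ua; apply/ccvg_sub0.
have na0 : 0 < cabs a by rewrite cabs_gt0.
have [N hN] := ua _ (divr_gt0 na0 (ltr0n R 2)).
have lb n : (N <= n)%N -> cabs a / 2 <= cabs (u n).
  move=> /hN h; have := cabs_lbD a (u n - a); rewrite [a + _]addrC subrK; lra.
have un0 n : (N <= n)%N -> u n != 0.
  by move=> /lb h; rewrite -cabs_gt0; apply: lt_le_trans h; rewrite divr_gt0.
have := @ccvgM0 (fun n => u n - a) (fun n => - (u n * a)^-1)
  ((cabs a / 2 * cabs a)^-1) N _ ((ccvg_sub0 _ _).1 ua).
move=> h; apply: (ccvg_ext (N := N)) (h _) => n Nn.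
  by field; rewrite a0 un0.
rewrite cabsN cabsV cabsM lef_pV2 ?posrE ?mulr_gt0 ?cabs_gt0 ?un0 //.
by rewrite ler_wpM2r ?cabs_ge0 ?lb.
Qed.

Lemma ccvg_sum (I : Type) (r : seq I) (F : I -> nat -> R[i]) (l : I -> R[i]) :
  (forall i, ccvg (F i) (l i)) ->
  ccvg (fun n => \sum_(i <- r) F i n) (\sum_(i <- r) l i).
Proof.
move=> h; elim: r => [|i r IH].
  by rewrite big_nil; apply: (ccvg_ext (N := 0)) (ccvg_cst _) => n _; rewrite big_nil.
rewrite big_cons; apply: (ccvg_ext (N := 0)) (ccvgD (h i) IH) => n _.
by rewrite big_cons.
Qed.

Lemma ccvg_le u a (K : R) N : ccvg u a -> (forall n, (N <= n)%N -> cabs (u n) <= K) ->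
  cabs a <= K.
Proof.
move=> ua uK; rewrite leNgt; apply/negP => Ka.
have e0 : 0 < cabs a - K by rewrite subr_gt0.
have [M hM] := ua _ e0.
have := hM _ (leq_maxr N M); have := uK _ (leq_maxl N M).
have := cabs_lbD a (u (maxn N M) - a); rewrite [a + _]addrC subrK; lra.
Qed.

Lemma ccvg_uniq u a b : ccvg u a -> ccvg u b -> a = b.
Proof.
move=> ua ub; have h := ccvgB ua ub.
apply/eqP; rewrite -subr_eq0 -cabs_eq0 eq_le cabs_ge0 andbT.
by apply: (ccvg_le (N := 0)) h _ => n _; rewrite subrr cabs0.
Qed.

Lemma ccvg_comp u a (f : nat -> nat) : (forall n, (n <= f n)%N) ->
  ccvg u a -> ccvg (fun n => u (f n)) a.
Proof.
by move=> fn ua e /ua[N hN]; exists N => n Nn; apply: hN (leq_trans Nn (fn n)).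
Qed.

Lemma archi_inv (e K : R) : 0 < e -> exists N, forall n, (N <= n)%N -> K / n.+1%:R < e.
Proof.
move=> e0; exists (Num.truncn (`|K| / e)) => n Nn.
rewrite ltr_pdivrMr ?ltr0n // mulrC -ltr_pdivrMr //.
apply: (@le_lt_trans _ _ (`|K| / e)).
  by rewrite ler_pM2r ?invr_gt0 // ler_norm.
by apply: (lt_le_trans (Num.Theory.truncnS_gt _)); rewrite ler_nat ltnS.
Qed.

Lemma ccvg_inv u a (K : R) N :
  (forall n, (N <= n)%N -> cabs (u n - a) <= K / n.+1%:R) -> ccvg u a.
Proof.
move=> h e /(archi_inv K)[M hM]; exists (maxn N M) => n.
by rewrite geq_max => /andP[/h + /hM]; exact: le_lt_trans.
Qed.

Lemma ccvg_ReIm u a : (fun n => complex.Re (u n)) @ \oo --> complex.Re a ->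
  (fun n => complex.Im (u n)) @ \oo --> complex.Im a -> ccvg u a.
Proof.
move=> /cvgrPdist_lt hr /cvgrPdist_lt hi e e0.
have e20 : 0 < e / 2 by rewrite divr_gt0.
have [N _ hN] := hr _ e20; have [M _ hM] := hi _ e20.
exists (maxn N M) => n; rewrite geq_max => /andP[/hN /= h1 /hM /= h2].
rewrite cabs_subC; apply: le_lt_trans (cabs_le_ReIm _) _.
by rewrite cReD cReN cImD cImN; lra.
Qed.

End ComplexNorm.

(** * The exponential exp(2 pi i z) *)

Section Qexp.
Variable R : realType.
Implicit Types (z w : R[i]).

Definition qexp z : R[i] := Complex
  (expR (- (2 * pi * complex.Im z)) * cos (2 * pi * complex.Re z))
  (expR (- (2 * pi * complex.Im z)) * sin (2 * pi * complex.Re z)).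

Lemma qexpD z w : qexp (z + w) = qexp z * qexp w.
Proof.
apply: complex_eqP; rewrite ?(cReM, cImM) /= cReD cImD !mulrDr opprD expRD (cosD, sinD);
  ring.
Qed.

Lemma qexp0 : qexp 0 = 1.
Proof. by apply: complex_eqP; rewrite /= !mulr0 oppr0 expR0 ?cos0 ?sin0 ?mulr1 ?mulr0. Qed.

Lemma qexp1 : qexp 1 = 1.
Proof.
by apply: complex_eqP; rewrite /= !mulr0 oppr0 expR0 !mulr1 !mul1r mulr_natl ?cos2pi ?sin2pi.
Qed.

Lemma qexpMn n z : qexp (n%:R * z) = qexp z ^+ n.
Proof.
elim: n => [|n IH]; first by rewrite mul0r qexp0.
by rewrite -natr1 mulrDl mul1r qexpD IH exprSr.
Qed.

Lemma qexp_nat n : qexp n%:R = 1.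
Proof. by rewrite -[n%:R]mulr1 qexpMn qexp1 expr1n. Qed.

Lemma qexpN z : qexp (- z) = (qexp z)^-1.
Proof.
have h : qexp z * qexp (- z) = 1 by rewrite -qexpD subrr qexp0.
have z0 : qexp z != 0 by apply: contra_eqN h => /eqP ->; rewrite mul0r eq_sym oner_eq0.
by apply: (mulfI z0); rewrite h divff.
Qed.

Lemma qexp_neq0 z : qexp z != 0.
Proof.
have h : qexp z * qexp (- z) = 1 by rewrite -qexpD subrr qexp0.
by apply: contra_eqN h => /eqP ->; rewrite mul0r eq_sym oner_eq0.
Qed.

Lemma qexp_int (n : int) : qexp n%:~R = 1.
Proof.
by case: n => n; [exact: qexp_nat|rewrite NegzE mulrNz qexpN qexp_nat invr1].
Qed.

Lemma cabs_qexp z : cabs (qexp z) = expR (- (2 * pi * complex.Im z)).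
Proof.
by rewrite cabsE /= !exprMn -mulrDr cos2Dsin2 mulr1 sqrtr_sqr ger0_norm ?expR_ge0.
Qed.

End Qexp.

(** * Derivatives of real functions *)

Section RealDerive.
Variable R : realType.
Implicit Types (f g : R -> R) (t : R).

Lemma is_derive1M f g t (a b : R) : is_derive t 1 f a -> is_derive t 1 g b ->
  is_derive t 1 (fun s => f s * g s) (f t * b + g t * a).
Proof. by move=> fa gb; exact: (is_deriveM fa gb). Qed.

Lemma is_derive1D f g t (a b : R) : is_derive t 1 f a -> is_derive t 1 g b ->
  is_derive t 1 (fun s => f s + g s) (a + b).
Proof. by move=> fa gb; exact: (is_deriveD fa gb). Qed.

Lemma is_derive1B f g t (a b : R) : is_derive t 1 f a -> is_derive t 1 g b ->
  is_derive t 1 (fun s => f s - g s) (a - b).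
Proof. by move=> fa gb; exact: (is_deriveB fa gb). Qed.

Lemma is_derive1Z f t (a k : R) : is_derive t 1 f a ->
  is_derive t 1 (fun s => k * f s) (k * a).
Proof. by move=> fa; exact: (is_deriveZ k fa). Qed.

Lemma is_derive1N f t (a : R) : is_derive t 1 f a ->
  is_derive t 1 (fun s => - f s) (- a).
Proof. by move=> fa; exact: (is_deriveN fa). Qed.

Lemma is_derive1_expR f t (a : R) : is_derive t 1 f a ->
  is_derive t 1 (fun s => expR (f s)) (expR (f t) * a).
Proof. by move=> fa; exact: (is_derive1_comp (is_derive_expR (f t)) fa). Qed.

Lemma is_derive1_cos f t (a : R) : is_derive t 1 f a ->
  is_derive t 1 (fun s => cos (f s)) (- sin (f t) * a).
Proof. by move=> fa; exact: (is_derive1_comp (is_derive_cos (f t)) fa). Qed.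

Lemma is_derive1_sin f t (a : R) : is_derive t 1 f a ->
  is_derive t 1 (fun s => sin (f s)) (cos (f t) * a).
Proof. by move=> fa; exact: (is_derive1_comp (is_derive_sin (f t)) fa). Qed.

Lemma is_derive_continuous f t (a : R) : is_derive t 1 f a -> {for t, continuous f}.
Proof. by move=> [fd _]; apply: differentiable_continuous; apply/derivable1_diffP. Qed.

Lemma derive_le_incr f (df : R -> R) (K a b : R) : a <= b ->
  (forall t, a <= t <= b -> is_derive t 1 f (df t)) ->
  (forall t, a <= t <= b -> df t <= K) -> f b - f a <= K * (b - a).
Proof.
rewrite le_eqVlt => /predU1P[->|ab] fd dK; first by rewrite !subrr mulr0.
have [||c /andP[ac cb] ->] := @MVT R f df a b ab.
- by move=> t; rewrite in_itv /= => /andP[/ltW h1 /ltW h2]; apply: fd; rewrite h1.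
- apply: continuous_in_subspaceT => t; rewrite inE /= in_itv /= => h.
  by apply: is_derive_continuous; exact: fd.
- by rewrite ler_pM2r ?subr_gt0 // dK // !ltW.
Qed.

Lemma derive_bound f (df : R -> R) (K a b : R) : a <= b ->
  (forall t, a <= t <= b -> is_derive t 1 f (df t)) ->
  (forall t, a <= t <= b -> `|df t| <= K) -> `|f b - f a| <= K * (b - a).
Proof.
move=> ab fd dK; rewrite ler_norml; apply/andP; split; last first.
  by apply: (derive_le_incr ab fd) => t /dK; apply: le_trans; exact: ler_norm.
have := @derive_le_incr (fun s => - f s) (fun s => - df s) K a b ab.
rewrite -opprD => h; rewrite lerNl; rewrite opprB addrC in h *.
apply: h => t tab; first exact: is_derive1N (fd _ tab).
by apply: le_trans (dK _ tab); rewrite -normrN ler_norm.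
Qed.

Lemma derive_seq f (a : R) (h : nat -> R) : is_derive (0 : R) 1 f a ->
  h @ \oo --> 0 -> (forall n, h n != 0) ->
  (fun n => (h n)^-1 * (f (h n) - f 0)) @ \oo --> a.
Proof.
move=> [fd <-] h0 hn0.
have /cvgr_dnbhsP/(_ h) := fd.
rewrite /derive; set l := lim _ => /(_ (conj hn0 h0)).
apply: cvg_trans; apply: near_eq_cvg; apply: nearW => n /=.
by rewrite /shift /= addr0 /GRing.scale /= mulr1.
Qed.

End RealDerive.

(** * Logarithmic derivatives *)

Section ComplexDerive.
Variable R : realType.
Implicit Types (f g : R -> R[i]) (t : R) (a b d : R[i]).

(** Only a real variable occurs: the transformation law is propagated along a segment, so real and
    imaginary parts are differentiated separately. *)
Definition cderiv f t d :=
  is_derive t 1 (fun s => complex.Re (f s)) (complex.Re d) /\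
  is_derive t 1 (fun s => complex.Im (f s)) (complex.Im d).

Lemma cderiv_eq f t a b : cderiv f t a -> a = b -> cderiv f t b.
Proof. by move=> h <-. Qed.

Lemma cderiv_cst c t : cderiv (fun=> c) t 0.
Proof. by split; exact: is_derive_cst. Qed.

Lemma cderivD f g t a b : cderiv f t a -> cderiv g t b ->
  cderiv (fun s => f s + g s) t (a + b).
Proof.
move=> [f1 f2] [g1 g2]; split.
  rewrite cReD; under eq_fun do rewrite cReD; exact: is_derive1D.
rewrite cImD; under eq_fun do rewrite cImD; exact: is_derive1D.
Qed.

Lemma cderivM f g t a b : cderiv f t a -> cderiv g t b ->
  cderiv (fun s => f s * g s) t (a * g t + f t * b).
Proof.
move=> [f1 f2] [g1 g2]; split.
  under eq_fun do rewrite cReM.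
  apply: is_derive_eq (is_derive1B (is_derive1M f1 g1) (is_derive1M f2 g2)) _.
  by rewrite cReD !cReM; ring.
under eq_fun do rewrite cImM.
apply: is_derive_eq (is_derive1D (is_derive1M f1 g2) (is_derive1M f2 g1)) _.
by rewrite cImD !cImM; ring.
Qed.

Lemma cderivZ f t a c : cderiv f t a -> cderiv (fun s => c * f s) t (c * a).
Proof.
move=> fa; apply: cderiv_eq (cderivM (cderiv_cst c t) fa) _.
by rewrite mul0r add0r.
Qed.

Lemma cderivN f t a : cderiv f t a -> cderiv (fun s => - f s) t (- a).
Proof.
move=> /(cderivZ (-1)); rewrite mulN1r.
by under [X in cderiv X]eq_fun do rewrite mulN1r.
Qed.

Lemma cderivB f g t a b : cderiv f t a -> cderiv g t b ->
  cderiv (fun s => f s - g s) t (a - b).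
Proof. by move=> fa /cderivN; exact: cderivD. Qed.

Lemma cderiv_real t : cderiv (fun s => s%:C%C) t 1.
Proof. by split; [exact: is_derive_id|exact: is_derive_cst]. Qed.

Lemma is_derive1V (f : R -> R) t (a : R) : f t != 0 -> is_derive t 1 f a ->
  is_derive t 1 (fun s => (f s)^-1) (- (f t) ^- 2 * a).
Proof. by move=> ft fa; exact: (is_deriveV ft). Qed.

Lemma cderivV f t a : f t != 0 -> cderiv f t a ->
  cderiv (fun s => (f s)^-1) t (- a / f t ^+ 2).
Proof.
move=> ft0 [f1 f2].
have n0 : cabs (f t) ^+ 2 != 0 by rewrite expf_neq0 // cabs_eq0.
have h : is_derive t 1 (fun s => (cabs (f s) ^+ 2)^-1)
    (- (cabs (f t) ^+ 2) ^- 2 * (2 * (complex.Re (f t) * complex.Re a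
       + complex.Im (f t) * complex.Im a))).
  apply: is_derive1V => //; under eq_fun do rewrite cabs_sqr !expr2.
  apply: is_derive_eq (is_derive1D (is_derive1M f1 f1) (is_derive1M f2 f2)) _.
  ring.
move: n0 h; rewrite cabs_sqr => n0 h; split.
  under eq_fun do rewrite cReV.
  apply: is_derive_eq (is_derive1M f1 h) _.
  rewrite cReM cReN cImN cReV cImV cabsX cabs_sqr expr2 cReM cImM -expr2; field.
  by rewrite n0.
under eq_fun do rewrite cImV.
apply: is_derive_eq (is_derive1M (is_derive1N f2) h) _.
rewrite cImM cReN cImN cReV cImV cabsX cabs_sqr expr2 cReM cImM -expr2; field.
by rewrite n0.
Qed.

Lemma cderiv_qexp f t a : cderiv f t a ->
  cderiv (fun s => qexp (f s)) t (2 * pi%:C%C * 'i%C * a * qexp (f t)).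
Proof.
move=> [f1 f2].
have he := is_derive1_expR (is_derive1N (is_derive1Z (2 * pi) f2)).
split.
  apply: is_derive_eq (is_derive1M he (is_derive1_cos (is_derive1Z (2 * pi) f1))) _.
  rewrite !(cReM, cImM) complex_natE /=; ring.
apply: is_derive_eq (is_derive1M he (is_derive1_sin (is_derive1Z (2 * pi) f1))) _.
rewrite !(cReM, cImM) complex_natE /=; ring.
Qed.

(** Nonvanishing is part of the predicate, so that products, powers and inverses compose without
    side conditions. *)
Definition cdlog f t a := f t != 0 /\ cderiv f t (f t * a).

Lemma cdlog_eq f t a b : cdlog f t a -> a = b -> cdlog f t b.
Proof. by move=> h <-. Qed.

Lemma cdlogM f g t a b : cdlog f t a -> cdlog g t b ->
  cdlog (fun s => f s * g s) t (a + b).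
Proof.
move=> [f0 fa] [g0 gb]; split; first by rewrite mulf_neq0.
apply: cderiv_eq (cderivM fa gb) _; ring.
Qed.

Lemma cdlog1 t : cdlog (fun=> 1) t 0.
Proof. by split; [exact: oner_neq0|rewrite mulr0; exact: cderiv_cst]. Qed.

Lemma cdlogX f t a n : cdlog f t a -> cdlog (fun s => f s ^+ n) t (n%:R * a).
Proof.
move=> fa; elim: n => [|n IH].
  by rewrite mul0r; under [X in cdlog X]eq_fun do rewrite expr0; exact: cdlog1.
under [X in cdlog X]eq_fun do rewrite exprS.
by apply: cdlog_eq (cdlogM fa IH) _; rewrite -natr1; ring.
Qed.

Lemma cdlogV f t a : cdlog f t a -> cdlog (fun s => (f s)^-1) t (- a).
Proof.
move=> [f0 fa]; split; first by rewrite invr_neq0.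
by apply: cderiv_eq (cderivV f0 fa) _; field.
Qed.

Lemma cdlog_prod (I : Type) (r : seq I) (F : I -> R -> R[i]) (c : I -> R[i]) t :
  (forall i, cdlog (F i) t (c i)) ->
  cdlog (fun s => \prod_(i <- r) F i s) t (\sum_(i <- r) c i).
Proof.
move=> h; elim: r => [|i r IH].
  by rewrite big_nil; under [X in cdlog X]eq_fun do rewrite big_nil; exact: cdlog1.
rewrite big_cons; under [X in cdlog X]eq_fun do rewrite big_cons.
exact: cdlogM.
Qed.

(* Gronwall: the squared modulus grows at most like [exp (2 t)], so [f] itself
   is bounded and its increment is controlled by the logarithmic derivative. *)
Lemma cdlog_small f (a : R -> R[i]) (e : R) : e <= 1 ->
  (forall t, 0 <= t <= 1 -> cdlog f t (a t)) ->
  (forall t, 0 <= t <= 1 -> cabs (a t) <= e) ->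
  cabs (f 1 - f 0) <= 2 * expR 1 * cabs (f 0) * e.
Proof.
move=> e1 fa ae.
have fb t : 0 <= t <= 1 -> cabs (f t) <= expR 1 * cabs (f 0).
  move=> /andP[t0 t1].
  pose h s := expR (- (2 * s)) * cabs (f s) ^+ 2.
  have hd s : 0 <= s <= t -> is_derive s 1 h
     (expR (- (2 * s)) * (2 * (complex.Re (a s) - 1) * cabs (f s) ^+ 2)).
    move=> /andP[s0 st]; have [|_ [f1 f2]] := fa s.
      by rewrite s0 (le_trans st).
    rewrite /h; under eq_fun do rewrite cabs_sqr !expr2.
    apply: is_derive_eq (is_derive1M
      (is_derive1_expR (is_derive1N (is_derive1Z 2 (is_derive_id s 1))))
      (is_derive1D (is_derive1M f1 f1) (is_derive1M f2 f2))) _.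
    rewrite cabs_sqr cReM cImM; ring.
  have hn s : 0 <= s <= t ->
     expR (- (2 * s)) * (2 * (complex.Re (a s) - 1) * cabs (f s) ^+ 2) <= 0.
    move=> /andP[s0 st]; rewrite mulr_ge0_le0 ?expR_ge0 //.
    rewrite mulr_le0_ge0 ?sqr_ge0 // mulr_ge0_le0 // subr_le0.
    apply: le_trans (ler_norm _) _; apply: le_trans (cabs_Re _) _.
    by apply: le_trans e1; apply: ae; rewrite s0 (le_trans st).
  have := derive_le_incr t0 hd hn.
  rewrite mul0r subr_le0 /h mulr0 oppr0 expR0 mul1r expRN ler_pdivrMl ?expR_gt0 //.
  move=> h1; rewrite -(@ler_pXn2r _ 2) ?nnegrE ?mulr_ge0 ?cabs_ge0 ?expR_ge0 //.
  apply: le_trans h1 _; rewrite exprMn ler_wpM2r ?sqr_ge0 //.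
  by rewrite -expRM_natl ler_expR ler_pM2l.
have db t : 0 <= t <= 1 -> cabs (f t * a t) <= expR 1 * cabs (f 0) * e.
  by move=> t01; rewrite cabsM ler_pM ?cabs_ge0 ?fb ?ae.
have h1 := @derive_bound R (fun s => complex.Re (f s)) _ _ 0 1 ler01
  (fun t ht => (fa t ht).2.1) (fun t ht => le_trans (cabs_Re _) (db t ht)).
have h2 := @derive_bound R (fun s => complex.Im (f s)) _ _ 0 1 ler01
  (fun t ht => (fa t ht).2.2) (fun t ht => le_trans (cabs_Im _) (db t ht)).
apply: le_trans (cabs_le_ReIm _) _; rewrite cReD cReN cImD cImN.
move: h1 h2; rewrite subr0 !mulr1 => h1 h2.
by apply: le_trans (lerD h1 h2) _; rewrite -!mulrA; lra.
Qed.

(** The derivative of exp(2 pi i t s) at t = 0, sampled at t = 1/(2n+1). Odd denominators match the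
    symmetric sums over -n, ..., n used for partial fractions. *)
Lemma qexp_scaled_cvg (s : R[i]) :
  ccvg (fun n => (n.*2.+1)%:R * (qexp (s / (n.*2.+1)%:R) - 1)) (2 * pi%:C%C * 'i%C * s).
Proof.
have z0 : (0 : R)%:C%C * s = 0 by rewrite mul0r.
have [d1 d2] : cderiv (fun t => qexp (t%:C%C * s)) 0 (2 * pi%:C%C * 'i%C * s).
  apply: cderiv_eq (cderiv_qexp (cderivM (cderiv_real 0) (cderiv_cst s 0))) _.
  by rewrite z0 qexp0 !mulr1 mul1r mulr0 addr0.
pose h n : R := (n.*2.+1)%:R^-1.
have h0 : h @ \oo --> 0.
  apply/cvgr0Pnorm_le => e e0; have [N hN] := archi_inv 1 e0.
  exists N => // n /= /hN; rewrite mul1r => /ltW hn.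
  rewrite /h ger0_norm ?invr_ge0 //; apply: le_trans hn.
  by rewrite lef_pV2 ?posrE ?ltr0n // ler_nat ltnS -addnn leq_addr.
have hn0 n : h n != 0 by rewrite invr_neq0 // pnatr_eq0.
have e1 := derive_seq d1 h0 hn0; have e2 := derive_seq d2 h0 hn0.
move: e1 e2; rewrite z0 qexp0.
have E n : (n.*2.+1)%:R * (qexp (s / (n.*2.+1)%:R) - 1) =
   ((h n)^-1)%:C%C * (qexp ((h n)%:C%C * s) - 1).
  rewrite /h invrK -complex_natE; congr (_ * (qexp _ - _)).
  by rewrite mulrC complex_natE -fmorphV.
move=> e1 e2; apply: ccvg_ReIm.
  under eq_fun do rewrite E cReM /= mul0r subr0 ?cReD ?cReN; exact: e1.
under eq_fun do rewrite E cImM /= mul0r addr0 ?cImD ?cImN; exact: e2.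
Qed.

End ComplexDerive.

(** * Sine bounds and roots of unity *)

Section SineBounds.
Variable R : realType.
Implicit Types (s t : R) (z : R[i]).

Lemma cos_nincr s t : 0 <= s -> s <= t -> t <= pi -> cos t <= cos s.
Proof.
move=> s0 st tp; have t0 := le_trans s0 st; have sp := le_trans st tp.
have hs : s \in `[0, pi] by rewrite in_itv /= s0.
have ht : t \in `[0, pi] by rewrite in_itv /= t0.
by rewrite leNgt (ltr_cos ht hs) -leNgt.
Qed.

Lemma cos_piquarter_ge : 2^-1 <= cos (pi / 4) :> R.
Proof.
have h : cos (pi / 4) ^+ 2 = 2^-1 :> R.
  have e : pi / 4 *+ 2 = pi / 2 :> R by rewrite -mulr_natl; field.
  have := cos_mulr2n (pi / 4 : R); rewrite e cos_pihalf; lra.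
have p0 : 0 < pi :> R := pi_gt0 R.
have c0 : 0 <= cos (pi / 4) :> R by apply: cos_ge0_pihalf; apply/andP; split; lra.
rewrite -(@ler_pXn2r _ 2) ?nnegrE ?invr_ge0 // h; lra.
Qed.

Lemma sin_ge_half t : 0 <= t <= pi / 4 -> t / 2 <= sin t.
Proof.
move=> /andP[t0 t4].
have p0 : 0 < pi :> R := pi_gt0 R.
have d x : 0 <= x <= t -> is_derive x 1 (fun s : R => - sin s) (- cos x).
  by move=> _; exact: is_derive1N.
have hx x : 0 <= x <= t -> - cos x <= - 2^-1.
  move=> /andP[x0 xt]; rewrite lerN2; apply: le_trans cos_piquarter_ge _.
  by apply: cos_nincr; lra.
have := derive_le_incr t0 d hx; rewrite sin0; lra.
Qed.

Lemma sin3 t : sin (3 * t) = sin t * (3 - 4 * sin t ^+ 2).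
Proof.
have -> : 3 * t = t *+ 2 + t by ring.
rewrite sinD sin_mulr2n cos_mulr2n.
have := cos2sin2 t; set c := cos t; set s := sin t => h.
have -> : (c * s) *+ 2 * c + (c ^+ 2 *+ 2 - 1) * s = s * (4 * c ^+ 2 - 1) by ring.
by rewrite h; ring.
Qed.

(** The triple-angle formula reduces to x = t/3 in [0, pi/4], where sin x >= x/2 and sin^2 x <= 1/2
    leaves 3 - 4 sin^2 x >= 1. *)
Lemma sin_ge_sixth t : 0 <= t <= 3 * pi / 4 -> t / 6 <= sin t.
Proof.
move=> /andP[t0 t4].
have p0 : 0 < pi :> R := pi_gt0 R.
have -> : t = 3 * (t / 3) by field.
rewrite sin3; set x := t / 3.
have x0 : 0 <= x <= pi / 4 by apply/andP; split; rewrite /x; lra.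
have h1 := sin_ge_half x0; have {}x0 := andP x0.
have h2 : sin x ^+ 2 <= 2^-1.
  rewrite sin2cos2; have := cos_piquarter_ge.
  have e : pi / 4 *+ 2 = pi / 2 :> R by rewrite -mulr_natl; field.
  have := cos_mulr2n (pi / 4 : R); rewrite e cos_pihalf.
  have h : cos (pi / 4) <= cos x.
    by case: x0 => ? ?; apply: cos_nincr; lra.
  nra.
have s0 : 0 <= sin x by lra.
nra.
Qed.

(** The range 3/4 covers the real parts of the arguments (w + k)/(2n+1) and (w - k)/(2n+1) with 2
    |Re w| <= k <= n. *)
Lemma sin_pi_ge s : `|s| <= 3 / 4 -> `|s| / 3 <= `|sin (pi * s)|.
Proof.
move=> hs.
have e : `|sin (pi * s)| = sin (pi * `|s|).
  have hp t : 0 <= t <= 3 / 4 -> 0 <= sin (pi * t).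
    move=> /andP[t0 t34]; apply: sin_ge0_pi; have := pi_gt0 R; nra.
  have [s0|s0] := leP 0 s.
    by move: hs; rewrite !(ger0_norm s0) => hs; rewrite ger0_norm // hp // s0.
  rewrite (ltr0_norm s0) mulrN sinN -normrN ger0_norm // -sinN -mulrN hp //.
  by move: hs; rewrite ltr0_norm // => hs; apply/andP; split; lra.
have := pi_ge2 R; have := normr_ge0 s => h0 p2.
have : pi * `|s| / 6 <= sin (pi * `|s|) by apply: sin_ge_sixth; nra.
rewrite e; nra.
Qed.

(** From sin t <= t at t = pi/6. The value sin(pi/6) = 1/2 holds because the triple-angle formula
    makes it a nonnegative root of 4 x^3 - 3 x + 1 = (x + 1)(2 x - 1)^2. *)
Lemma pi_ge3 : 3 <= pi :> R.
Proof.
have p0 : 0 < pi :> R := pi_gt0 R.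
have : sin (pi / 6) <= pi / 6 :> R.
  have d (x : R) : 0 <= x <= pi / 6 -> is_derive x 1 sin (cos x).
    by move=> _; exact: is_derive_sin.
  have := derive_le_incr _ d (fun x _ => cos_le1 x); rewrite sin0 !subr0 mul1r.
  by apply; lra.
suff : sin (pi / 6) = 2^-1 :> R by lra.
have := sin3 (pi / 6 : R); have -> : 3 * (pi / 6) = pi / 2 :> R by field.
have : 0 <= sin (pi / 6) :> R by apply: sin_ge0_pi; lra.
rewrite sin_pihalf; set x := sin _ => x0 h.
have : (x - 2^-1) ^+ 2 * (x + 1) = 0 by move: h; rewrite !expr2; nra.
move/eqP; rewrite mulf_eq0 expf_eq0 /= => /orP[/eqP|/eqP]; lra.
Qed.

(** The difference of the two sides is exactly (1 - r)^2, where r is the modulus of [qexp z]. *)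
Lemma cabs_1subqexp z :
  4 * expR (- (2 * pi * complex.Im z)) * sin (pi * complex.Re z) ^+ 2
    <= cabs (1 - qexp z) ^+ 2.
Proof.
rewrite cabs_sqr cReD cImD cReN cImN /=; set r := expR _; set x := pi * _.
have -> : 2 * pi * complex.Re z = x *+ 2 by rewrite /x -mulr_natl; ring.
rewrite cos_mulr2n sin_mulr2n.
have h := cos2sin2 x; set c := cos x in h *; set s := sin x in h *.
have -> : (1 - r * (c ^+ 2 *+ 2 - 1)) ^+ 2 + (0 - r * ((c * s) *+ 2)) ^+ 2 =
   (1 - r * (c ^+ 2 *+ 2 - 1)) ^+ 2 + 4 * r ^+ 2 * c ^+ 2 * s ^+ 2 by ring.
rewrite h -subr_ge0.
have -> : (1 - r * ((1 - s ^+ 2) *+ 2 - 1)) ^+ 2 + 4 * r ^+ 2 * (1 - s ^+ 2) * s ^+ 2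
   - 4 * r * s ^+ 2 = (1 - r) ^+ 2 by ring.
exact: sqr_ge0.
Qed.

End SineBounds.

Section RootsOfUnity.
Variable R : realType.
Implicit Types (y z w : R[i]).

Lemma qexp_frac_neq1 N j : (0 < j < N)%N -> qexp (j%:R / N%:R) != 1 :> R[i].
Proof.
move=> /andP[j0 jN]; have N0 : (0 < N)%N by apply: leq_trans jN.
rewrite eq_sym -subr_eq0 -cabs_gt0 -(@ltr_pXn2r _ 2) ?nnegrE ?cabs_ge0 //.
rewrite expr0n /=; apply: lt_le_trans (cabs_1subqexp _).
have -> : (j%:R / N%:R : R[i]) = (j%:R / N%:R)%:C%C by rewrite rmorphM fmorphV !rmorph_nat.
rewrite /=; apply: mulr_gt0; first by rewrite mulr_gt0 ?expR_gt0.
apply: exprn_gt0; apply: sin_gt0_pi.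
rewrite mulr_gt0 ?pi_gt0 ?divr_gt0 ?ltr0n //= -[ltRHS]mulr1 ltr_pM2l ?pi_gt0 //.
by rewrite ltr_pdivrMr ?ltr0n // mul1r ltr_nat.
Qed.

Lemma qexp_frac_mod N j : (0 < N)%N -> qexp (j%:R / N%:R) = qexp ((j %% N)%:R / N%:R) :> R[i].
Proof.
move=> N0; rewrite {1}(divn_eq j N) natrD natrM mulrDl mulfK ?pnatr_eq0 -?lt0n //.
by rewrite qexpD qexp_nat mul1r.
Qed.

Lemma sum_roots_unity N j : (0 < N)%N ->
  \sum_(k < N) qexp (j%:R / N%:R) ^+ k = (if (N %| j)%N then N%:R else 0) :> R[i].
Proof.
move=> N0; have N0' : N%:R != 0 :> R[i] by rewrite pnatr_eq0 -lt0n.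
case: ifPn => [|] Nj.
  rewrite qexp_frac_mod // (eqP Nj) mul0r qexp0; under eq_bigr do rewrite expr1n.
  by rewrite sumr_const card_ord.
have h : qexp (j%:R / N%:R) != 1 :> R[i].
  by rewrite qexp_frac_mod // qexp_frac_neq1 // ltn_mod N0 andbT lt0n.
apply: (@mulfI _ (qexp (j%:R / N%:R) - 1)); first by rewrite subr_eq0.
by rewrite -subrX1 mulr0 -qexpMn mulrCA divff // mulr1 qexp_nat subrr.
Qed.

(** Each 1/(1 - w) with w^N = y^N is a geometric sum of length N divided by 1 - y^N, and summing
    over the N roots w keeps only exponents divisible by N. For the squares the exponents j + l that
    survive are 0, once, and N, for the N - 1 nonzero values of j. These are finite forms of the
    partial fractions of cot and 1/sin^2. *)
Lemma sum_geom_roots N y : (0 < N)%N -> y ^+ N != 1 ->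
  \sum_(k < N) (1 - y * qexp (N%:R^-1) ^+ k)^-1 = N%:R / (1 - y ^+ N) /\
  \sum_(k < N) (1 - y * qexp (N%:R^-1) ^+ k) ^- 2
    = N%:R * (1 + N.-1%:R * y ^+ N) / (1 - y ^+ N) ^+ 2.
Proof.
move=> N0 yN; set q : R[i] := qexp _.
have qN : q ^+ N = 1.
  by rewrite /q -qexpMn divff ?qexp1 // pnatr_eq0 -lt0n.
have x1 : 1 - y ^+ N != 0 by rewrite subr_eq0 eq_sym.
have geo k : (1 - y * q ^+ k) * \sum_(j < N) (y * q ^+ k) ^+ j = 1 - y ^+ N.
  have := subrX1 (y * q ^+ k) N; rewrite exprMn -exprM mulnC exprM qN expr1n mulr1 => e.
  by rewrite -opprB mulNr -e opprB.
have nz k : 1 - y * q ^+ k != 0.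
  by apply: contra_neq x1 => h; rewrite -(geo k) h mul0r.
have inv k : (1 - y * q ^+ k)^-1 = (\sum_(j < N) (y * q ^+ k) ^+ j) / (1 - y ^+ N).
  by apply: (mulfI (nz k)); rewrite divff // mulrA geo divff.
have filt j : \sum_(k < N) (y * q ^+ k) ^+ j = y ^+ j * (if (N %| j)%N then N%:R else 0).
  rewrite -(sum_roots_unity j N0) mulr_sumr; apply: eq_bigr => k _.
  by rewrite exprMn -exprM mulnC exprM /q !qexpMn.
split.
  under eq_bigr do rewrite inv; rewrite -mulr_suml exchange_big /=; congr (_ / _).
  under eq_bigr do rewrite filt.
  case: N N0 {yN q qN x1 geo nz inv filt} => // N _.
  rewrite big_ord_recl big1 => [|i _]; first by rewrite expr0 mul1r addr0.
  by rewrite lift0 gtnNdvd ?mulr0 // ltnS ltn_ord.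
under eq_bigr do rewrite -exprVn inv exprMn exprVn.
rewrite -mulr_suml; congr (_ / _).
under eq_bigr do rewrite expr2 big_distrlr /=.
rewrite exchange_big /=.
have E (j : 'I_N) : \sum_(k < N) \sum_(l < N) (y * q ^+ k) ^+ j * (y * q ^+ k) ^+ l =
   if j == 0%N :> nat then N%:R else N%:R * y ^+ N.
  rewrite exchange_big /=.
  under eq_bigr => l _ do (under eq_bigr do rewrite -exprD; rewrite filt).
  have l0 : ((N - j) %% N < N)%N by rewrite ltn_mod.
  rewrite (bigD1 (Ordinal l0)) //= big1 ?addr0.
    case: (posnP j) => [->|j0].
      by rewrite subn0 modnn dvdn0 expr0 mul1r.
    rewrite modn_small; last by rewrite ltn_subrL j0.
    by rewrite subnKC ?dvdnn 1?mulrC // ltnW.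
  move=> l /eqP lj; rewrite ifN ?mulr0 //; apply/negP => d; apply: lj; apply: val_inj => /=.
  have lN := ltn_ord l; have jN := ltn_ord j.
  have [/eqP jl0|jl0] := boolP (j + l == 0)%N.
    have [-> ->] : (j : nat) = 0%N /\ (l : nat) = 0%N by lia.
    by rewrite subn0 modnn.
  have jlN : (j + l = N)%N.
    move/dvdnP: d => [[|[|m]] h]; [lia|lia|exfalso].
    have h2 : (2 * N <= m.+2 * N)%N by rewrite leq_mul2r orbT.
    lia.
  by rewrite modn_small; lia.
rewrite (eq_bigr _ (fun j _ => E j)).
case: N N0 {yN q qN x1 geo nz inv filt E} => // N _.
rewrite big_ord_recl /= sumr_const card_ord -mulr_natl; ring.
Qed.

End RootsOfUnity.

(** * Partial fractions *)

Section PartialFractions.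
Variable R : realType.
Implicit Types (z w s y : R[i]).

Lemma sum_inv_sqr_tail (K N : nat) : (0 < K)%N ->
  \sum_(K <= k < N) (k.+1%:R ^+ 2)^-1 <= K%:R^-1 :> R.
Proof.
move=> K0; have K0' : 0 <= K%:R^-1 :> R by rewrite invr_ge0.
have [NK|KN] := leqP N K; first by rewrite big_geq.
suff : \sum_(K <= k < N) (k.+1%:R ^+ 2)^-1 <= K%:R^-1 - N%:R^-1 :> R.
  by move/le_trans; apply; rewrite lerBlDr lerDl invr_ge0.
have := telescope_sumr (fun k => - (k%:R^-1 : R)) (ltnW KN); rewrite opprK addrC => <-.
apply: ler_sum_nat => k /andP[Kk _].
have k0 : 0 < k%:R :> R by rewrite ltr0n (leq_trans K0).
have -> : - k.+1%:R^-1 - - k%:R^-1 = ((k%:R * (k%:R + 1))^-1 : R).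
  by rewrite -natr1; field; rewrite !gt_eqF //; lra.
rewrite -natr1.
by rewrite lef_pV2 ?posrE ?mulr_gt0 ?exprn_gt0 //; nra.
Qed.

Lemma sum_inv_sqr_le2 N : \sum_(k < N) (k.+1%:R ^+ 2)^-1 <= 2 :> R.
Proof.
case: N => [|N]; first by rewrite big_ord0.
rewrite -(big_mkord xpredT (fun k => (k.+1%:R ^+ 2)^-1 : R)) big_ltn // expr1n invr1.
by have := @sum_inv_sqr_tail 1 N.+1 isT; rewrite invr1; lra.
Qed.

(** Dominated convergence for sums whose length grows with N. Domination is asked only from [K0] on,
    because the shifts w + k and w - k have a large real part only once k exceeds 2 |Re w|. *)
Lemma tannery (a : nat -> nat -> R[i]) (b : nat -> R[i]) (S : R[i]) (B : R) (K0 N0 : nat) :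
  (forall k, ccvg (fun N => a N k) (b k)) ->
  (forall N k, (N0 <= N)%N -> (K0 <= k < N)%N -> cabs (a N k) <= B / k.+1%:R ^+ 2) ->
  ccvg (fun N => \sum_(k < N) a N k) S ->
  ccvg (fun N => \sum_(k < N) b k) S.
Proof.
move=> ab aB aS e e0; have e4 : 0 < e / 4 by rewrite divr_gt0.
have bB k : (K0 <= k)%N -> cabs (b k) <= B / k.+1%:R ^+ 2.
  move=> Kk; apply: (ccvg_le (N := maxn N0 k.+1)) (ab k) _ => n.
  by rewrite geq_max => /andP[h1 h2]; apply: aB; rewrite // Kk.
have B0 : 0 <= B.
  have := le_trans (cabs_ge0 _) (bB K0 (leqnn _)).
  by rewrite pmulr_lge0 // invr_gt0 exprn_gt0.
have [K1 hK1] := archi_inv B e4.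
pose K := (maxn K0 K1).+1.
have KB : B / K%:R < e / 4 by apply: hK1; exact: leq_maxr.
have [N1 hN1] := aS _ e4.
have [N2 hN2] := ccvg_sum (index_enum 'I_K) (fun k : 'I_K => ab k) e4.
exists (maxn (maxn N0 N1) (maxn N2 K)) => N; rewrite !geq_max => /andP[/andP[h0 h1] /andP[h2 hK]].
have tailP (f : nat -> R[i]) : (forall k, (K0 <= k < N)%N -> cabs (f k) <= B / k.+1%:R ^+ 2) ->
    cabs (\sum_(K <= k < N) f k) <= B / K%:R.
  move=> fB; apply: le_trans (cabs_sum _ _ _) _.
  apply: (@le_trans _ _ (\sum_(K <= k < N) B * (k.+1%:R ^+ 2)^-1)).
    apply: ler_sum_nat => k /andP[Kk kN]; apply: fB; rewrite kN andbT.
    by apply: leq_trans Kk; rewrite /K leqW ?leq_maxl.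
  by rewrite -mulr_sumr ler_wpM2l // sum_inv_sqr_tail.
have t1 := tailP b (fun k => fun h => bB k (proj1 (andP h))).
have t2 := tailP (a N) (fun k h => aB N k h0 h).
have split (f : nat -> R[i]) : \sum_(k < N) f k = \sum_(k < K) f k + \sum_(K <= k < N) f k.
  by rewrite -!(big_mkord xpredT f) (big_cat_nat (n := K)).
have := hN2 _ h2; have := hN1 _ h1; rewrite (split (a N)) (split b).
set A1 := \sum_(k < K) _; set A2 := \sum_(K <= k < N) a N k.
set B1 := \sum_(k < K) _; set B2 := \sum_(K <= k < N) b k => u1 u2.
have -> : B1 + B2 - S = - (A1 - B1) + (B2 - A2) + (A1 + A2 - S) by ring.
apply: le_lt_trans (cabsD _ _) _.
apply: (@le_lt_trans _ _ (cabs (A1 - B1) + (cabs B2 + cabs A2) + cabs (A1 + A2 - S))).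
  rewrite lerD2r; apply: le_trans (cabsD _ _) _.
  by rewrite cabsN lerD2l cabsB.
lra.
Qed.

Lemma sum_centered (G : nat -> R[i]) n :
  \sum_(k < n.*2.+1) G k = G n + \sum_(k < n) (G (n + k.+1)%N + G (n - k.+1)%N).
Proof.
rewrite -(big_mkord xpredT G) (big_cat_nat (n := n)) //=; last by lia.
rewrite (big_ltn (m := n)); last by lia.
rewrite addrCA; congr (_ + _); rewrite big_split /= addrC; congr (_ + _).
  rewrite -{1}[n.+1]add0n big_addn; have -> : (n.*2.+1 - n.+1 = n)%N by lia.
  by rewrite big_mkord; apply: eq_bigr => i _; congr G; lia.
by rewrite big_nat_rev big_mkord; apply: eq_bigr => i _; congr G; lia.
Qed.

(** A root of [qexp s] of odd order 2n+1, so that the shifts of s by -n, ..., n give all such roots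
    exactly once. *)
Let nth_root (n : nat) s := qexp (s / (n.*2.+1)%:R).

Let nth_rootX n s : nth_root n s ^+ n.*2.+1 = qexp s.
Proof. by rewrite /nth_root -qexpMn mulrCA divff ?mulr1 ?pnatr_eq0. Qed.

Let nth_root_neq1 n s : qexp s != 1 -> nth_root n s != 1.
Proof. by apply: contra_neq => h; rewrite -(nth_rootX n s) h expr1n. Qed.

Let qroot n : qexp ((n.*2.+1)%:R^-1) ^+ n.*2.+1 = 1 :> R[i].
Proof. by rewrite -qexpMn divff ?qexp1 ?pnatr_eq0. Qed.

Let qexp_shift w (k : nat) : qexp (w + k%:R) = qexp w /\ qexp (w - k%:R) = qexp w.
Proof. by rewrite qexpD (qexpD w) qexpN qexp_nat invr1 !mulr1. Qed.

Let sum_roots_centered (G : R[i] -> R[i]) n w :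
  \sum_(k < n.*2.+1) G (nth_root n (w - n%:R) * qexp ((n.*2.+1)%:R^-1) ^+ k) =
  G (nth_root n w) + \sum_(k < n) (G (nth_root n (w + k.+1%:R)) + G (nth_root n (w - k.+1%:R))).
Proof.
rewrite (sum_centered (fun k => G (nth_root n (w - n%:R) * qexp ((n.*2.+1)%:R^-1) ^+ k))).
have E k : nth_root n (w - n%:R) * qexp ((n.*2.+1)%:R^-1) ^+ k = nth_root n (w - n%:R + k%:R).
  by rewrite /nth_root [in RHS]mulrDl [in RHS]qexpD -qexpMn.
rewrite E; congr (G (nth_root n _) + _); first by ring.
apply: eq_bigr => k _; rewrite !E natrB // natrD.
by congr (G (nth_root n _) + G (nth_root n _)); ring.
Qed.

(** With M = 2n+1, [Ac] is (pi/M) cot(pi s/M) and [Bc] is (pi/M)^2 / sin^2(pi s/M): approximations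
    of 1/s and 1/s^2 whose symmetric sums are independent of n. *)
Let Ac n s : R[i] := pi%:C%C * 'i%C / (n.*2.+1)%:R * ((nth_root n s + 1) / (nth_root n s - 1)).
Let Bc n s : R[i] := (2 * pi%:C%C * 'i%C / (n.*2.+1)%:R) ^+ 2 * (nth_root n s / (1 - nth_root n s) ^+ 2).

Let Ac_sum n w : qexp w != 1 ->
  Ac n w + \sum_(k < n) (Ac n (w + k.+1%:R) + Ac n (w - k.+1%:R)) =
  pi%:C%C * 'i%C * (qexp w + 1) / (qexp w - 1).
Proof.
move=> w1.
pose G y := pi%:C%C * 'i%C / (n.*2.+1)%:R * ((y + 1) / (y - 1)) : R[i].
rewrite -(sum_roots_centered G n w) /G -mulr_sumr.
have [_ qwn] := qexp_shift w n.
have x1 : nth_root n (w - n%:R) ^+ n.*2.+1 != 1 by rewrite nth_rootX qwn.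
have [] := sum_geom_roots (ltn0Sn n.*2) x1.
rewrite nth_rootX qwn; set y := nth_root _ _; set q := qexp (_^-1) => e _.
have nz k : 1 - y * q ^+ k != 0.
  rewrite subr_eq0 eq_sym; apply: contra_neq w1 => h.
  have <- : (y * q ^+ k) ^+ n.*2.+1 = qexp w.
    by rewrite exprMn nth_rootX qwn -(exprM q) mulnC exprM /q qroot expr1n mulr1.
  by rewrite h expr1n.
have E k : (y * q ^+ k + 1) / (y * q ^+ k - 1) = 1 - 2 * (1 - y * q ^+ k)^-1.
  have nz' : y * q ^+ k - 1 != 0 by rewrite -opprB oppr_eq0 nz.
  by field; rewrite nz nz'.
under eq_bigr do rewrite E.
rewrite sumrB -mulr_sumr e sumr_const card_ord -mulr_natl mulr1.
have h1 : 1 - qexp w != 0 by rewrite subr_eq0 eq_sym.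
have h2 : qexp w - 1 != 0 by rewrite subr_eq0.
have h3 : (n.*2.+1)%:R != 0 :> R[i] by rewrite pnatr_eq0.
by move: (n.*2.+1)%:R h3 => d h3; field; rewrite h1 h2 h3.
Qed.

Let Bc_sum n w : qexp w != 1 ->
  Bc n w + \sum_(k < n) (Bc n (w + k.+1%:R) + Bc n (w - k.+1%:R)) =
  (2 * pi%:C%C * 'i%C) ^+ 2 * qexp w / (1 - qexp w) ^+ 2.
Proof.
move=> w1.
pose G y := (2 * pi%:C%C * 'i%C / (n.*2.+1)%:R) ^+ 2 * (y / (1 - y) ^+ 2) : R[i].
rewrite -(sum_roots_centered G n w) /G -mulr_sumr.
have [_ qwn] := qexp_shift w n.
have x1 : nth_root n (w - n%:R) ^+ n.*2.+1 != 1 by rewrite nth_rootX qwn.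
have [] := sum_geom_roots (ltn0Sn n.*2) x1.
rewrite nth_rootX qwn; set y := nth_root _ _; set q := qexp (_^-1) => e e'.
have nz k : 1 - y * q ^+ k != 0.
  rewrite subr_eq0 eq_sym; apply: contra_neq w1 => h.
  have <- : (y * q ^+ k) ^+ n.*2.+1 = qexp w.
    by rewrite exprMn nth_rootX qwn -(exprM q) mulnC exprM /q qroot expr1n mulr1.
  by rewrite h expr1n.
have E k : (y * q ^+ k) / (1 - y * q ^+ k) ^+ 2 = (1 - y * q ^+ k) ^- 2 - (1 - y * q ^+ k)^-1.
  by field; rewrite nz.
under eq_bigr do rewrite E.
have e2 : n.*2%:R = (n.*2.+1)%:R - 1 :> R[i] by rewrite -natr1 addrK.
rewrite sumrB e e' /= e2.
have h1 : 1 - qexp w != 0 by rewrite subr_eq0 eq_sym.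
have h3 : (n.*2.+1)%:R != 0 :> R[i] by rewrite pnatr_eq0.
by move: (n.*2.+1)%:R h3 => d h3; field; rewrite h1 h3.
Qed.

Let scaled_neq0 s : s != 0 -> 2 * pi%:C%C * 'i%C * s != 0.
Proof.
move=> s0; rewrite !mulf_neq0 //.
  by rewrite (fmorph_eq0 (real_complex R)) gt_eqF ?pi_gt0.
by rewrite -cabs_gt0 cabs_i.
Qed.

Let pii_neq0 : pi%:C%C * 'i%C != 0 :> R[i].
Proof. by have := scaled_neq0 (oner_neq0 _); rewrite mulr1 -mulrA mulf_eq0 negb_or => /andP[]. Qed.

Let nth_root_cvg s : ccvg (fun n => nth_root n s) 1.
Proof.
have [K K0 [N hN]] := ccvg_bounded (qexp_scaled_cvg s).
apply: (ccvg_inv (K := K) (N := N)) => n /hN; rewrite cabsM cabs_nat => h.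
rewrite ler_pdivlMr // mulrC; apply: le_trans h.
by rewrite ler_wpM2r ?cabs_ge0 // ler_nat ltnS -addnn leq_addr.
Qed.

Let Ac_cvg s : qexp s != 1 -> ccvg (fun n => Ac n s) s^-1.
Proof.
move=> s1; have s0 : s != 0 by apply: contra_neq s1 => ->; rewrite qexp0.
have h := ccvgM (ccvgZ (pi%:C%C * 'i%C) (ccvgD (nth_root_cvg s) (ccvg_cst 1)))
  (ccvgV (scaled_neq0 s0) (qexp_scaled_cvg s)).
have -> : s^-1 = pi%:C%C * 'i%C * (1 + 1) / (2 * pi%:C%C * 'i%C * s).
  have := pii_neq0; rewrite mulf_eq0 negb_or => /andP[].
  by move: (pi%:C)%C ('i)%C => p ii p0 i0; field; rewrite s0 p0 i0.
apply: (ccvg_ext (N := 0)) h => n _; rewrite /Ac -/(nth_root n s).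
have h1 : nth_root n s - 1 != 0 by rewrite subr_eq0 nth_root_neq1.
have h2 : (n.*2.+1)%:R != 0 :> R[i] by rewrite pnatr_eq0.
by move: (n.*2.+1)%:R h2 => d h2; field; rewrite h1 h2.
Qed.

Let Bc_cvg s : qexp s != 1 -> ccvg (fun n => Bc n s) (s ^- 2).
Proof.
move=> s1; have s0 : s != 0 by apply: contra_neq s1 => ->; rewrite qexp0.
have h := ccvgM (ccvgZ ((2 * pi%:C%C * 'i%C) ^+ 2) (nth_root_cvg s))
  (ccvgX 2 (ccvgV (scaled_neq0 s0) (qexp_scaled_cvg s))).
have -> : s ^- 2 = (2 * pi%:C%C * 'i%C) ^+ 2 * 1 * (2 * pi%:C%C * 'i%C * s)^-1 ^+ 2.
  have := pii_neq0; rewrite mulf_eq0 negb_or => /andP[].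
  by move: (pi%:C)%C ('i)%C => p ii p0 i0; field; rewrite s0 p0 i0.
apply: (ccvg_ext (N := 0)) h => n _; rewrite /Bc -/(nth_root n s).
have h1 : nth_root n s - 1 != 0 by rewrite subr_eq0 nth_root_neq1.
have h1' : 1 - nth_root n s != 0 by rewrite subr_eq0 eq_sym nth_root_neq1.
have h2 : (n.*2.+1)%:R != 0 :> R[i] by rewrite pnatr_eq0.
by move: (n.*2.+1)%:R h2 => d h2; field; rewrite h1 h1' h2.
Qed.

(** When Im s = Im w, the modulus of [nth_root n s] lies between [rho w] and its inverse, for every
    n. *)
Let rho w : R := expR (- (2 * pi * `|complex.Im w|)).

Let nth_root_lb n w s (k : nat) : complex.Im s = complex.Im w ->
  k.+1%:R / 2 <= `|complex.Re s| -> `|complex.Re s| <= 3 / 2 * k.+1%:R -> (k < n)%N ->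
  rho w * k.+1%:R ^+ 2 / (9 * (n.*2.+1)%:R ^+ 2) <= cabs (1 - nth_root n s) ^+ 2.
Proof.
move=> im lb ub kn; apply: le_trans (cabs_1subqexp _).
have n0 : 0 < (n.*2.+1)%:R :> R by rewrite ltr0n.
have E : s / (n.*2.+1)%:R = s * ((n.*2.+1)%:R^-1)%:C%C by rewrite fmorphV rmorph_nat.
have rE : complex.Re (s / (n.*2.+1)%:R) = complex.Re s / (n.*2.+1)%:R.
  by rewrite E cReM /= mulr0 subr0.
have iE : complex.Im (s / (n.*2.+1)%:R) = complex.Im w / (n.*2.+1)%:R.
  by rewrite E cImM /= mulr0 add0r im.
rewrite rE iE.
have kn' : k.+1%:R <= n%:R :> R by rewrite ler_nat.
have nE : (n.*2.+1)%:R = 2 * n%:R + 1 :> R by rewrite -natr1 -muln2 natrM mulrC.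
have hs : `|complex.Re s / (n.*2.+1)%:R| <= 3 / 4.
  by rewrite normrM normfV (gtr0_norm n0) ler_pdivrMr // nE; lra.
have := sin_pi_ge hs; rewrite normrM normfV (gtr0_norm n0) => h.
have h2 : k.+1%:R / (6 * (n.*2.+1)%:R) <= `|sin (pi * (complex.Re s / (n.*2.+1)%:R))|.
  apply: le_trans h; rewrite invfM mulrA -mulrA [leRHS]mulrAC [leLHS]mulrA ler_pM2r ?invr_gt0 //; lra.
have h3 : (k.+1%:R / (6 * (n.*2.+1)%:R)) ^+ 2 <= sin (pi * (complex.Re s / (n.*2.+1)%:R)) ^+ 2.
  rewrite -[leRHS]real_normK ?num_real // ler_pXn2r ?nnegrE //.
have r1 : rho w <= expR (- (2 * pi * (complex.Im w / (n.*2.+1)%:R))).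
  rewrite ler_expR lerN2 -!mulrA !ler_pM2l ?pi_gt0 //.
  apply: le_trans (ler_norm _) _; rewrite normrM normfV (gtr0_norm n0).
  rewrite ler_pdivrMr // ler_peMr // -[1]/(1%:R) ler_nat.
  by [].
have r0 : 0 <= rho w by exact: expR_ge0.
have -> : rho w * k.+1%:R ^+ 2 / (9 * (n.*2.+1)%:R ^+ 2)
   = 4 * rho w * (k.+1%:R / (6 * (n.*2.+1)%:R)) ^+ 2.
  by field; rewrite gt_eqF.
by rewrite ler_pM ?mulr_ge0 ?sqr_ge0 // ler_pM2l.
Qed.

Let shift_bounds w (k : nat) : 2 * `|complex.Re w| <= k.+1%:R ->
  (complex.Im (w + k.+1%:R) = complex.Im w /\
   k.+1%:R / 2 <= `|complex.Re (w + k.+1%:R)| <= 3 / 2 * k.+1%:R) /\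
  (complex.Im (w - k.+1%:R) = complex.Im w /\
   k.+1%:R / 2 <= `|complex.Re (w - k.+1%:R)| <= 3 / 2 * k.+1%:R).
Proof.
move=> hk; rewrite !cImD cImN cIm_nat !cReD cReN cRe_nat oppr0 addr0.
have k0 : 0 <= k.+1%:R :> R by [].
move: hk; set u := complex.Re w => hk.
have := ler_norm u; have := ler_norm (- u); rewrite normrN => h1 h2.
split; split => //; apply/andP; split.
- by apply: le_trans (ler_norm _); lra.
- by rewrite ger0_norm; lra.
- by rewrite -normrN; apply: le_trans (ler_norm _); lra.
- by rewrite ler0_norm; lra.
Qed.

Let rho_gt0 w : 0 < rho w. Proof. exact: expR_gt0. Qed.

Let nth_root_ub n w s : complex.Im s = complex.Im w -> cabs (nth_root n s) <= (rho w)^-1.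
Proof.
move=> im; rewrite /nth_root cabs_qexp /rho -expRN opprK ler_expR.
have n0 : 0 < (n.*2.+1)%:R :> R by rewrite ltr0n.
have -> : s / (n.*2.+1)%:R = s * ((n.*2.+1)%:R^-1)%:C%C by rewrite fmorphV rmorph_nat.
rewrite cImM /= mulr0 add0r im -mulrN -!mulrA !ler_pM2l ?pi_gt0 //.
apply: le_trans (ler_norm _) _; rewrite normrN normrM normfV (gtr0_norm n0).
rewrite ler_pdivrMr // ler_peMr //.
by rewrite -[1]/(1%:R) ler_nat.
Qed.

Let Bc_bound n w s (k : nat) : complex.Im s = complex.Im w ->
  k.+1%:R / 2 <= `|complex.Re s| -> `|complex.Re s| <= 3 / 2 * k.+1%:R -> (k < n)%N ->
  cabs (Bc n s) <= 36 * pi ^+ 2 / rho w ^+ 2 / k.+1%:R ^+ 2.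
Proof.
move=> im lb ub kn; have h := nth_root_lb im lb ub kn.
have hu := nth_root_ub n im.
have n0 : 0 < (n.*2.+1)%:R :> R by rewrite ltr0n.
have r0 := rho_gt0 w; have k0 : 0 < k.+1%:R :> R by rewrite ltr0n.
have p0 := pi_gt0 R.
rewrite /Bc !(cabsM, cabsX, cabsV) !cabs_nat cabs_i cabs_real (gtr0_norm p0) mulr1.
set D := rho w * _ / _ in h.
have D0 : 0 < D by rewrite /D divr_gt0 // !mulr_gt0 // exprn_gt0.
apply: (@le_trans _ _ ((2 * pi / (n.*2.+1)%:R) ^+ 2 * ((rho w)^-1 / D))).
  rewrite ler_wpM2l ?sqr_ge0 // ler_pM ?cabs_ge0 ?invr_ge0 ?sqr_ge0 //.
  by rewrite lef_pV2 ?posrE // (lt_le_trans D0 h).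
rewrite le_eqVlt; apply/orP; left; apply/eqP; rewrite /D; field.
by rewrite !gt_eqF.
Qed.

(** The finite identity [Bc_sum] has the same right-hand side for every n; Tannery's theorem passes
    to the limit term by term. The central term is split off, so that only the shifted pairs are
    dominated. *)
Lemma csc_sqr_expansion w : qexp w != 1 ->
  ccvg (fun n => w ^- 2 + \sum_(k < n) ((w + k.+1%:R) ^- 2 + (w - k.+1%:R) ^- 2))
    ((2 * pi%:C%C * 'i%C) ^+ 2 * qexp w / (1 - qexp w) ^+ 2).
Proof.
move=> w1; set L := _ / _.
suff h : ccvg (fun n => \sum_(k < n) ((w + k.+1%:R) ^- 2 + (w - k.+1%:R) ^- 2)) (L - w ^- 2).
  have := ccvgD (ccvg_cst (w ^- 2)) h; rewrite addrC subrK; exact: (ccvg_ext (N := 0)).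
have h : ccvg (fun n => \sum_(k < n) (Bc n (w + k.+1%:R) + Bc n (w - k.+1%:R))) (L - w ^- 2).
  apply: (ccvg_ext (N := 0)) (ccvgB (ccvg_cst L) (Bc_cvg w1)) => n _.
  by rewrite /L -(Bc_sum n w1) addrC addKr.
pose K0 := Num.truncn (2 * `|complex.Re w|).
apply: (@tannery (fun n k => Bc n (w + k.+1%:R) + Bc n (w - k.+1%:R))
  (fun k => (w + k.+1%:R) ^- 2 + (w - k.+1%:R) ^- 2) _
  (2 * (36 * pi ^+ 2 / rho w ^+ 2)) K0 0 _ _ h).
  move=> k; have [e1 e2] := qexp_shift w k.+1.
  by apply: ccvgD; apply: Bc_cvg; rewrite ?e1 ?e2.
move=> n k _ /andP[Kk kn].
have [|[i1 /andP[l1 u1]] [i2 /andP[l2 u2]]] := @shift_bounds w k.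
  by apply: ltW; apply: lt_le_trans (Num.Theory.truncnS_gt _) _; rewrite ler_nat ltnS.
apply: le_trans (cabsD _ _) _.
have := Bc_bound i1 l1 u1 kn; have := Bc_bound i2 l2 u2 kn.
move=> hb1 hb2; apply: le_trans (lerD hb2 hb1) _.
by rewrite -!mulrDl -mulr2n -[_ *+ 2]mulr_natl !mulrA.
Qed.

(** Single terms decay only like 1/k, so the terms for w + k and w - k are dominated together. If y
    and y' are the two roots, the sum of the pair has numerator y y' - 1, where y y' = exp(2 pi i
    2w/(2n+1)) no longer depends on k. *)
Lemma cot_expansion w : qexp w != 1 ->
  ccvg (fun n => w^-1 + \sum_(k < n) ((w + k.+1%:R)^-1 + (w - k.+1%:R)^-1))
    (pi%:C%C * 'i%C * (qexp w + 1) / (qexp w - 1)).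
Proof.
move=> w1; set L := _ / _.
suff h : ccvg (fun n => \sum_(k < n) ((w + k.+1%:R)^-1 + (w - k.+1%:R)^-1)) (L - w^-1).
  have := ccvgD (ccvg_cst (w^-1)) h; rewrite addrC subrK; exact: (ccvg_ext (N := 0)).
have h : ccvg (fun n => \sum_(k < n) (Ac n (w + k.+1%:R) + Ac n (w - k.+1%:R))) (L - w^-1).
  apply: (ccvg_ext (N := 0)) (ccvgB (ccvg_cst L) (Ac_cvg w1)) => n _.
  by rewrite /L -(Ac_sum n w1) addrC addKr.
pose K0 := Num.truncn (2 * `|complex.Re w|).
(* [K] bounds (2n+1) |y y' - 1|, the numerator of a pair, for all large n. *)
have [K Kgt0 [N0 hN0]] := ccvg_bounded (qexp_scaled_cvg (2 * w)).
apply: (@tannery (fun n k => Ac n (w + k.+1%:R) + Ac n (w - k.+1%:R))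
  (fun k => (w + k.+1%:R)^-1 + (w - k.+1%:R)^-1) _
  (18 * pi * K / rho w) K0 N0 _ _ h).
  move=> k; have [e1 e2] := qexp_shift w k.+1.
  by apply: ccvgD; apply: Ac_cvg; rewrite ?e1 ?e2.
move=> n k Nn /andP[Kk kn].
have [|[i1 /andP[l1 u1]] [i2 /andP[l2 u2]]] := @shift_bounds w k.
  by apply: ltW; apply: lt_le_trans (Num.Theory.truncnS_gt _) _; rewrite ler_nat ltnS.
have b1 := nth_root_lb i1 l1 u1 kn; have b2 := nth_root_lb i2 l2 u2 kn.
have [e1 e2] := qexp_shift w k.+1.
have y1 : nth_root n (w + k.+1%:R) != 1 by rewrite nth_root_neq1 // e1.
have y2 : nth_root n (w - k.+1%:R) != 1 by rewrite nth_root_neq1 // e2.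
have yy : nth_root n (w + k.+1%:R) * nth_root n (w - k.+1%:R) = qexp (2 * w / (n.*2.+1)%:R).
  by rewrite /nth_root -qexpD; congr qexp; ring.
have := hN0 _ Nn; rewrite -yy /Ac.
move: b1 b2 y1 y2; set y := nth_root _ _; set y' := nth_root _ _ => b1 b2 y1 y2 hK.
have n0 : 0 < (n.*2.+1)%:R :> R by rewrite ltr0n.
have r0 := rho_gt0 w; have k0 : 0 < k.+1%:R :> R by rewrite ltr0n.
have p0 := pi_gt0 R.
set D := rho w * _ / _ in b1 b2.
have D0 : 0 < D by rewrite /D divr_gt0 // !mulr_gt0 // exprn_gt0.
have z1 : 1 - y != 0 by rewrite subr_eq0 eq_sym.
have z2 : 1 - y' != 0 by rewrite subr_eq0 eq_sym.
have z1' : y - 1 != 0 by rewrite subr_eq0.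
have z2' : y' - 1 != 0 by rewrite subr_eq0.
have n0' : (n.*2.+1)%:R != 0 :> R[i] by rewrite pnatr_eq0.
have -> : pi%:C%C * 'i%C / (n.*2.+1)%:R * ((y + 1) / (y - 1)) +
   pi%:C%C * 'i%C / (n.*2.+1)%:R * ((y' + 1) / (y' - 1)) =
   2 * pi%:C%C * 'i%C / (n.*2.+1)%:R ^+ 2 * ((n.*2.+1)%:R * (y * y' - 1)) / ((1 - y) * (1 - y')).
  by move: (n.*2.+1)%:R n0' (pi%:C)%C => d d0 p; field; rewrite z1 z2 z1' z2' d0.
have DD : D <= cabs (1 - y) * cabs (1 - y').
  have : D ^+ 2 <= (cabs (1 - y) * cabs (1 - y')) ^+ 2.
    by rewrite [leRHS]exprMn [leLHS]expr2 ler_pM // ltW.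
  by rewrite ler_pXn2r // nnegrE ?mulr_ge0 ?cabs_ge0 // ltW.
rewrite cabsM cabsV (cabsM (1 - y)) [cabs (2 * _ * _ / _ * _)]cabsM.
apply: (@le_trans _ _ (2 * pi / (n.*2.+1)%:R ^+ 2 * K / D)).
  rewrite ler_pM ?mulr_ge0 ?invr_ge0 ?cabs_ge0 ?mulr_ge0 ?cabs_ge0 //.
    rewrite ler_pM ?cabs_ge0 // !(cabsM, cabsX, cabsV) !cabs_nat cabs_i cabs_real.
    by rewrite (gtr0_norm p0) mulr1.
  by rewrite lef_pV2 ?posrE // (lt_le_trans D0 DD).
rewrite le_eqVlt; apply/orP; left; apply/eqP; rewrite /D; field.
by rewrite !gt_eqF.
Qed.

End PartialFractions.

(** * The weight two Eisenstein sum *)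

Section Basel.
Variable R : realType.

Lemma real_complexB (x y : R) : (x - y)%:C%C = x%:C%C - y%:C%C.
Proof. by rewrite rmorphB. Qed.

Lemma complex_inv_sqrE k : (k.+1%:R : R[i]) ^- 2 = ((k.+1%:R ^+ 2)^-1)%:C%C.
Proof. by rewrite fmorphV rmorphXn rmorph_nat. Qed.

Lemma real_ccvg (u : nat -> R) (l : R) : u @ \oo --> l -> ccvg (fun n => (u n)%:C%C) l%:C%C.
Proof. by move=> h; apply: ccvg_ReIm => //=; exact: cvg_cst. Qed.

(** The expansion of pi^2/sin^2(pi w) at w = 1/2 gives pi^2 as 8 times the sum of inverse squares of
    odd numbers. That sum is 3/4 of the full one, so pi^2 = 6 L. *)
Lemma sum_inv_sqr_cvg :
  (fun n => \sum_(k < n) (k.+1%:R ^+ 2)^-1) @ \oo --> (pi ^+ 2 / 6 : R).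
Proof.
pose zt n : R := \sum_(k < n) (k.+1%:R ^+ 2)^-1.
have ztc : cvgn zt.
  apply: nondecreasing_is_cvgn.
    apply/nondecreasing_seqP => n; rewrite /zt big_ord_recr /= lerDl.
    by rewrite invr_ge0 exprn_ge0.
  by exists 2 => _ [n _ <-]; exact: sum_inv_sqr_le2.
set L := limn zt in ztc *.
suff -> : pi ^+ 2 / 6 = L by [].
have cL : ccvg (fun n => (zt n)%:C%C) L%:C%C by apply: real_ccvg.
have half : qexp (2^-1 : R[i]) = -1.
  have -> : (2^-1 : R[i]) = (2^-1)%:C%C by rewrite fmorphV rmorph_nat.
  have e : 2 * pi * 2^-1 = pi :> R by field.
  by apply: complex_eqP; rewrite /= mulr0 oppr0 expR0 mul1r e (cospi, sinpi) //= oppr0.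
have h1 : qexp (2^-1 : R[i]) != 1.
  by rewrite half -subr_eq0 -opprD oppr_eq0 -mulr2n pnatr_eq0.
have hL := csc_sqr_expansion h1; move: hL; rewrite half.
pose T k : R[i] := k.+1%:R ^- 2.
have ztE n : (zt n)%:C%C = \sum_(k < n) T k.
  by rewrite /zt rmorph_sum /=; apply: eq_bigr => k _; rewrite -complex_inv_sqrE.
have nz (k : nat) : k.+1%:R != 0 :> R[i] by rewrite pnatr_eq0.
have h2 (x : R[i]) : (x / 2) ^- 2 = 4 * x ^- 2.
  by rewrite exprMn invfM exprVn invrK mulrC -natrX.
have a1 k : (2^-1 + k.+1%:R : R[i]) ^- 2 = 4 * T k.*2.+2.
  by rewrite -h2; congr (_ ^- 2); rewrite -!natr1 -muln2 natrM; field.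
have a2 k : (2^-1 - k.+1%:R : R[i]) ^- 2 = 4 * T k.*2.
  by rewrite -h2 -sqrrN; congr (_ ^- 2); rewrite -!natr1 -muln2 natrM; field.
have a3 k : T k.*2.+1 = T k / 4.
  by rewrite /T -[k.*2.+2]doubleS -muln2 natrM exprMn invfM -(natrX _ 2 2).
have E n : (2^-1 : R[i]) ^- 2 + \sum_(k < n) ((2^-1 + k.+1%:R) ^- 2 + (2^-1 - k.+1%:R) ^- 2)
  = 4 * ((zt n.+1.*2)%:C%C - (zt n.+1)%:C%C / 4) + 4 * ((zt n.*2)%:C%C - (zt n)%:C%C / 4).
  rewrite !ztE; elim: n => [|n IH].
    have t1 : T 1 = T 0 / 4 := a3 0%N.
    have t0 : T 0 = 1 by rewrite /T expr1n invr1.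
    rewrite doubleS !big_ord_recr !big_ord0 /= t1 t0.
    by have := h2 1; rewrite expr1n invr1 mul1r => ->; field.
  rewrite big_ord_recr /= addrA IH !doubleS !big_ord_recr /= a1 a2.
  by have := a3 n; have := a3 n.+1; rewrite doubleS => -> ->; field.
pose c4 := 4 * (L%:C%C - L%:C%C / 4) + 4 * (L%:C%C - L%:C%C / 4) : R[i].
have dbl n : (n <= n.*2)%N by rewrite -addnn leq_addr.
have cE : ccvg (fun n => 4 * ((zt n.+1.*2)%:C%C - (zt n.+1)%:C%C / 4)
   + 4 * ((zt n.*2)%:C%C - (zt n)%:C%C / 4)) c4.
  have cS : ccvg (fun n => (zt n.+1)%:C%C) L%:C%C by apply: (ccvg_comp (f := S)) cL.
  have cS2 : ccvg (fun n => (zt n.+1.*2)%:C%C) L%:C%C.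
    by apply: (ccvg_comp (f := fun n => n.+1.*2)) cL => n; apply: leq_trans (dbl _) _; rewrite leq_double.
  have cD : ccvg (fun n => (zt n.*2)%:C%C) L%:C%C by apply: (ccvg_comp (f := double)) cL.
  by apply: ccvgD; apply: ccvgZ; apply: ccvgB => //; apply: ccvgM => //; exact: ccvg_cst.
move=> hL; have hL' := ccvg_ext (N := 0) (fun n _ => E n) hL.
have := ccvg_uniq hL' cE; rewrite /c4.
have -> : (2 * pi%:C%C * 'i%C) ^+ 2 * -1 / (1 - -1) ^+ 2 = (pi ^+ 2)%:C%C :> R[i].
  have -> : (pi ^+ 2)%:C%C = pi%:C%C ^+ 2 :> R[i] by rewrite rmorphXn.
  have i2 : ('i%C : R[i]) ^+ 2 = -1 by exact: sqr_i.
  rewrite !exprMn i2.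
  by field.
have -> : 4 * (L%:C%C - L%:C%C / 4) + 4 * (L%:C%C - L%:C%C / 4) = (6 * L)%:C%C :> R[i].
  by rewrite rmorphM rmorph_nat; field.
by move=> /complexI ->; field.
Qed.

Lemma sum_inv_sqr_dist N : (0 < N)%N ->
  `|pi ^+ 2 / 6 - \sum_(k < N) (k.+1%:R ^+ 2)^-1| <= N%:R^-1 :> R.
Proof.
move=> N0; set S := \sum_(k < N) _.
have h := ccvgB (real_ccvg sum_inv_sqr_cvg) (ccvg_cst S%:C%C).
rewrite -cabs_real real_complexB; apply: (ccvg_le (N := N)) h _ => M NM.
rewrite -real_complexB cabs_real /S -!(big_mkord xpredT (fun k => (k.+1%:R ^+ 2)^-1 : R)).
rewrite (big_cat_nat (n := N)) //= addrAC subrr add0r ger0_norm ?sum_inv_sqr_tail //.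
by apply: sumr_ge0 => k _; rewrite invr_ge0 exprn_ge0.
Qed.

End Basel.

(** * Exchange of summation for the weight two lattice sum *)

Section QuasiModular.
Variable R : realType.
Implicit Types (z w : R[i]).

(** This is pi^2 / sin^2(pi w), written in terms of exp(2 pi i w). *)
Definition csc2 w : R[i] := (2 * pi%:C%C * 'i%C) ^+ 2 * qexp w / (1 - qexp w) ^+ 2.

Lemma csc2N w : qexp w != 1 -> csc2 (- w) = csc2 w.
Proof.
move=> w1; rewrite /csc2 qexpN; have x0 := qexp_neq0 w.
have h : qexp w - 1 != 0 by rewrite subr_eq0.
have h' : 1 - qexp w != 0 by rewrite subr_eq0 eq_sym.
by move: (pi%:C)%C ('i)%C => p ii; field; rewrite h h' x0.
Qed.

Lemma qexp_neq1 w : complex.Im w != 0 -> qexp w != 1.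
Proof.
apply: contra_neq => h; have := cabs_qexp w; rewrite h cabs1.
rewrite -[LHS]expR0 => /expR_inj /eqP; rewrite eq_sym oppr_eq0 mulf_eq0 => /orP[|/eqP//].
by rewrite mulf_eq0 pnatr_eq0 /= gt_eqF ?pi_gt0.
Qed.

Variables (z : R[i]) (c : R).
Hypotheses (z0 : 0 < complex.Im z) (c0 : 0 < c)
  (hc : forall a b : R, c * (a ^+ 2 + b ^+ 2) <= cabs (a%:C%C * z + b%:C%C) ^+ 2).

(* [h] is a telescoping approximation of the Eisenstein term [g].  The double sum
   of [g - h] converges absolutely, so it may be summed in either order; comparing
   the two orders gives the transformation law of the weight two Eisenstein sum. *)
Let v (a : R) (m : nat) := (m.+1%:R * z + a%:C%C)^-1 - (m.+1%:R * z - a%:C%C)^-1.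
Let g (m n : nat) := (m.+1%:R * z + n.+1%:R) ^- 2 + (m.+1%:R * z - n.+1%:R) ^- 2.
Let h (m n : nat) := v (n%:R + 2^-1) m - v (n.+1%:R + 2^-1) m.

Let lin_lb (m : nat) (b : R) : c * (m.+1%:R ^+ 2 + b ^+ 2) <= cabs (m.+1%:R * z + b%:C%C) ^+ 2.
Proof. by rewrite complex_natE. Qed.

Let lin_neq0 (m : nat) (b : R) : m.+1%:R * z + b%:C%C != 0.
Proof.
rewrite -cabs_gt0 -(@ltr_pXn2r _ 2) ?nnegrE ?cabs_ge0 // expr0n.
apply: lt_le_trans (lin_lb m b); rewrite mulr_gt0 //.
by rewrite ltr_pwDl ?sqr_ge0 // exprn_gt0.
Qed.

(** The difference is -1/(4 W^2 (W - 1/2)(W + 1/2)), of fourth order in 1/W. Each squared modulus is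
    at least c (m^2 + n^2/4) >= c m n, where m and n stand for [m.+1] and [n.+1], which gives
    absolute convergence in both indices. *)
Let d_term (m n : nat) (b : R) : n.+1%:R <= `|b| ->
  cabs ((m.+1%:R * z + b%:C%C) ^- 2 -
     ((m.+1%:R * z + (b - 2^-1)%:C%C)^-1 - (m.+1%:R * z + (b + 2^-1)%:C%C)^-1))
   <= 4^-1 * (c * (m.+1%:R * n.+1%:R)) ^- 2.
Proof.
move=> nb; have e1 := lin_neq0 m b; have e2 := lin_neq0 m (b - 2^-1).
have e3 := lin_neq0 m (b + 2^-1).
have n1 : 1 <= n.+1%:R :> R by rewrite -[1]/(1%:R) ler_nat.
have m1 : 1 <= m.+1%:R :> R by rewrite -[1]/(1%:R) ler_nat.
have T0 : 0 < c * (m.+1%:R * n.+1%:R) by rewrite !mulr_gt0.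
have lb (b' : R) : n.+1%:R / 2 <= `|b'| ->
    c * (m.+1%:R * n.+1%:R) <= cabs (m.+1%:R * z + b'%:C%C) ^+ 2.
  move=> hb; apply: le_trans (lin_lb m b'); rewrite ler_pM2l //.
  rewrite -[b' ^+ 2]real_normK ?num_real //.
  have : (n.+1%:R / 2) ^+ 2 <= `|b'| ^+ 2 by rewrite ler_pXn2r ?nnegrE // divr_ge0.
  have := sqr_ge0 (m.+1%:R - n.+1%:R / 2 : R); nra.
have l1 := lb b _; have l2 := lb (b - 2^-1) _; have l3 := lb (b + 2^-1) _.
have hb2 : n.+1%:R / 2 <= `|b - 2^-1|.
  have := ler_normD (b - 2^-1) (2^-1); rewrite subrK (@ger0_norm _ 2^-1) ?invr_ge0 //; lra.
have hb3 : n.+1%:R / 2 <= `|b + 2^-1|.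
  have := ler_normB (b + 2^-1) (2^-1); rewrite addrK (@ger0_norm _ 2^-1) ?invr_ge0 //; lra.
have {}l1 := l1 ltac:(lra); have {}l2 := l2 hb2; have {}l3 := l3 hb3.
set W := _ + b%:C%C in e1 l1 *.
have E2 : m.+1%:R * z + (b - 2^-1)%:C%C = W - 2^-1.
  by rewrite rmorphB /= fmorphV rmorph_nat addrA.
have E3 : m.+1%:R * z + (b + 2^-1)%:C%C = W + 2^-1.
  by rewrite rmorphD /= fmorphV rmorph_nat addrA.
move: e2 e3 l2 l3; rewrite E2 E3 => e2 e3 l2 l3.
have -> : W ^- 2 - ((W - 2^-1)^-1 - (W + 2^-1)^-1) = - (4^-1 * (W ^+ 2 * ((W - 2^-1) * (W + 2^-1)))^-1).
  clearbody W; field; rewrite e1 andbT /=.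
  have t : 2%:R != 0 :> R[i] by rewrite pnatr_eq0.
  apply/andP; split.
    by move: e3; apply: contra_neq => w0; apply: (mulfI t); rewrite mulr0 mulrDr divff // mulrC.
  by move: e2; apply: contra_neq => w0; apply: (mulfI t); rewrite mulr0 mulrBr divff // mulrC.
rewrite cabsN cabsM !cabsV cabs_nat ler_pM2l ?invr_gt0 // lef_pV2 ?posrE; last 2 first.
- by rewrite cabs_gt0 !mulf_neq0 // expf_neq0.
- by rewrite exprn_gt0.
rewrite -(@ler_pXn2r _ 2) ?nnegrE ?sqr_ge0 ?cabs_ge0 // [leLHS]exprS expr1.
rewrite !(cabsM, cabsX) [leRHS]exprMn.
apply: ler_pM; rewrite ?sqr_ge0 //.
  by rewrite ler_pXn2r ?nnegrE ?sqr_ge0 // ltW.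
by rewrite [leLHS]expr2 [leRHS]exprMn; apply: ler_pM => //; rewrite ltW.
Qed.

Let d_bound m n : cabs (g m n - h m n) <= c ^- 2 * (m.+1%:R ^+ 2)^-1 * (n.+1%:R ^+ 2)^-1.
Proof.
have b1 : n.+1%:R <= `|n.+1%:R| :> R by rewrite ger0_norm.
have b2 : n.+1%:R <= `|- n.+1%:R| :> R by rewrite normrN ger0_norm.
have h1 := d_term m b1; have h2 := d_term m b2.
have -> : g m n - h m n =
  ((m.+1%:R * z + n.+1%:R%:C%C) ^- 2 -
     ((m.+1%:R * z + (n.+1%:R - 2^-1)%:C%C)^-1 - (m.+1%:R * z + (n.+1%:R + 2^-1)%:C%C)^-1)) +
  ((m.+1%:R * z + (- n.+1%:R)%:C%C) ^- 2 -
     ((m.+1%:R * z + (- n.+1%:R - 2^-1)%:C%C)^-1 - (m.+1%:R * z + (- n.+1%:R + 2^-1)%:C%C)^-1)).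
  rewrite /g /h /v (complex_natE R n.+1).
  have -> : n%:R + 2^-1 = n.+1%:R - 2^-1 :> R by rewrite -natr1; field.
  have -> : - n.+1%:R - 2^-1 = - (n.+1%:R + 2^-1) :> R by ring.
  have -> : - n.+1%:R + 2^-1 = - (n.+1%:R - 2^-1) :> R by ring.
  rewrite !(rmorphN (real_complex R)) /=; ring.
apply: le_trans (cabsD _ _) _; apply: le_trans (lerD h1 h2) _.
have n1 : 0 < n.+1%:R :> R by [].
have m1 : 0 < m.+1%:R :> R by [].
have -> : c ^- 2 * (m.+1%:R ^+ 2)^-1 * (n.+1%:R ^+ 2)^-1 = (c * (m.+1%:R * n.+1%:R)) ^- 2.
  by move: (m.+1%:R) (n.+1%:R) m1 n1 => a b a0 b0; field; rewrite !gt_eqF.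
rewrite -mulrDl ler_piMl ?invr_ge0 ?sqr_ge0 //; lra.
Qed.

Let D (N K : nat) := \sum_(m < N) \sum_(n < K) (g m n - h m n).

Let D_tail2 N K K' : (0 < K <= K')%N -> cabs (D N K' - D N K) <= 2 * c ^- 2 / K%:R.
Proof.
move=> /andP[K0 KK]; rewrite /D -sumrB.
apply: le_trans (cabs_sum _ _ _) _.
apply: (@le_trans _ _ (\sum_(m < N) (m.+1%:R ^+ 2)^-1 * (c ^- 2 / K%:R))); last first.
  rewrite -mulr_suml -mulrA ler_wpM2r ?sum_inv_sqr_le2 //.
  by rewrite mulr_ge0 ?invr_ge0 ?sqr_ge0.
apply: ler_sum => m _.
rewrite -!(big_mkord xpredT (fun n => g m n - h m n)) (big_cat_nat (n := K)) //=.
rewrite addrAC subrr add0r; apply: le_trans (cabs_sum _ _ _) _.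
apply: (le_trans (ler_sum _ (fun n _ => d_bound m n))).
rewrite -mulr_sumr [c ^- 2 * _]mulrC -!mulrA ler_wpM2l ?invr_ge0 ?sqr_ge0 //.
by rewrite ler_wpM2l ?invr_ge0 ?sqr_ge0 // sum_inv_sqr_tail.
Qed.

Let D_tail1 N N' K : (0 < N <= N')%N -> cabs (D N' K - D N K) <= 2 * c ^- 2 / N%:R.
Proof.
move=> /andP[N0 NN].
rewrite /D -!(big_mkord xpredT (fun m => \sum_(n < K) (g m n - h m n))).
rewrite (big_cat_nat (n := N)) //= addrAC subrr add0r exchange_big /=.
apply: le_trans (cabs_sum _ _ _) _.
apply: (@le_trans _ _ (\sum_(n < K) (n.+1%:R ^+ 2)^-1 * (c ^- 2 / N%:R))); last first.
  rewrite -mulr_suml -mulrA ler_wpM2r ?sum_inv_sqr_le2 //.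
  by rewrite mulr_ge0 ?invr_ge0 ?sqr_ge0.
apply: ler_sum => n _; apply: le_trans (cabs_sum _ _ _) _.
apply: (le_trans (ler_sum _ (fun m _ => d_bound m n))).
rewrite -mulr_suml -mulr_sumr mulrC ler_wpM2l ?invr_ge0 ?sqr_ge0 //.
by rewrite ler_wpM2l ?invr_ge0 ?sqr_ge0 // sum_inv_sqr_tail.
Qed.

Let h_sum m K : \sum_(n < K) h m n = v (2^-1) m - v (K%:R + 2^-1) m.
Proof.
elim: K => [|K IH]; first by rewrite big_ord0 add0r subrr.
by rewrite big_ord_recr /= IH /h addrA subrK.
Qed.

Let mz_neq1 m : qexp (m.+1%:R * z) != 1.
Proof.
apply: qexp_neq1; rewrite cImM cRe_nat cIm_nat mul0r addr0.
by rewrite mulf_neq0 ?pnatr_eq0 // gt_eqF.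
Qed.

Let z_neq0 : z != 0. Proof. by apply: contraTneq z0 => ->; rewrite ltxx. Qed.

Let az_neq1 (a : R) : a != 0 -> qexp (a%:C%C / z) != 1.
Proof.
move=> a0; apply: qexp_neq1; rewrite cImM /= mul0r addr0 cImV.
by rewrite mulf_neq0 // mulf_neq0 ?oppr_eq0 ?gt_eqF // invr_gt0 exprn_gt0 // cabs_gt0.
Qed.

Let v_cvg0 m : ccvg (fun K => v (K%:R + 2^-1) m) 0.
Proof.
have lim0 (b : nat -> R) : (forall K, (1 <= K)%N -> K.+1%:R / 2 <= `|b K|) ->
    ccvg (fun K => (m.+1%:R * z + (b K)%:C%C)^-1) 0.
  move=> hb; have s0 : 0 < Num.sqrt c by rewrite sqrtr_gt0.
  apply: (ccvg_inv (K := 2 / Num.sqrt c) (N := 1)) => K K1; rewrite subr0 cabsV.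
  have k0 : 0 < K.+1%:R :> R by [].
  have -> : 2 / Num.sqrt c / K.+1%:R = (Num.sqrt c * (K.+1%:R / 2))^-1.
    by move: (K.+1%:R) k0 => k k0; field; rewrite !gt_eqF.
  have e := lin_neq0 m (b K).
  rewrite lef_pV2 ?posrE ?cabs_gt0 ?mulr_gt0 ?divr_gt0 //.
  rewrite -(@ler_pXn2r _ 2) ?nnegrE ?cabs_ge0 ?mulr_ge0 ?divr_ge0 ?sqrtr_ge0 //.
  apply: le_trans (lin_lb m (b K)); rewrite exprMn sqr_sqrtr ?(ltW c0) // ler_pM2l //.
  apply: (@le_trans _ _ (b K ^+ 2)); last by rewrite lerDr sqr_ge0.
  rewrite -[leRHS]real_normK ?num_real // ler_pXn2r ?nnegrE ?divr_ge0 //.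
  exact: hb.
have l1 := lim0 (fun K => K%:R + 2^-1) _; have l2 := lim0 (fun K => - (K%:R + 2^-1)) _.
have hb K : (1 <= K)%N -> K.+1%:R / 2 <= `|K%:R + 2^-1| :> R.
  rewrite -(ler_nat R) -natr1 => K1; rewrite ger0_norm; lra.
have {}l1 := l1 hb; have {}l2 := l2 (fun K K1 => eq_rect_r (fun x => _ <= x) (hb K K1) (normrN _)).
have := ccvgB l1 l2; rewrite subrr; apply: (ccvg_ext (N := 0)) => K _.
by rewrite /v (rmorphN (real_complex R)).
Qed.

(** Limit of [D N K] in K: summing [g] over n gives [csc2] without its central term, and [h]
    telescopes to [v (1/2)]. *)
Let Rone (N : nat) := \sum_(m < N) (csc2 (m.+1%:R * z) - (m.+1%:R * z) ^- 2 - v (2^-1) m).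

Let D_Rone N : (0 < N)%N -> cabs (Rone N - D N N) <= 2 * c ^- 2 / N%:R.
Proof.
move=> N0.
have l : ccvg (fun K => D N K) (Rone N).
  apply: ccvg_sum => m; have h1 := csc_sqr_expansion (mz_neq1 m).
  have := ccvgD (ccvgB (ccvgB h1 (ccvg_cst ((m.+1%:R * z) ^- 2))) (ccvg_cst (v 2^-1 m))) (v_cvg0 m).
  rewrite addr0; apply: (ccvg_ext (N := 0)) => K _.
  by rewrite sumrB h_sum /g; ring.
apply: (ccvg_le (N := N)) (ccvgB l (ccvg_cst (D N N))) _ => K NK.
by apply: D_tail2; rewrite N0.
Qed.

Definition cotpi w : R[i] := pi%:C%C * 'i%C * (qexp w + 1) / (qexp w - 1).

Let U (a : R) := z^-1 * cotpi (a%:C%C / z) - a%:C%C^-1.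

Let v_sum_cvg (a : R) : a != 0 -> ccvg (fun N => \sum_(m < N) v a m) (U a).
Proof.
move=> a0; have a0' : a%:C%C != 0 by rewrite (fmorph_eq0 (real_complex R)).
have := ccvgZ z^-1 (ccvgB (cot_expansion (az_neq1 a0)) (ccvg_cst (a%:C%C / z)^-1)).
have -> : z^-1 * (pi%:C%C * 'i%C * (qexp (a%:C%C / z) + 1) / (qexp (a%:C%C / z) - 1) - (a%:C%C / z)^-1)
   = U a by rewrite /U /cotpi mulrBr invf_div mulKf.
apply: (ccvg_ext (N := 0)) => N _.
rewrite addrAC subrr add0r mulr_sumr; apply: eq_bigr => m _; rewrite /v.
have e1 := lin_neq0 m a; have := lin_neq0 m (- a); rewrite rmorphN /= => e2.
have e3 : a%:C%C - m.+1%:R * z != 0 by rewrite -oppr_eq0 opprB.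
have e4 : a%:C%C + m.+1%:R * z != 0 by rewrite addrC.
move: (a%:C)%C (m.+1%:R : R[i]) e1 e2 e3 e4 => b k e1 e2 e3 e4.
by field; rewrite z_neq0 ?mulNr ?e1 ?e2 ?e3 ?e4.
Qed.

(** Limit of [D M N] in M. Here [h] leaves two cotangent sums, and [U (N + 1/2)] does not vanish for
    large N: it tends to pi i / z, the source of the term that breaks modularity. *)
Let Rtwo (N : nat) := \sum_(n < N) (z ^- 2 * csc2 (n.+1%:R / z) - n.+1%:R ^- 2) - U 2^-1 + U (N%:R + 2^-1).

Let D_Rtwo N : (0 < N)%N -> cabs (Rtwo N - D N N) <= 2 * c ^- 2 / N%:R.
Proof.
move=> N0.
have l : ccvg (fun M => D M N) (Rtwo N).
  have h1 : ccvg (fun M => \sum_(n < N) \sum_(m < M) g m n)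
     (\sum_(n < N) (z ^- 2 * csc2 (n.+1%:R / z) - n.+1%:R ^- 2)).
    apply: ccvg_sum => n.
    have n0 : n.+1%:R != 0 :> R by rewrite pnatr_eq0.
    have := ccvgZ (z ^- 2) (ccvgB (csc_sqr_expansion (az_neq1 n0)) (ccvg_cst ((n.+1%:R%:C%C / z) ^- 2))).
    rewrite -complex_natE mulrBr; have nz : n.+1%:R != 0 :> R[i] by rewrite pnatr_eq0.
    have -> : z ^- 2 * (n.+1%:R / z) ^- 2 = n.+1%:R ^- 2.
      by move: (n.+1%:R) nz => k k0; field; rewrite z_neq0 k0.
    apply: (ccvg_ext (N := 0)) => M _.
    rewrite addrAC subrr add0r mulr_sumr; apply: eq_bigr => m _; rewrite /g.
    have := lin_neq0 m n.+1%:R; have := lin_neq0 m (- n.+1%:R); rewrite rmorphN /= -complex_natE => e2 e1.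
    have e3 : n.+1%:R - m.+1%:R * z != 0 by rewrite -oppr_eq0 opprB.
    have e4 : n.+1%:R + m.+1%:R * z != 0 by rewrite addrC.
    move: (n.+1%:R) (m.+1%:R : R[i]) e1 e2 e3 e4 => b k e1 e2 e3 e4.
    by field; rewrite z_neq0 ?mulNr ?e1 ?e2 ?e3 ?e4.
  have h0 : 2^-1 != 0 :> R by rewrite invr_eq0 pnatr_eq0.
  have hN : N%:R + 2^-1 != 0 :> R by rewrite gt_eqF // ltr_wpDl.
  have := ccvgB h1 (ccvgB (v_sum_cvg h0) (v_sum_cvg hN)).
  rewrite opprB addrA addrAC; apply: (ccvg_ext (N := 0)) => M _.
  have -> : D M N = \sum_(m < M) \sum_(n < N) g m n - \sum_(m < M) (v 2^-1 m - v (N%:R + 2^-1) m).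
    by rewrite /D -sumrB; apply: eq_bigr => m _; rewrite sumrB h_sum.
  have hv : \sum_(m < M) (v 2^-1 m - v (N%:R + 2^-1) m) =
    \sum_(m < M) v 2^-1 m - \sum_(m < M) v (N%:R + 2^-1) m by exact: sumrB.
  by rewrite [in RHS]exchange_big /= hv.
apply: (ccvg_le (N := N)) (ccvgB l (ccvg_cst (D N N))) _ => M NM.
by apply: D_tail1; rewrite N0.
Qed.

Let v_half_tail N : (0 < N)%N -> cabs (U 2^-1 - \sum_(m < N) v (2^-1) m) <= c^-1 / N%:R.
Proof.
move=> N0; have h0 : 2^-1 != 0 :> R by rewrite invr_eq0 pnatr_eq0.
apply: (ccvg_le (N := N)) (ccvgB (v_sum_cvg h0) (ccvg_cst _)) _ => M NM.
rewrite -!(big_mkord xpredT (v 2^-1)) (big_cat_nat (n := N)) //= addrAC subrr add0r.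
apply: le_trans (cabs_sum _ _ _) _.
apply: (@le_trans _ _ (\sum_(N <= m < M) c^-1 * (m.+1%:R ^+ 2)^-1)); last first.
  by rewrite -mulr_sumr ler_wpM2l ?invr_ge0 ?(ltW c0) // sum_inv_sqr_tail.
apply: ler_sum => m _; rewrite /v.
have e1 := lin_neq0 m 2^-1; have := lin_neq0 m (- 2^-1); have l1 := lin_lb m 2^-1.
have := lin_lb m (- 2^-1); rewrite rmorphN /= => l2 e2.
have -> : (m.+1%:R * z + (2^-1)%:C%C)^-1 - (m.+1%:R * z - (2^-1)%:C%C)^-1 =
  - ((m.+1%:R * z + (2^-1)%:C%C) * (m.+1%:R * z - (2^-1)%:C%C))^-1.
  have e : 2 * (2^-1)%:C%C = 1 :> R[i] by rewrite fmorphV rmorph_nat divff // pnatr_eq0.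
  have -> : - ((m.+1%:R * z + (2^-1)%:C%C) * (m.+1%:R * z - (2^-1)%:C%C))^-1 =
     - (2 * (2^-1)%:C%C * ((m.+1%:R * z + (2^-1)%:C%C) * (m.+1%:R * z - (2^-1)%:C%C))^-1).
    by rewrite e mul1r.
  move: (2^-1%:C)%C (m.+1%:R * z) e1 e2 {l1 l2 e} => b k e1 e2.
  by field; rewrite e1 e2.
rewrite cabsN cabsV cabsM -invfM lef_pV2 ?posrE ?mulr_gt0 ?cabs_gt0 ?exprn_gt0 //.
have T0 : 0 < c * m.+1%:R ^+ 2 by rewrite mulr_gt0 // exprn_gt0.
have hl (b x : R) : c * (m.+1%:R ^+ 2 + b ^+ 2) <= x -> c * m.+1%:R ^+ 2 <= x.
  by apply: le_trans; rewrite ler_pM2l // lerDl sqr_ge0.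
have : (c * m.+1%:R ^+ 2) ^+ 2 <= (cabs (m.+1%:R * z + (2^-1)%:C%C) * cabs (m.+1%:R * z - (2^-1)%:C%C)) ^+ 2.
  rewrite [leRHS]exprMn [leLHS]expr2; apply: ler_pM; rewrite ?(ltW T0) //; [exact: hl l1|exact: hl l2].
by rewrite ler_pXn2r ?nnegrE ?mulr_ge0 ?cabs_ge0 ?sqr_ge0 // ltW.
Qed.

(** The point a/z lies in the lower half-plane, so its [qexp] has modulus exp r with r > 0
    proportional to a; the crude bound exp r - 1 >= r suffices for an error O(1/a). *)
Let cot_tail (a : R) : 0 < a ->
  cabs (cotpi (a%:C%C / z) - pi%:C%C * 'i%C) <= cabs z ^+ 2 / (a * complex.Im z).
Proof.
move=> a0; have p0 := pi_gt0 R; have hw := az_neq1 (lt0r_neq0 a0); rewrite /cotpi; set w := _ / z.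
have w1 : qexp w - 1 != 0 by rewrite subr_eq0.
have -> : pi%:C%C * 'i%C * (qexp w + 1) / (qexp w - 1) - pi%:C%C * 'i%C = 2 * pi%:C%C * 'i%C / (qexp w - 1).
  by move: (pi%:C)%C ('i)%C (qexp w) w1 => p ii x x1; field.
rewrite !(cabsM, cabsV) cabs_nat cabs_i cabs_real (gtr0_norm p0) mulr1.
have nz : 0 < cabs z by rewrite cabs_gt0.
set r := 2 * pi * (a * complex.Im z / cabs z ^+ 2).
have r0 : 0 < r by rewrite /r !mulr_gt0 // ?invr_gt0 ?exprn_gt0.
have hr : r <= cabs (qexp w - 1).
  apply: le_trans (cabs_lbD _ _); rewrite cabsN cabs1 cabs_qexp.
  have -> : - (2 * pi * complex.Im w) = r.
    rewrite /w /r cImM /= mul0r addr0 cImV; ring.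
  by have := expR_ge1Dx r; lra.
have -> : cabs z ^+ 2 / (a * complex.Im z) = 2 * pi / r.
  rewrite /r; move: (@pi R) p0 (cabs z) nz (complex.Im z) z0 {hr r0} => p p0 k k0 y y0.
  by field; rewrite !gt_eqF.
by rewrite ler_pM2l ?mulr_gt0 // lef_pV2 ?posrE // (lt_le_trans r0).
Qed.

(** [Rone N] and [Rtwo N] are both close to [D N N]. The central terms removed in the two orders
    account for (z^(-2) - 1) pi^2/6, and [U (N + 1/2)] accounts for pi i / z. The constant depends
    on z only through c, A and delta, hence is uniform along a segment. *)
Lemma csc2_sum_inversion (A delta : R) N : (0 < N)%N -> 0 < delta ->
  cabs z <= A -> delta <= complex.Im z ->
  cabs (\sum_(m < N) csc2 (m.+1%:R * z) - z ^- 2 * \sum_(m < N) csc2 (m.+1%:R * (- z^-1))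
     - ((z ^- 2 - 1) * (pi ^+ 2 / 6)%:C%C + pi%:C%C * 'i%C / z))
   <= (4 * c ^- 2 + c^-1 + c^-1 + 2 + A / delta) / N%:R.
Proof.
move=> N0 de0 zA zd.
have nz : 0 < cabs z by rewrite cabs_gt0.
have N0' : 0 < N%:R :> R by rewrite ltr0n.
have cz : c <= cabs z ^+ 2.
  by have := hc 1 0; rewrite expr1n expr0n /= addr0 mulr1 mul1r addr0.
pose a : R := N%:R + 2^-1.
have a0 : 0 < a by rewrite /a; lra.
have e1 := D_Rone N0; have e2 := D_Rtwo N0; have e3 := v_half_tail N0.
have e4 := cot_tail a0.
pose zt : R := \sum_(k < N) (k.+1%:R ^+ 2)^-1.
have e5 : `|pi ^+ 2 / 6 - zt| <= N%:R^-1 by exact: sum_inv_sqr_dist.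
have -> : \sum_(m < N) csc2 (m.+1%:R * (- z^-1)) = \sum_(m < N) csc2 (m.+1%:R / z).
  apply: eq_bigr => m _; rewrite mulrN csc2N // (complex_natE R m.+1).
  by apply: az_neq1; rewrite pnatr_eq0.
set S1 := \sum_(m < N) csc2 _; set S2 := \sum_(m < N) csc2 _.
have E1 : Rone N = S1 - z ^- 2 * zt%:C%C - \sum_(m < N) v (2^-1) m.
  rewrite /Rone !sumrB; congr (_ - _ - _).
  rewrite /zt rmorph_sum /= mulr_sumr; apply: eq_bigr => m _.
  by rewrite exprMn invfM mulrC complex_inv_sqrE.
have E2 : Rtwo N = z ^- 2 * S2 - zt%:C%C - U 2^-1 + (z^-1 * cotpi (a%:C%C / z) - (a^-1)%:C%C).
  rewrite /Rtwo sumrB -mulr_sumr /zt rmorph_sum /=; congr (_ - _ - _ + (_ - _)).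
    by apply: eq_bigr => m _; rewrite complex_inv_sqrE.
  by rewrite fmorphV.
have -> : S1 - z ^- 2 * S2 - ((z ^- 2 - 1) * (pi ^+ 2 / 6)%:C%C + pi%:C%C * 'i%C / z) =
  (Rone N - D N N) - (Rtwo N - D N N) - (U 2^-1 - \sum_(m < N) v (2^-1) m)
  + ((1 - z ^- 2) * (pi ^+ 2 / 6 - zt)%:C%C + z^-1 * (cotpi (a%:C%C / z) - pi%:C%C * 'i%C) - (a^-1)%:C%C).
  by rewrite E1 E2 rmorphB /=; ring.
have f1 : cabs ((1 - z ^- 2) * (pi ^+ 2 / 6 - zt)%:C%C) <= (1 + c^-1) / N%:R.
  rewrite cabsM cabs_real; apply: ler_pM => //; first exact: cabs_ge0.
  apply: le_trans (cabsB _ _) _; rewrite cabs1 lerD2l cabsV cabsX.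
  by rewrite lef_pV2 // posrE ?exprn_gt0.
have f2 : cabs (z^-1 * (cotpi (a%:C%C / z) - pi%:C%C * 'i%C)) <= A / delta / N%:R.
  rewrite cabsM cabsV; apply: (@le_trans _ _ ((cabs z)^-1 * (cabs z ^+ 2 / (a * complex.Im z)))).
    by rewrite ler_wpM2l ?invr_ge0 ?cabs_ge0.
  have -> : (cabs z)^-1 * (cabs z ^+ 2 / (a * complex.Im z)) = cabs z * (complex.Im z)^-1 / a.
    move: (cabs z) nz (complex.Im z) z0 => k k0 y y0; by field; rewrite !gt_eqF.
  rewrite ler_pM ?mulr_ge0 ?invr_ge0 ?cabs_ge0 ?(ltW z0) ?(ltW a0) //.
    by rewrite ler_pM ?invr_ge0 ?cabs_ge0 ?(ltW z0) // lef_pV2 ?posrE.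
  by rewrite lef_pV2 ?posrE // /a lerDl invr_ge0.
have f3 : cabs (a^-1)%:C%C <= 1 / N%:R.
  rewrite cabs_real ger0_norm ?invr_ge0 ?(ltW a0) // mul1r.
  by rewrite lef_pV2 ?posrE // /a lerDl invr_ge0.
set X1 := Rone N - _ in e1 *; set X2 := Rtwo N - _ in e2 *; set X3 := U _ - _ in e3 *.
set Y1 := (1 - _) * _ in f1 *; set Y2 := z^-1 * _ in f2 *; set Y3 := _%:C%C in f3 *.
have := cabsD (X1 - X2 - X3) (Y1 + Y2 - Y3); have := cabsB (X1 - X2) X3; have := cabsB X1 X2.
have := cabsB (Y1 + Y2) Y3; have := cabsD Y1 Y2.
have -> : (4 * c ^- 2 + c^-1 + c^-1 + 2 + A / delta) / N%:R =
  2 * c ^- 2 / N%:R + 2 * c ^- 2 / N%:R + c^-1 / N%:R + (1 + c^-1) / N%:R + A / delta / N%:R + 1 / N%:R.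
  by rewrite -!mulrDl; congr (_ / _); ring.
lra.
Qed.

End QuasiModular.

(** * Inversion of the product for Delta *)

Section DeltaInversion.
Variable R : realType.
Implicit Types (z w : R[i]).

Definition delta_prod N z : R[i] := qexp z * \prod_(m < N) (1 - qexp z ^+ m.+1) ^+ 24.

(** The truncation of the weight two Eisenstein series for which 2 pi i [eis_sum N] is exactly the
    logarithmic derivative of [delta_prod N]. *)
Definition eis_sum N z : R[i] :=
  1 - 24 * \sum_(m < N) m.+1%:R * (qexp z ^+ m.+1 / (1 - qexp z ^+ m.+1)).

Lemma cabs_qexp_lt1 z : 0 < complex.Im z -> cabs (qexp z) < 1.
Proof.
by move=> z0; rewrite cabs_qexp expR_lt1 oppr_lt0 !mulr_gt0 ?pi_gt0.
Qed.

Lemma qexpX_neq1 z m : 0 < complex.Im z -> 1 - qexp z ^+ m.+1 != 0.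
Proof.
move=> z0; rewrite subr_eq0 eq_sym -qexpMn; apply: qexp_neq1.
by rewrite cImM cRe_nat cIm_nat mul0r addr0 mulf_neq0 ?pnatr_eq0 ?gt_eqF.
Qed.

Lemma delta_prod_dlog N (f : R -> R[i]) t d : 0 < complex.Im (f t) -> cderiv f t d ->
  cdlog (fun s => delta_prod N (f s)) t (2 * pi%:C%C * 'i%C * d * eis_sum N (f t)).
Proof.
move=> f0 fd; set k := 2 * pi%:C%C * 'i%C * d.
have qd : cdlog (fun s => qexp (f s)) t k.
  split; first exact: qexp_neq0.
  by apply: cderiv_eq (cderiv_qexp fd) _; rewrite mulrC.
have hm (m : 'I_N) : cdlog (fun s => (1 - qexp (f s) ^+ m.+1) ^+ 24) t
    (24 * (- k * (m.+1%:R * (qexp (f t) ^+ m.+1 / (1 - qexp (f t) ^+ m.+1))))).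
  apply: (@cdlogX R (fun s => 1 - qexp (f s) ^+ m.+1)); split; first exact: qexpX_neq1.
  have [_ dX] := cdlogX m.+1 qd.
  apply: cderiv_eq (cderivB (cderiv_cst 1 t) dX) _.
  have := qexpX_neq1 m f0; move: (qexp _ ^+ _) (m.+1%:R : R[i]) => x j x1.
  by clearbody k; field.
apply: cdlog_eq (cdlogM qd (cdlog_prod _ hm)) _.
rewrite /eis_sum -!mulr_sumr; clearbody k; ring.
Qed.

Lemma geom_tail (x : R[i]) N : 1 - x != 0 ->
  x / (1 - x) - \sum_(k < N) x ^+ k.+1 = x ^+ N.+1 / (1 - x) /\
  x / (1 - x) ^+ 2 - \sum_(k < N) k.+1%:R * x ^+ k.+1
    = x ^+ N.+1 * (N.+1%:R - N%:R * x) / (1 - x) ^+ 2.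
Proof.
move=> x1; elim: N => [|N [IH1 IH2]].
  by rewrite !big_ord0 !subr0 mul0r subr0 expr1 mulr1.
rewrite !big_ord_recr /= !opprD !addrA IH1 IH2 -!natr1 !exprS.
by split; field.
Qed.

(** Cube exp u >= u at u = (n+1)(- ln r)/3. *)
Lemma expX_decay (r : R) : 0 < r < 1 -> exists2 K, 0 < K &
  forall n, n.+1%:R ^+ 2 * r ^+ n.+1 <= K / n.+1%:R.
Proof.
move=> /andP[r0 r1]; have a0 : 0 < - ln r by rewrite oppr_gt0 ln_lt0 ?r0.
have a3 : 0 < - ln r / 3 by rewrite divr_gt0.
exists ((- ln r / 3) ^- 3); first by rewrite invr_gt0 exprn_gt0.
move=> n; set m : R := n.+1%:R; have m0 : 0 < m by rewrite /m.
have -> : r ^+ n.+1 = (expR (m * (- ln r / 3))) ^- 3.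
  rewrite -expRM_natl -expRN -[in LHS](lnK (x := r)) ?posrE // -expRM_natl.
  by congr expR; rewrite /m; field.
set E := expR _.
have hE : m * (- ln r / 3) <= E by have := expR_ge1Dx (m * (- ln r / 3)); rewrite /E; lra.
have b0 : 0 < m * (- ln r / 3) by rewrite mulr_gt0.
apply: (@le_trans _ _ (m ^+ 2 * (m * (- ln r / 3)) ^- 3)).
  rewrite ler_wpM2l ?sqr_ge0 // lef_pV2 ?posrE ?exprn_gt0 //.
    by rewrite ler_pXn2r ?nnegrE ?(ltW b0) // (le_trans (ltW b0)).
  exact: lt_le_trans hE.
move: (- ln r / 3) a3 {hE b0} => a a3; rewrite le_eqVlt; apply/orP; left; apply/eqP.
by clearbody m; field; rewrite !gt_eqF.
Qed.

(** When both sides are expanded in geometric series cut after N terms, they become the same N by N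
    double sum of m q^(m k) with the indices exchanged. Only the geometric tails remain. *)
Lemma lambert_bound z (r : R) N : cabs (qexp z) <= r -> r < 1 ->
  cabs (\sum_(m < N) m.+1%:R * (qexp z ^+ m.+1 / (1 - qexp z ^+ m.+1))
     - \sum_(m < N) qexp z ^+ m.+1 / (1 - qexp z ^+ m.+1) ^+ 2)
  <= 4 / (1 - r) ^+ 2 * (N.+1%:R ^+ 2 * r ^+ N.+1).
Proof.
set q := qexp z => qr r1.
have r0 : 0 <= r by apply: le_trans qr; exact: cabs_ge0.
have s0 : 0 < 1 - r by rewrite subr_gt0.
have qm m : cabs (q ^+ m.+1) <= r.
  rewrite cabsX; apply: le_trans (_ : r ^+ m.+1 <= r).
    by rewrite ler_pXn2r ?nnegrE ?cabs_ge0.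
  by rewrite -[leRHS]expr1 ler_wiXn2l // ltW.
have q1 m : 1 - r <= cabs (1 - q ^+ m.+1).
  by apply: le_trans (cabs_lbD _ _); rewrite cabsN cabs1 lerD2l lerN2.
have qn m : 1 - q ^+ m.+1 != 0 by rewrite -cabs_gt0 (lt_le_trans s0).
have swap : \sum_(m < N) m.+1%:R * \sum_(k < N) (q ^+ m.+1) ^+ k.+1 =
   \sum_(m < N) \sum_(k < N) k.+1%:R * (q ^+ m.+1) ^+ k.+1.
  under eq_bigr do rewrite mulr_sumr; rewrite exchange_big /=.
  by apply: eq_bigr => m _; apply: eq_bigr => k _; rewrite -!exprM mulnC.
set S := \sum_(m < N) _; set T := \sum_(m < N) _.
have -> : S - T = \sum_(m < N) (m.+1%:R * ((q ^+ m.+1) ^+ N.+1 / (1 - q ^+ m.+1))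
   - (q ^+ m.+1) ^+ N.+1 * (N.+1%:R - N%:R * q ^+ m.+1) / (1 - q ^+ m.+1) ^+ 2).
  rewrite sumrB; under eq_bigr => m _ do rewrite -(geom_tail N (qn m)).1 mulrBr.
  rewrite sumrB swap.
  have -> : \sum_(m < N) (q ^+ m.+1) ^+ N.+1 * (N.+1%:R - N%:R * q ^+ m.+1) / (1 - q ^+ m.+1) ^+ 2
     = T - \sum_(m < N) \sum_(k < N) k.+1%:R * (q ^+ m.+1) ^+ k.+1.
    by rewrite /T -sumrB; apply: eq_bigr => m _; rewrite (geom_tail N (qn m)).2.
  by rewrite /S opprB addrA subrK.
apply: le_trans (cabs_sum _ _ _) _.
have rN0 : 0 <= r ^+ N.+1 by exact: exprn_ge0.
have hx m : cabs ((q ^+ m.+1) ^+ N.+1) <= r ^+ N.+1.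
  by rewrite cabsX ler_pXn2r ?nnegrE ?cabs_ge0.
have N1 : N%:R + 1 = N.+1%:R :> R by rewrite natr1.
have N0 : 0 <= N%:R :> R by [].
have s1 : (1 - r)^-1 <= (1 - r) ^- 2.
  by rewrite lef_pV2 ?posrE ?exprn_gt0 // expr2 ler_piMl ?(ltW s0) //; lra.
have i0 : 0 <= (1 - r) ^- 2 by rewrite invr_ge0 sqr_ge0.
apply: (@le_trans _ _ (\sum_(m < N) (3 * N.+1%:R * r ^+ N.+1 / (1 - r) ^+ 2))).
  apply: ler_sum => m _; apply: le_trans (cabsB _ _) _.
  have b1 : cabs (m.+1%:R * ((q ^+ m.+1) ^+ N.+1 / (1 - q ^+ m.+1))) <= N.+1%:R * (r ^+ N.+1 * (1 - r) ^- 2).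
    rewrite !cabsM cabs_nat cabsV; apply: ler_pM; rewrite ?mulr_ge0 ?invr_ge0 ?cabs_ge0 //.
      by rewrite ler_nat ltnS ltnW.
    apply: ler_pM; rewrite ?invr_ge0 ?cabs_ge0 //; apply: le_trans s1.
    by rewrite lef_pV2 ?posrE ?cabs_gt0.
  have b2 : cabs ((q ^+ m.+1) ^+ N.+1 * (N.+1%:R - N%:R * q ^+ m.+1) / (1 - q ^+ m.+1) ^+ 2)
     <= r ^+ N.+1 * (2 * N.+1%:R) * (1 - r) ^- 2.
    rewrite 2!cabsM; apply: ler_pM; rewrite ?mulr_ge0 ?cabs_ge0 //; last first.
      rewrite cabsV cabsX lef_pV2 ?posrE ?exprn_gt0 ?cabs_gt0 //.
      by rewrite ler_pXn2r ?nnegrE ?cabs_ge0 ?(ltW s0).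
    apply: ler_pM; rewrite ?cabs_ge0 //; apply: le_trans (cabsB _ _) _.
    rewrite cabsM !cabs_nat; have := qm m; have := cabs_ge0 (q ^+ m.+1) => h1 h2.
    have : N%:R * cabs (q ^+ m.+1) <= N%:R by rewrite ler_piMr //; lra.
    lra.
  by apply: le_trans (lerD b1 b2) _; rewrite le_eqVlt; apply/orP; left; apply/eqP; ring.
rewrite sumr_const card_ord -[leLHS]mulr_natl.
have -> : 4 / (1 - r) ^+ 2 * (N.+1%:R ^+ 2 * r ^+ N.+1) =
  4 * N.+1%:R * (N.+1%:R * (r ^+ N.+1 * (1 - r) ^- 2)) by ring.
have -> : N%:R * (3 * N.+1%:R * r ^+ N.+1 / (1 - r) ^+ 2) =
  3 * N%:R * (N.+1%:R * (r ^+ N.+1 * (1 - r) ^- 2)) by ring.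
apply: ler_wpM2r; last by lra.
by rewrite !mulr_ge0.
Qed.

Lemma cabs_sum3_le (x1 x2 x3 : R[i]) (a1 a2 a3 n : R) :
  cabs x1 <= a1 / n -> cabs x2 <= a2 / n -> cabs x3 <= a3 / n ->
  cabs (x1 + x2 + x3) <= (a1 + a2 + a3) / n.
Proof.
move=> h1 h2 h3; rewrite !mulrDl; apply: le_trans (cabsD _ _) _; apply: lerD => //.
by apply: le_trans (cabsD _ _) _; apply: lerD.
Qed.

(** Since -24 = 6/pi^2 (2 pi i)^2, multiplying the estimate for T1 and T2 by 6/pi^2 turns (z^(-2) -
    1) pi^2/6 into the constants of the two Eisenstein sums and pi i/z into 6 i/(pi z). *)
Lemma eis_split_bound z (S1 T1 S2 T2 : R[i]) (c k1 k2 n : R) : z != 0 -> 0 < c ->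
  c <= cabs z ^+ 2 -> cabs (S1 - T1) <= k1 / n -> cabs (S2 - T2) <= k1 / n ->
  cabs ((2 * pi%:C%C * 'i%C) ^+ 2 * T1 - z ^- 2 * ((2 * pi%:C%C * 'i%C) ^+ 2 * T2)
    - ((z ^- 2 - 1) * (pi ^+ 2 / 6)%:C%C + pi%:C%C * 'i%C / z)) <= k2 / n ->
  cabs (1 - 24 * S1 - z ^- 2 * (1 - 24 * S2) - 6 * 'i%C / (pi%:C%C * z)) <=
    (24 * k1 + c^-1 * (24 * k1) + 6 / pi ^+ 2 * k2) / n.
Proof.
move=> zn c0 cz l1 l2 main; have p0 := pi_gt0 R.
have zp : 0 < cabs z by rewrite cabs_gt0.
have p0' : pi%:C%C != 0 :> R[i] by rewrite (fmorph_eq0 (real_complex R)) gt_eqF.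
have i2 : ('i%C : R[i]) ^+ 2 = -1 by exact: sqr_i.
have P6 : (pi ^+ 2 / 6)%:C%C = pi%:C%C ^+ 2 / 6 :> R[i] by rewrite rmorphM rmorphXn fmorphV rmorph_nat.
have -> : 1 - 24 * S1 - z ^- 2 * (1 - 24 * S2) - 6 * 'i%C / (pi%:C%C * z) =
  - (24 * (S1 - T1)) + z ^- 2 * (24 * (S2 - T2)) +
  6 / pi%:C%C ^+ 2 * ((2 * pi%:C%C * 'i%C) ^+ 2 * T1 - z ^- 2 * ((2 * pi%:C%C * 'i%C) ^+ 2 * T2)
   - ((z ^- 2 - 1) * (pi ^+ 2 / 6)%:C%C + pi%:C%C * 'i%C / z)).
  rewrite P6 !exprMn i2; move: (pi%:C)%C ('i)%C p0' => p ii p1.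
  by field; rewrite zn p1.
apply: cabs_sum3_le.
- by rewrite cabsN cabsM cabs_nat -[leRHS]mulrA ler_pM2l.
- rewrite -[leRHS]mulrA cabsM; apply: ler_pM; rewrite ?cabs_ge0 //.
    by rewrite cabsV cabsX lef_pV2 ?posrE ?exprn_gt0.
  by rewrite cabsM cabs_nat -[leRHS]mulrA ler_pM2l.
- rewrite -[leRHS]mulrA cabsM; apply: ler_pM; rewrite ?cabs_ge0 //.
  by rewrite cabsM cabsV cabsX cabs_nat cabs_real (gtr0_norm p0).
Qed.

Lemma eis_sum_inversion (delta A : R) : 0 < delta -> 0 < A -> exists2 K : R, 0 <= K &
  forall z N, (0 < N)%N -> delta <= complex.Im z -> cabs z <= A ->
   cabs (eis_sum N z - z ^- 2 * eis_sum N (- z^-1) - 6 * 'i%C / (pi%:C%C * z)) <= K / N%:R.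
Proof.
move=> d0 A0; have p0 := pi_gt0 R.
(* For w = a z + b, |a| <= |w|/delta follows from Im w, and then |b| <= (1 + A/delta) |w|; the
   squares add up to 1/c. *)
pose c : R := (delta ^- 2 + (1 + A / delta) ^+ 2)^-1.
have c0 : 0 < c by rewrite invr_gt0 ltr_pwDl ?sqr_ge0 // invr_gt0 exprn_gt0.
(* A lower bound for both Im z and Im(-1/z), so that one radius [r] serves at both points. *)
pose e := Num.min delta (delta / A ^+ 2).
have e0 : 0 < e by rewrite lt_min d0 divr_gt0 // exprn_gt0.
pose r : R := expR (- (2 * pi * e)).
have r01 : 0 < r < 1 by rewrite expR_gt0 expR_lt1 oppr_lt0 !mulr_gt0.
have [r0 r1] := andP r01.
have [K0 K00 hK0] := expX_decay r01.
pose K1 := 24 * (4 / (1 - r) ^+ 2 * K0).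
have K10 : 0 <= K1 by rewrite !mulr_ge0 ?invr_ge0 ?sqr_ge0 // ltW.
pose K2 := 4 * c ^- 2 + c^-1 + c^-1 + 2 + A / delta.
have K20 : 0 <= K2.
  have h1 : 0 <= c ^- 2 by rewrite invr_ge0 sqr_ge0.
  have h2 : 0 <= A / delta by rewrite divr_ge0 // ltW.
  have h3 : 0 <= c^-1 by rewrite ltW // invr_gt0.
  by rewrite /K2; lra.
exists (K1 + c^-1 * K1 + 6 / pi ^+ 2 * K2).
  have h3 : 0 <= c^-1 by rewrite ltW // invr_gt0.
  have h4 : 0 <= pi ^- 2 :> R by rewrite invr_ge0 sqr_ge0.
  have h5 := mulr_ge0 h3 K10; have h6 := mulr_ge0 h4 K20.
  by rewrite -[6 / _ * _]mulrA; lra.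
move=> z N N0 zd zA; have z0 : 0 < complex.Im z by exact: lt_le_trans zd.
have zn : z != 0 by apply: contraTneq z0 => ->; rewrite ltxx.
have zp : 0 < cabs z by rewrite cabs_gt0.
have hc (a b : R) : c * (a ^+ 2 + b ^+ 2) <= cabs (a%:C%C * z + b%:C%C) ^+ 2.
  rewrite ler_pdivrMl ?ltr_pwDl ?sqr_ge0 ?invr_gt0 ?exprn_gt0 //.
  set w := _ + b%:C%C; have w0 := cabs_ge0 w.
  have ha : `|a| <= delta^-1 * cabs w.
    rewrite ler_pdivlMl //; apply: le_trans (cabs_Im w).
    have -> : complex.Im w = a * complex.Im z by rewrite /w cImD cImM /= mul0r !addr0.
    by rewrite normrM mulrC ler_wpM2l // gtr0_norm.
  have hb : `|b| <= (1 + A / delta) * cabs w.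
    rewrite -(cabs_real b); have -> : b%:C%C = w - a%:C%C * z by rewrite /w addrAC subrr add0r.
    apply: le_trans (cabsB _ _) _; rewrite mulrDl mul1r lerD2l cabsM cabs_real -mulrA mulrC.
    by apply: ler_pM; rewrite ?cabs_ge0.
  rewrite mulrDl; apply: lerD.
    by rewrite -exprVn -exprMn -[leLHS]real_normK ?num_real // ler_pXn2r ?nnegrE ?mulr_ge0 ?invr_ge0 ?(ltW d0).
  rewrite -exprMn -[leLHS]real_normK ?num_real // ler_pXn2r ?nnegrE ?mulr_ge0 //.
  by rewrite addr_ge0 // divr_ge0 // ltW.
have hr w : e <= complex.Im w -> cabs (qexp w) <= r.
  by move=> he; rewrite cabs_qexp ler_expR lerN2 !ler_pM2l ?mulr_gt0.
have q1 : cabs (qexp z) <= r by apply: hr; rewrite ge_min zd.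
have q2 : cabs (qexp (- z^-1)) <= r.
  apply: hr; rewrite cImN cImV mulNr opprK ge_min; apply/orP; right.
  apply: ler_pM; rewrite ?invr_ge0 ?sqr_ge0 ?(ltW d0) //.
  by rewrite lef_pV2 ?posrE ?exprn_gt0 // ler_pXn2r ?nnegrE ?cabs_ge0 ?(ltW A0).
have N0' : 0 < N%:R :> R by rewrite ltr0n.
have l1 := lambert_bound N q1 r1; have l2 := lambert_bound N q2 r1.
have hN : 4 / (1 - r) ^+ 2 * (N.+1%:R ^+ 2 * r ^+ N.+1) <= 4 / (1 - r) ^+ 2 * K0 / N%:R.
  rewrite -[leRHS]mulrA ler_wpM2l ?mulr_ge0 ?invr_ge0 ?sqr_ge0 //.
  apply: le_trans (hK0 N) _; rewrite ler_wpM2l ?(ltW K00) // lef_pV2 ?posrE //.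
  by rewrite ler_nat.
have cz : c <= cabs z ^+ 2.
  by have := hc 1 0; rewrite expr1n expr0n /= addr0 mulr1 mul1r addr0.
have main := csc2_sum_inversion z0 c0 hc N0 d0 zA zd.
have E w : \sum_(m < N) csc2 (m.+1%:R * w) =
   (2 * pi%:C%C * 'i%C) ^+ 2 * \sum_(m < N) qexp w ^+ m.+1 / (1 - qexp w ^+ m.+1) ^+ 2.
  by rewrite mulr_sumr; apply: eq_bigr => m _; rewrite /csc2 qexpMn mulrA.
rewrite !E in main.
exact: (eis_split_bound zn c0 cz (le_trans l1 hN) (le_trans l2 hN) main).
Qed.

Lemma delta_prod_inversion z (L L' : R[i]) : 0 < complex.Im z ->
  ccvg (fun N => delta_prod N z) L -> ccvg (fun N => delta_prod N (- z^-1)) L' ->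
  L' = z ^+ 12 * L.
Proof.
move=> z0 cL cL'.
have zn : z != 0 by apply: contraTneq z0 => ->; rewrite ltxx.
pose f (t : R) : R[i] := 'i%C + t%:C%C * (z - 'i%C).
pose d : R[i] := z - 'i%C.
have fd t : cderiv f t d.
  apply: cderiv_eq (cderivD (cderiv_cst 'i%C t) (cderivM (cderiv_real t) (cderiv_cst d t))) _.
  by rewrite mulr0 addr0 add0r mul1r.
pose delta := Num.min 1 (complex.Im z); pose A := 1 + cabs z.
have d0 : 0 < delta by rewrite lt_min ltr01.
have A0 : 0 < A by rewrite ltr_wpDr ?cabs_ge0.
have fim t : 0 <= t <= 1 -> delta <= complex.Im (f t).
  move=> /andP[t0 t1].
  have -> : complex.Im (f t) = (1 - t) * 1 + t * complex.Im z.
    by rewrite /f cImD cImM cImD cImN cReD cReN /=; ring.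
  have h1 : delta <= 1 by rewrite ge_min lexx.
  have h2 : delta <= complex.Im z by rewrite ge_min lexx orbT.
  nra.
have fA t : 0 <= t <= 1 -> cabs (f t) <= A.
  move=> /andP[t0 t1].
  have -> : f t = (1 - t)%:C%C * 'i%C + t%:C%C * z.
    by rewrite /f rmorphB /=; ring.
  apply: le_trans (cabsD _ _) _; rewrite !cabsM cabs_i !cabs_real mulr1 !ger0_norm ?subr_ge0 //.
  have := cabs_ge0 z; rewrite /A; nra.
have fp t : 0 <= t <= 1 -> 0 < complex.Im (f t) by move=> /fim; exact: lt_le_trans.
have fn t : 0 <= t <= 1 -> f t != 0.
  by move=> /fp h; apply: contraTneq h => ->; rewrite ltxx.
have [K K0 hK] := eis_sum_inversion d0 A0.
have p0 := pi_gt0 R.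
(* The ratio that must tend to 1. It equals 1 at t = 0, since i is fixed by inversion and i^12 = 1,
   and its logarithmic derivative [a N] is O(1/N) uniformly in t. *)
pose Phi N t := delta_prod N (- (f t)^-1) * (f t ^+ 12)^-1 * (delta_prod N (f t))^-1.
pose a N t := - (2 * pi%:C%C * 'i%C * d) *
  (eis_sum N (f t) - f t ^- 2 * eis_sum N (- (f t)^-1) - 6 * 'i%C / (pi%:C%C * f t)).
have invim t : 0 <= t <= 1 -> 0 < complex.Im (- (f t)^-1).
  move=> ht; rewrite cImN cImV mulNr opprK divr_gt0 ?fp //.
  by rewrite exprn_gt0 // cabs_gt0 fn.
have Phid N t : 0 <= t <= 1 -> cdlog (Phi N) t (a N t).
  move=> ht; have ft0 := fn _ ht.
  have h1 := delta_prod_dlog N (invim _ ht) (cderivN (cderivV ft0 (fd t))).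
  have h2 : cdlog f t (d / f t).
    by split => //; rewrite mulrCA divff // mulr1.
  have h3 := delta_prod_dlog N (fp _ ht) (fd t).
  apply: cdlog_eq (cdlogM (cdlogM h1 (cdlogV (cdlogX 12 h2))) (cdlogV h3)) _.
  rewrite /a.
  have p0' : pi%:C%C != 0 :> R[i] by rewrite (fmorph_eq0 (real_complex R)) gt_eqF.
  have i2 : ('i%C : R[i]) ^+ 2 = -1 by exact: sqr_i.
  (* The weight 12 matches the quasi-modular term through 12/(2 pi i) = -6 i/pi; writing i^2 out
     makes this an identity with i as an indeterminate. *)
  have -> : 12%:R * (d / f t) = - (12 * ('i%C ^+ 2) * (d / f t)) by rewrite i2; ring.
  move: (eis_sum N (- (f t)^-1)) (eis_sum N (f t)) => e2 e1.
  move: (f t) ft0 (d : R[i]) (pi%:C)%C ('i)%C p0' => y y0 dd p ii p1.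
  by field; rewrite y0 p1.
have ab N t : (0 < N)%N -> 0 <= t <= 1 -> cabs (a N t) <= 2 * pi * cabs d * K / N%:R.
  move=> N0 ht; rewrite /a cabsM cabsN !cabsM cabs_nat cabs_i cabs_real (gtr0_norm p0) mulr1.
  by rewrite -[leRHS]mulrA ler_wpM2l ?mulr_ge0 ?cabs_ge0 ?(ltW p0) //; apply: hK; rewrite ?fim ?fA.
have ii1 : - ('i%C : R[i])^-1 = 'i%C.
  by apply: complex_eqP => /=; rewrite ?oppr0 ?mul0r ?oppr0 // expr0n expr1n add0r divr1 opprK.
have Phi0 N : Phi N 0 = 1.
  have f0 : f 0 = 'i%C by rewrite /f mul0r addr0.
  have i12 : ('i%C : R[i]) ^+ 12 = 1.
    have i2 : ('i%C : R[i]) ^+ 2 = -1 by exact: sqr_i.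
    by rewrite (exprM _ 2 6) i2 -signr_odd.
  rewrite /Phi f0 ii1 i12 invr1 mulr1 divff //.
  have [|+ _] := Phid N 0; first by rewrite lexx ler01.
  by rewrite /Phi f0 ii1 !mulf_eq0 !negb_or => /andP[/andP[]].
have f1 : f 1 = z by rewrite /f mul1r addrC subrK.
have cPhi : ccvg (fun N => Phi N 1) 1.
  pose K' := 2 * pi * cabs d * K.
  have K'0 : 0 <= K' by rewrite !mulr_ge0 ?cabs_ge0 ?(ltW p0).
  have [N1 hN1] := archi_inv K' ltr01.
  (* The last factor 2 pays for 1/N <= 2/(N+1). *)
  apply: (ccvg_inv (K := 2 * expR 1 * K' * 2) (N := N1.+1)) => N NN.
  have N0 : (0 < N)%N by apply: leq_trans NN.
  have := @cdlog_small R (Phi N) (a N) (K' / N%:R) _ (Phid N) (fun t ht => ab N t N0 ht).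
  rewrite Phi0 cabs1 mulr1 => h; apply: le_trans (h _) _.
    by case: N N0 NN {h} => // N _ NN; apply/ltW; exact: hN1.
  clearbody K'; rewrite -!mulrA ler_pM2l // ler_pM2l ?expR_gt0 // ler_wpM2l //.
  rewrite ler_pdivlMr // mulrC ler_pdivrMr ?ltr0n //.
  have : 1 <= N%:R :> R by rewrite -[1]/(1%:R) ler_nat.
  by rewrite -natr1; lra.
have cR := ccvgM cPhi (ccvgZ (z ^+ 12) cL); rewrite mul1r in cR.
apply: ccvg_uniq cL' _; apply: (ccvg_ext (N := 0)) cR => N _.
have [|+ _] := Phid N 1; first by rewrite lexx ler01.
rewrite /Phi f1 !mulf_eq0 !negb_or !invr_eq0 => /andP[/andP[h1 h2] h3].
by move: (z ^+ 12) (delta_prod _ _) (delta_prod _ _) h1 h2 h3 => x y w h1 h2 h3; field; rewrite h2 h3.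
Qed.

End DeltaInversion.

(** * Power series and Parseval *)

Section QSeries.
Variable R : realType.
Implicit Types (a : nat -> R) (q z : R[i]) (r : R).

Lemma sum_geom_le (x : R) m n : 0 <= x < 1 -> \sum_(m <= k < n) x ^+ k <= x ^+ m / (1 - x).
Proof.
move=> /andP[x0 x1]; have s0 : 0 < 1 - x by rewrite subr_gt0.
have [nm|mn] := leqP n m.
  by rewrite big_geq // divr_ge0 ?exprn_ge0 // ltW.
rewrite ler_pdivlMr // mulrC mulr_sumr.
under eq_bigr do rewrite mulrBl mul1r -exprS -opprB.
rewrite sumrN telescope_sumr ?(ltnW mn) // opprB gerBl exprn_ge0 //.
Qed.

(** Equivalent to convergence of the power series throughout the open unit disc. *)
Definition subexp a := forall r, 0 < r < 1 -> exists B, forall n, `|a n| * r ^+ n <= B.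

Definition qpsum a q N : R[i] := \sum_(n < N) (a n)%:C%C * q ^+ n.

Definition qsum a q : R[i] :=
  Complex (limn (series (fun n => a n * complex.Re (q ^+ n))))
          (limn (series (fun n => a n * complex.Im (q ^+ n)))).

Lemma subexp_geom a r : subexp a -> 0 <= r < 1 -> exists B x, [/\ 0 <= B, 0 <= x < 1 &
  forall n, `|a n| * r ^+ n <= B * x ^+ n].
Proof.
move=> ha /andP[r0 r1]; pose r' := (1 + r) / 2.
have r'0 : 0 < r' by rewrite /r'; lra.
have [|B hB] := ha r'; first by apply/andP; split; rewrite /r'; lra.
exists B, (r / r'); split.
- by apply: le_trans (hB 0%N); rewrite mulr_ge0.
- by rewrite divr_ge0 ?(ltW r'0) //= ltr_pdivrMr // mul1r /r'; lra.
move=> n; have e : r' * (r / r') = r by rewrite mulrC divfK ?gt_eqF.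
rewrite -{1}e exprMn mulrA ler_wpM2r ?hB // exprn_ge0 // divr_ge0 //.
exact: ltW.
Qed.

Lemma qsum_cvg a q : subexp a -> cabs q < 1 -> ccvg (qpsum a q) (qsum a q).
Proof.
move=> ha q1; have [|B [x [B0 /andP[x0 x1] hB]]] := subexp_geom ha (r := cabs q).
  by rewrite cabs_ge0.
have cv (f : R[i] -> R) : (forall w, `|f w| <= cabs w) ->
    cvgn (series (fun n => a n * f (q ^+ n))).
  move=> hf; apply: normed_cvg.
  apply: (@series_le_cvg _ _ (fun n => B * x ^+ n)).
  - by move=> n; exact: normr_ge0.
  - by move=> n; rewrite mulr_ge0 ?exprn_ge0.
  - move=> n /=; rewrite normrM; apply: le_trans (hB n).
    by rewrite ler_wpM2l // -cabsX.
  - by apply: is_cvg_geometric_series; rewrite ger0_norm.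
have E (f : R[i] -> R) n : (forall u v, f (u + v) = f u + f v) -> f 0 = 0 ->
    (forall b w, f (b%:C%C * w) = b * f w) ->
    f (qpsum a q n) = series (fun n => a n * f (q ^+ n)) n.
  move=> fD f0 fZ; rewrite /qpsum /series /= big_mkord.
  by elim/big_rec2: _ => [|i y1 y2 _ <-]; rewrite ?fD ?fZ.
have ER n : complex.Re (qpsum a q n) = series (fun n => a n * complex.Re (q ^+ n)) n.
  by apply: E => // [u v|b w]; rewrite ?cReD // cReM /= mul0r subr0.
have EI n : complex.Im (qpsum a q n) = series (fun n => a n * complex.Im (q ^+ n)) n.
  by apply: E => // [u v|b w]; rewrite ?cImD // cImM /= mul0r addr0.
apply: ccvg_ReIm.
  by under eq_fun do rewrite ER; apply: cv; exact: cabs_Re.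
by under eq_fun do rewrite EI; apply: cv; exact: cabs_Im.
Qed.

Lemma cabs_term a q n : cabs ((a n)%:C%C * q ^+ n) = `|a n| * cabs q ^+ n.
Proof. by rewrite cabsM cabs_real cabsX. Qed.

Lemma qsum_tail a r e : subexp a -> 0 <= r < 1 -> 0 < e -> exists N0, forall N q, (N0 <= N)%N ->
  cabs q <= r -> cabs (qsum a q - qpsum a q N) <= e.
Proof.
move=> ha r01 e0; have [B [x [B0 /andP[x0 x1] hB]]] := subexp_geom ha r01.
have s0 : 0 < 1 - x by rewrite subr_gt0.
have : (fun n => B / (1 - x) * x ^+ n) @ \oo --> (0 : R).
  rewrite -(mulr0 (B / (1 - x))); apply: cvgMr.
  by apply: cvg_expr; rewrite ger0_norm.
move=> /cvgr0Pnorm_le /(_ _ e0)[N0 _ hN0].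
exists N0 => N q NN qr; have [r0 r1] := andP r01.
have cq := qsum_cvg ha (le_lt_trans qr r1).
apply: (ccvg_le (N := N)) (ccvgB cq (ccvg_cst _)) _ => M NM.
rewrite /qpsum -!(big_mkord xpredT (fun n => (a n)%:C%C * q ^+ n)) (big_cat_nat (n := N)) //=.
rewrite addrAC subrr add0r; apply: le_trans (cabs_sum _ _ _) _.
apply: (@le_trans _ _ (\sum_(N <= n < M) B * x ^+ n)).
  apply: ler_sum => n _; rewrite cabs_term; apply: le_trans (hB n).
  by rewrite ler_wpM2l // lerXn2r ?nnegrE ?cabs_ge0.
rewrite -mulr_sumr; apply: le_trans (_ : B * (x ^+ N / (1 - x)) <= _).
  by rewrite ler_wpM2l // sum_geom_le // x0.
have := hN0 N NN; rewrite /= ger0_norm ?mulr_ge0 ?invr_ge0 ?exprn_ge0 ?(ltW s0) //.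
by rewrite -mulrA [_^-1 * _]mulrC.
Qed.

(* Parseval on the circle of radius [r], in discrete form: for a polynomial of
   degree less than [M], averaging over the [M]-th roots of unity is exact. *)
Lemma qpsum_parseval a (r x : R) (M : nat) : (0 < M)%N ->
  \sum_(j < M) cabs (qpsum a (r%:C%C * qexp (x%:C%C + j%:R / M%:R)) M) ^+ 2 =
  M%:R * \sum_(n < M) a n ^+ 2 * r ^+ n ^+ 2.
Proof.
move=> M0; have M0' : M%:R != 0 :> R[i] by rewrite pnatr_eq0 -lt0n.
apply: (@complexI R).
rewrite !rmorphM !rmorph_sum /= rmorph_nat mulr_sumr.
have cabs2 (w : R[i]) : (cabs w ^+ 2)%:C%C = w * conjc w.
  by rewrite cabs_sqr add_Re2_Im2 sqr_normc.
have cqexp (y : R) : conjc (qexp y%:C%C) = qexp (- y%:C%C).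
  by apply: complex_eqP; rewrite /= !mulr0 oppr0 ?mulr0 ?oppr0 mulrN ?cosN ?sinN // mulrN.
have y_real (j : nat) : x%:C%C + j%:R / M%:R = (x + j%:R / M%:R)%:C%C :> R[i].
  by rewrite rmorphD rmorphM fmorphV !rmorph_nat.
have key (n m : nat) : (n < M)%N -> (m < M)%N ->
   \sum_(j < M) qexp (x%:C%C + j%:R / M%:R) ^+ n * qexp (- (x%:C%C + j%:R / M%:R)) ^+ m
   = if n == m then M%:R else 0.
  move=> nM mM.
  (* The exponent n - m is raised by M to remain a natural number; the integer j that this adds to
     the argument is invisible to [qexp]. *)
  have E (j : 'I_M) : qexp (x%:C%C + j%:R / M%:R) ^+ n * qexp (- (x%:C%C + j%:R / M%:R)) ^+ m =
     qexp (n%:R * x%:C%C - m%:R * x%:C%C) * qexp ((n + (M - m))%:R / M%:R) ^+ j.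
    rewrite -!qexpMn -!qexpD natrD natrB 1?ltnW //.
    rewrite -[RHS]mulr1 -[X in _ = _ * X](qexp_int R (- j%:Z)) -qexpD; congr qexp.
    by rewrite mulrNz -pmulrn; field.
  rewrite (eq_bigr _ (fun j _ => E j)) -mulr_sumr sum_roots_unity //.
  case: eqVneq => [->|nm]; first by rewrite subnKC 1?ltnW // dvdnn subrr qexp0 mul1r.
  rewrite ifN ?mulr0 //; apply/negP => /dvdnP[[|[|k]] hk].
  - lia.
  - by move/eqP: nm; apply; lia.
  - have : (2 * M <= k.+2 * M)%N by rewrite leq_mul2r orbT.
    lia.
have E2 (j : 'I_M) : (cabs (qpsum a (r%:C%C * qexp (x%:C%C + j%:R / M%:R)) M) ^+ 2)%:C%C =
   \sum_(n < M) \sum_(m < M) (a n)%:C%C * (a m)%:C%C * r%:C%C ^+ n * r%:C%C ^+ m *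
     (qexp (x%:C%C + j%:R / M%:R) ^+ n * qexp (- (x%:C%C + j%:R / M%:R)) ^+ m).
  rewrite cabs2 /qpsum [conjc _]rmorph_sum big_distrlr /=.
  apply: eq_bigr => n _; apply: eq_bigr => m _.
  have -> : conjc ((a m)%:C%C * (r%:C%C * qexp (x%:C%C + j%:R / M%:R)) ^+ m) =
      (a m)%:C%C * (r%:C%C * qexp (- (x%:C%C + j%:R / M%:R))) ^+ m.
    have cM (u v : R[i]) : conjc (u * v) = conjc u * conjc v by rewrite rmorphM.
    have cX (u : R[i]) k : conjc (u ^+ k) = conjc u ^+ k by rewrite rmorphXn.
    by rewrite y_real -cqexp cM cX cM !conjc_real.
  by rewrite !exprMn; ring.
under eq_bigr => j _ do rewrite E2.
rewrite exchange_big /=; apply: eq_bigr => n _.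
rewrite exchange_big /= (bigD1 n) //= [X in _ + X]big1 ?addr0.
  rewrite -mulr_sumr key // eqxx !rmorphM /= !rmorphXn /=; ring.
move=> m mn; rewrite -mulr_sumr key //; case: eqP => [h|]; last by rewrite mulr0.
by case/eqP: mn; apply: val_inj.
Qed.

(** The discrete Parseval identity applies to a partial sum, whose distance to the series is at most
    e uniformly on the circle. This gives (S + e)^2 for every e > 0. *)
Lemma qsum_l2_bound a (y S : R) : subexp a -> 0 < y ->
  (forall z, complex.Im z = y -> cabs (qsum a (qexp z)) <= S) ->
  forall N, \sum_(n < N) a n ^+ 2 * expR (- (2 * pi * y)) ^+ n ^+ 2 <= S ^+ 2.
Proof.
move=> ha y0 hS N; pose r := expR (- (2 * pi * y)).
have r01 : 0 <= r < 1.
  by rewrite expR_ge0 expR_lt1 oppr_lt0 !mulr_gt0 ?pi_gt0.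
have S0 : 0 <= S.
  by apply: le_trans (hS (Complex 0 y) _) => //; exact: cabs_ge0.
have main e : 0 < e -> \sum_(n < N) a n ^+ 2 * r ^+ n ^+ 2 <= (S + e) ^+ 2.
  move=> e0; have [N0 hN0] := qsum_tail ha r01 e0.
  pose M := (maxn N N0).+1.
  have E : r%:C%C = qexp (Complex 0 y).
    by apply: complex_eqP; rewrite /= mulr0 ?cos0 ?sin0 ?mulr1 ?mulr0.
  apply: (@le_trans _ _ (\sum_(n < M) a n ^+ 2 * r ^+ n ^+ 2)).
    rewrite -!(big_mkord xpredT (fun n => a n ^+ 2 * r ^+ n ^+ 2)).
    rewrite [leRHS](big_cat_nat (n := N)) //=; last by rewrite /M ltnW // ltnS leq_maxl.
    by rewrite lerDl sumr_ge0 // => n _; rewrite mulr_ge0 ?sqr_ge0.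
  have M0 : 0 < M%:R :> R by rewrite ltr0n.
  rewrite -(ler_pM2l M0) -(@qpsum_parseval a r 0) //.
  apply: (@le_trans _ _ (\sum_(j < M) (S + e) ^+ 2)); last first.
    by rewrite sumr_const card_ord -[leLHS]mulr_natl.
  apply: ler_sum => j _; rewrite ler_pXn2r ?nnegrE ?cabs_ge0 ?addr_ge0 ?(ltW e0) //.
  rewrite E -qexpD; set z := _ + _.
  have zy : complex.Im z = y.
    rewrite /z cImD /= add0r; have -> : j%:R / M%:R = (j%:R / M%:R)%:C%C :> R[i].
      by rewrite rmorphM fmorphV !rmorph_nat.
    by rewrite /= addr0.
  have qr : cabs (qexp z) <= r by rewrite cabs_qexp zy.
  have MN : (N0 <= M)%N by rewrite /M leqW // leq_maxr.
  have h2 := hN0 M _ MN qr; have h1 := hS z zy.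
  have -> : qpsum a (qexp z) M = qsum a (qexp z) - (qsum a (qexp z) - qpsum a (qexp z) M) by ring.
  by apply: le_trans (cabsB _ _) _; exact: lerD.
rewrite leNgt; apply/negP => lt.
pose f (e : R) := (S + e) ^+ 2.
set T := \sum_(n < N) _ in lt main.
have T0 : 0 < T - S ^+ 2 by rewrite subr_gt0.
(* With e <= 1, (S + e)^2 - S^2 <= e (2 S + 1), at most half of the supposed gap. *)
pose e := Num.min 1 ((T - S ^+ 2) / (2 * (2 * S + 1))).
have dS : 0 < 2 * (2 * S + 1) by lra.
have e0 : 0 < e by rewrite lt_min ltr01 divr_gt0.
have e1 : e <= 1 by rewrite ge_min lexx.
have e2 : e * (2 * (2 * S + 1)) <= T - S ^+ 2.
  by rewrite -ler_pdivlMr // ge_min lexx orbT.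
have := main e e0; nra.
Qed.

Lemma qsum_coef_bound a (y S : R) n : subexp a -> 0 < y ->
  (forall z, complex.Im z = y -> cabs (qsum a (qexp z)) <= S) ->
  `|a n| * expR (- (2 * pi * y)) ^+ n <= S.
Proof.
move=> ha y0 hS.
have S0 : 0 <= S.
  by apply: le_trans (hS (Complex 0 y) _) => //; exact: cabs_ge0.
have := qsum_l2_bound ha y0 hS n.+1; rewrite big_ord_recr /= => h.
rewrite -(@ler_pXn2r _ 2) ?nnegrE ?mulr_ge0 ?exprn_ge0 ?expR_ge0 //.
rewrite exprMn real_normK ?num_real //; apply: le_trans h; rewrite lerDr.
by apply: sumr_ge0 => k _; rewrite mulr_ge0 ?sqr_ge0.
Qed.

End QSeries.

(** * Modularity of Delta *)

Section TauCoefficients.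
Implicit Types (p q P Q : {poly int}) (i k m N : nat).

Let dom p P := forall i, `|p`_i| <= P`_i.

Let domM p P q Q : dom p P -> dom q Q -> dom (p * q) (P * Q).
Proof.
move=> pP qQ i; rewrite !coefM; apply: le_trans (ler_norm_sum _ _ _) _.
by apply: ler_sum => j _; rewrite normrM ler_pM.
Qed.

Let dom1 : dom 1 1.
Proof. by move=> i; rewrite coef1; case: eqP. Qed.

Let dom_factor k : dom (1 - 'X^k) (1 + 'X^k).
Proof.
move=> i; rewrite coefB coefD coef1 coefXn; apply: le_trans (ler_normB _ _) _.
by case: eqP; case: eqP.
Qed.

Definition tau_majorant N : {poly int} := 'X * \prod_(1 <= k < N.+1) (1 + 'X^k) ^+ 24.

Lemma tau_poly_dom N i : `|(tau_poly N)`_i| <= (tau_majorant N)`_i.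
Proof.
suff : dom (tau_poly N) (tau_majorant N) by [].
apply: domM; first by move=> j; rewrite coefX; case: eqP.
elim/big_ind2: _ => [|? ? ? ? h1 h2|k _]; [exact: dom1|exact: domM|].
by elim: 24%N => [|n IH]; [exact: dom1|rewrite !exprS; exact: domM (dom_factor k) IH].
Qed.

Lemma tau_polyS N : tau_poly N.+1 = tau_poly N * (1 - 'X^(N.+1)) ^+ 24.
Proof. by rewrite /tau_poly big_nat_recr //= mulrA. Qed.

Lemma coef_mul_factorX p m i n : (i < m)%N -> (p * (1 - 'X^m) ^+ n)`_i = p`_i.
Proof.
move=> im; elim: n => [|n IH]; first by rewrite expr0 mulr1.
by rewrite exprSr mulrA mulrBr mulr1 coefB coefMXn im subr0.
Qed.

Lemma tau_polyE N i : (i <= N)%N -> (tau_poly N)`_i = tau i.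
Proof.
elim: N => [|N IH]; first by rewrite leqn0 => /eqP ->.
rewrite leq_eqVlt => /predU1P[->//|iN].
by rewrite tau_polyS coef_mul_factorX // IH.
Qed.

Lemma tau0 : tau 0 = 0.
Proof. by rewrite /tau /tau_poly mulrC coefMX. Qed.

Lemma tau1 : tau 1 = 1.
Proof.
rewrite /tau /tau_poly mulrC coefMX /= big_nat1 -[_ ^+ 24]mul1r coef_mul_factorX //.
by rewrite coef1.
Qed.

Lemma horner_tau_poly (K : comNzRingType) (x : K) N :
  (map_poly intr (tau_poly N)).[x] = x * \prod_(k < N) (1 - x ^+ k.+1) ^+ 24.
Proof.
rewrite /tau_poly rmorphM rmorph_prod /= map_polyX hornerM hornerX horner_prod.
congr (_ * _); rewrite big_add1 big_mkord; apply: eq_bigr => k _.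
by rewrite rmorphXn /= rmorphB rmorph1 /= map_polyXn !hornerE.
Qed.

Lemma horner_tau_majorant (K : comNzRingType) (x : K) N :
  (map_poly intr (tau_majorant N)).[x] = x * \prod_(k < N) (1 + x ^+ k.+1) ^+ 24.
Proof.
rewrite /tau_majorant rmorphM rmorph_prod /= map_polyX hornerM hornerX horner_prod.
congr (_ * _); rewrite big_add1 big_mkord; apply: eq_bigr => k _.
by rewrite rmorphXn /= rmorphD rmorph1 /= map_polyXn !hornerE.
Qed.

(** One term of the majorant is at most its value at r, itself at most the exponential of 24 times a
    geometric sum. The bound is uniform in N, which allows the products to be compared with the
    series. *)
Lemma tau_poly_growth (R : realType) (r : R) N i : 0 < r < 1 ->
  `|(tau_poly N)`_i|%:~R * r ^+ i <= expR (24 / (1 - r)).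
Proof.
move=> /andP[r0 r1]; have s0 : 0 < 1 - r by rewrite subr_gt0.
have G0 j : 0 <= (tau_majorant N)`_j by apply: le_trans (tau_poly_dom N j).
apply: (@le_trans _ _ (((tau_majorant N)`_i)%:~R * r ^+ i)).
  by rewrite ler_wpM2r ?exprn_ge0 ?(ltW r0) // ler_int tau_poly_dom.
apply: (@le_trans _ _ (map_poly intr (tau_majorant N)).[r]).
  rewrite (horner_coef_wide _ (n := maxn (size (tau_majorant N)) i.+1)); last first.
    by apply: leq_trans (size_poly _ _) _; exact: leq_maxl.
  have iM : (i < maxn (size (tau_majorant N)) i.+1)%N by exact: leq_maxr.
  rewrite (bigD1 (Ordinal iM)) //= coef_map lerDl sumr_ge0 // => j _.
  by rewrite coef_map mulr_ge0 ?exprn_ge0 ?(ltW r0) // ler0z.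
rewrite horner_tau_majorant.
apply: (@le_trans _ _ (\prod_(k < N) expR (24 * r ^+ k.+1))).
  rewrite -[leRHS]mul1r ler_pM ?(ltW r1) ?(ltW r0) //.
    by apply: prodr_ge0 => k _; rewrite exprn_ge0 // addr_ge0 ?exprn_ge0 // ltW.
  apply: ler_prod => k _; rewrite exprn_ge0 ?addr_ge0 ?exprn_ge0 ?(ltW r0) //=.
  by rewrite expRM_natl lerXn2r ?nnegrE ?addr_ge0 ?exprn_ge0 ?expR_ge0 ?expR_ge1Dx ?(ltW r0).
rewrite -expR_sum ler_expR -mulr_sumr ler_pM2l //.
rewrite -(big_mkord xpredT (fun k => r ^+ k.+1)) -(big_add1 _ _ 0 N.+1 xpredT (fun k => r ^+ k)).
apply: le_trans (sum_geom_le 1 N.+1 _) _; first by rewrite (ltW r0).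
by rewrite expr1 -[leRHS]mul1r ler_wpM2r ?invr_ge0 ?(ltW s0) ?(ltW r1).
Qed.

End TauCoefficients.

(** * Delta as a power series and its behaviour under SL(2, Z) *)

Section Delta.
Variable R : realType.
Implicit Types (z w : R[i]).

Definition tauR n : R := (tau n)%:~R.

Lemma tauR_subexp : subexp tauR.
Proof.
move=> r r01; exists (expR (24 / (1 - r))) => n.
by have := tau_poly_growth n n r01; rewrite -/(tau n) intr_norm.
Qed.

Definition Delta z := qsum tauR (qexp z).

Lemma geom_small (x K e : R) : 0 <= x < 1 -> 0 < e -> exists N0, forall N, (N0 <= N)%N -> K * x ^+ N < e.
Proof.
move=> /andP[x0 x1] e0.
have : (fun n => K * x ^+ n) @ \oo --> (0 : R).
  rewrite -(mulr0 K); apply: cvgMr.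
  by apply: cvg_expr; rewrite ger0_norm.
move=> /cvgr0Pnorm_lt /(_ _ e0)[N0 _ hN0].
by exists N0 => N /hN0; exact: le_lt_trans (ler_norm _).
Qed.

(** As a polynomial in q, the N-th product has the coefficients of the series up to degree N. The
    later ones are bounded uniformly in N at a radius r' between |q| and 1, so they contribute
    O((|q|/r')^N). *)
Lemma delta_prod_cvg z : 0 < complex.Im z -> ccvg (fun N => delta_prod N z) (Delta z).
Proof.
move=> z0; have q1 := cabs_qexp_lt1 z0; have c := qsum_cvg tauR_subexp q1.
rewrite /Delta; set q := qexp z in q1 c *.
pose r := cabs q; pose r' := (1 + r) / 2.
have r0 : 0 <= r by exact: cabs_ge0.
have r1 : r < 1 := q1.
have r'0 : 0 < r' by rewrite /r'; lra.
have r'01 : 0 < r' < 1 by apply/andP; split; rewrite /r'; lra.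
pose B := expR (24 / (1 - r')) : R; pose x := r / r'.
have x01 : 0 <= x < 1.
  by rewrite divr_ge0 ?(ltW r'0) //= ltr_pdivrMr // mul1r /r' /r; lra.
have [x0 x1] := andP x01; have s0 : 0 < 1 - x by rewrite subr_gt0.
have hB N i : `|((tau_poly N)`_i)%:~R| * r ^+ i <= B * x ^+ i.
  have e : r' * x = r by rewrite /x mulrC divfK ?gt_eqF.
  rewrite -e exprMn mulrA ler_wpM2r ?exprn_ge0 //.
  by rewrite -intr_norm; exact: tau_poly_growth.
have d0 : ccvg (fun N => delta_prod N z - qpsum tauR q N) 0.
  move=> e e0; have [N0 hN0] := geom_small (B / (1 - x)) x01 e0.
  exists N0 => N NN; rewrite subr0; apply: le_lt_trans (hN0 N NN).
  pose M := maxn (size (tau_poly N)) N.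
  have NM : (N <= M)%N by exact: leq_maxr.
  have -> : delta_prod N z = \sum_(0 <= i < M) ((tau_poly N)`_i)%:~R * q ^+ i.
    rewrite /delta_prod -/q -horner_tau_poly (horner_coef_wide _ (n := M)); last first.
      by apply: leq_trans (size_poly _ _) _; exact: leq_maxl.
    by rewrite big_mkord; apply: eq_bigr => i _; rewrite coef_map.
  rewrite (big_cat_nat (n := N)) //= [X in X + _ - _](_ : _ = qpsum tauR q N).
    rewrite addrAC subrr add0r; apply: le_trans (cabs_sum _ _ _) _.
    apply: (@le_trans _ _ (\sum_(N <= i < M) B * x ^+ i)).
      apply: ler_sum => i _; rewrite complex_intE cabsM cabs_real cabsX; exact: hB.
    rewrite -mulr_sumr; apply: le_trans (_ : B * (x ^+ N / (1 - x)) <= _).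
      by rewrite ler_wpM2l ?expR_ge0 // sum_geom_le.
    by rewrite -mulrA [_^-1 * _]mulrC.
  rewrite /qpsum big_mkord; apply: eq_bigr => i _.
  by rewrite tau_polyE ?(ltnW (ltn_ord i)) // complex_intE.
have := ccvgD d0 c; rewrite add0r; apply: (ccvg_ext (N := 0)) => N _.
by rewrite subrK.
Qed.

Lemma Delta_int z (n : int) : Delta (z + n%:~R) = Delta z.
Proof. by rewrite /Delta qexpD qexp_int mulr1. Qed.

Lemma Im_inv z : complex.Im (- z^-1) = complex.Im z / cabs z ^+ 2.
Proof. by rewrite cImN cImV mulNr opprK. Qed.

Lemma upper_neq0 z : 0 < complex.Im z -> z != 0.
Proof. by apply: contraTneq => ->; rewrite ltxx. Qed.

Lemma Im_inv_gt0 z : 0 < complex.Im z -> 0 < complex.Im (- z^-1).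
Proof. by move=> z0; rewrite Im_inv divr_gt0 // exprn_gt0 // cabs_gt0 upper_neq0. Qed.

Lemma Delta_inv z : 0 < complex.Im z -> Delta (- z^-1) = z ^+ 12 * Delta z.
Proof.
move=> z0; apply: delta_prod_inversion => //; apply: delta_prod_cvg => //.
exact: Im_inv_gt0.
Qed.

Lemma lin_form_neq0 z (c d : int) : 0 < complex.Im z -> (c != 0) || (d != 0) ->
  c%:~R * z + d%:~R != 0.
Proof.
move=> z0 cd; apply/eqP => h.
have : complex.Im (c%:~R * z + d%:~R) = 0 by rewrite h.
rewrite cImD cImM cRe_int cIm_int cIm_int mul0r !addr0 => /eqP.
rewrite mulf_eq0 (gt_eqF z0) orbF intr_eq0 => /eqP c0.
move: cd h; rewrite c0 eqxx /= mul0r add0r => /negP dn /eqP; rewrite intr_eq0; exact: dn.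
Qed.

Lemma Im_mobius z (a b c d : int) : 0 < complex.Im z -> a * d - b * c = 1 ->
  0 < complex.Im ((a%:~R * z + b%:~R) / (c%:~R * z + d%:~R)).
Proof.
move=> z0 det; have cd : (c != 0) || (d != 0).
  apply/negPn; rewrite negb_or !negbK; apply/negP => /andP[/eqP c0 /eqP d0].
  by move: det; rewrite c0 d0 !mulr0 subrr.
have n0 := lin_form_neq0 z0 cd.
have -> : complex.Im ((a%:~R * z + b%:~R) / (c%:~R * z + d%:~R)) =
   complex.Im z / cabs (c%:~R * z + d%:~R) ^+ 2.
  have detR : a%:~R * d%:~R - b%:~R * c%:~R = 1 :> R by rewrite -!intrM -intrB det.
  rewrite cImM cReV cImV !(cImD, cReD, cImM, cReM) !(cRe_int, cIm_int).
  rewrite !mul0r !addr0 !subr0 -[complex.Im z in RHS]mul1r -[X in _ = X * _ / _]detR; ring.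
by rewrite divr_gt0 // exprn_gt0 // cabs_gt0.
Qed.

(** Euclid's algorithm on the first column: with a = k c + a', the map is the one with rows (-c, -d)
    and (a', b'), followed by inversion and translation by k, and |a'| < |c|. For c = 0 only a
    translation is left, up to the sign of the matrix. *)
Lemma Delta_mobius z (a b c d : int) : 0 < complex.Im z -> a * d - b * c = 1 ->
  Delta ((a%:~R * z + b%:~R) / (c%:~R * z + d%:~R)) = (c%:~R * z + d%:~R) ^+ 12 * Delta z.
Proof.
move=> z0; have [n] := ubnP `|c|%N; elim: n a b c d => // n IH a b c d cn det.
have [c0|c0] := eqVneq c 0.
  move: det; rewrite c0 mulr0 subr0 => det.
  have := intUnitRing.unitzPl det; rewrite unfold_in => /orP[] /eqP d1; move: det.
    by rewrite d1 mulr1 => ->; rewrite mulr0z mul0r add0r mulr1z mul1r divr1 expr1n mul1r Delta_int.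
  rewrite d1 mulrN1 => /eqP; rewrite eqr_oppLR => /eqP ->.
  rewrite mulr0z mul0r add0r (mulrNz 1 1) mulr1z -[X in X ^+ 12]/(-1) -signr_odd mul1r.
  by rewrite mulN1r invrN1 mulrN1 opprD opprK -mulrNz Delta_int.
set k := (a %/ c)%Z; set a' := (a %% c)%Z; set b' := b - k * d.
have ak : a = k * c + a' := divz_eq a c.
have bk : b = b' + k * d by rewrite /b' subrK.
have det' : - c * b' - (- d) * a' = 1.
  by rewrite /b' -det [in RHS]ak; ring.
have a'0 : 0 <= a' by exact: modz_ge0.
have a'c : (`|a'| < n)%N.
  have : a' < `|c|%N := ltz_mod a c0.
  by move: cn a'0; clear -c0; lia.
clearbody a' b' k.
have ab : (a' != 0) || (b' != 0).
  apply/negPn; rewrite negb_or !negbK; apply/negP => /andP[/eqP h1 /eqP h2].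
  by move: det'; rewrite h1 h2 !mulr0 subrr.
have cd : (c != 0) || (d != 0) by rewrite c0.
have n1 := lin_form_neq0 z0 ab; have n2 := lin_form_neq0 z0 cd.
have det2 : (- c) * b' - (- d) * a' = 1 by [].
have u0 := Im_mobius z0 det2.
have := IH _ _ _ _ a'c det2.
set u := _ / _ in u0 * => hu.
have -> : (a%:~R * z + b%:~R) / (c%:~R * z + d%:~R) = - u^-1 + k%:~R.
  rewrite [in a%:~R]ak bk /u !intrD !intrM !intrN.
  have n3 : - c%:~R * z + - d%:~R != 0 by rewrite mulNr -opprD oppr_eq0.
  move: (a'%:~R : R[i]) (b'%:~R : R[i]) (c%:~R : R[i]) (d%:~R : R[i]) (k%:~R : R[i]) n1 n2 n3.
  by move=> xa xb xc xd xk n1 n2 n3; field; rewrite n1 n2 n3.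
rewrite Delta_int (Delta_inv u0) hu mulrA -exprMn.
have -> : u * (a'%:~R * z + b'%:~R) = - (c%:~R * z + d%:~R).
  by rewrite /u divfK // !intrN mulNr opprD.
by rewrite [(- _) ^+ 12]exprNn -signr_odd mul1r.
Qed.

End Delta.

(** * Reduction theory and the mean square of tau *)

Section Reduction.
Variable R : realType.
Implicit Types (z w : R[i]) (a : nat -> R).

(** The height 4/5 is below the optimal sqrt 3 / 2 in order to gain a fixed factor: if |Re z| <= 1/2
    and Im z < 4/5, then |z|^2 <= 1/4 + 16/25 = 89/100, so inversion multiplies the height by at
    least 100/89 and finitely many steps suffice. *)
Lemma fundamental_domain (W : R[i] -> R) :
  (forall z (n : int), 0 < complex.Im z -> W (z + n%:~R) = W z) ->
  (forall z, 0 < complex.Im z -> W (- z^-1) = W z) ->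
  forall z, 0 < complex.Im z -> exists2 w, 4 / 5 <= complex.Im w & W z = W w.
Proof.
move=> Wn Ws z z0; have x01 : 0 <= (89 / 100 : R) < 1 by apply/andP; split; lra.
have [k hk] := geom_small (4 / 5) x01 z0.
have := ltW (hk k (leqnn _)); elim: k z z0 {hk} => [|k IH] z z0 hz.
  by exists z => //; move: hz; rewrite expr0 mulr1.
have [zb|zs] := leP (4 / 5) (complex.Im z); first by exists z.
pose n := Num.floor (complex.Re z + 2^-1); pose z1 := z + (- n)%:~R.
have z1i : complex.Im z1 = complex.Im z by rewrite /z1 cImD cIm_int addr0.
have z10 : 0 < complex.Im z1 by rewrite z1i.
have z1r : `|complex.Re z1| <= 2^-1.
  rewrite /z1 cReD cRe_int mulrNz ler_norml.
  have /andP[h1 h2] := floor_itv (complex.Re z + 2^-1).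
  move: h1 h2; rewrite -/n intrD mulr1z => h1 h2; apply/andP; split; lra.
have nz1 : cabs z1 ^+ 2 <= 89 / 100.
  rewrite cabs_sqr z1i -[complex.Re z1 ^+ 2]real_normK ?num_real //.
  have := normr_ge0 (complex.Re z1); nra.
have p1 : 0 < cabs z1 ^+ 2 by rewrite exprn_gt0 // cabs_gt0 upper_neq0.
have [||w w1 w2] := IH (- z1^-1); first exact: Im_inv_gt0.
  rewrite Im_inv z1i ler_pdivlMr // -(@ler_pM2r _ (89 / 100)) ?divr_gt0 //.
  have c0 : 0 <= 4 / 5 * (89 / 100) ^+ k :> R by rewrite mulr_ge0 ?exprn_ge0 ?divr_ge0.
  move: hz c0; rewrite exprSr mulrA; set C := 4 / 5 * _ => hz c0; nra.
by exists w => //; rewrite -w2 Ws // /z1 Wn.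
Qed.

Lemma qsum_decay a (k : nat) (y : R) : subexp a -> 0 < y ->
  (forall n, (n < k)%N -> a n = 0) -> exists2 C, 0 <= C &
  forall z, y <= complex.Im z -> cabs (qsum a (qexp z)) <= C * cabs (qexp z) ^+ k.
Proof.
move=> ha y0 ak; pose r : R := expR (- (2 * pi * y)).
have r0 : 0 < r by exact: expR_gt0.
have r01 : 0 <= r < 1 by rewrite expR_ge0 expR_lt1 oppr_lt0 !mulr_gt0 ?pi_gt0.
have [B [x [B0 x01 hB]]] := subexp_geom ha r01.
have [x0 x1] := andP x01; have s0 : 0 < 1 - x by rewrite subr_gt0.
exists (r ^- k * (B / (1 - x))).
  by rewrite mulr_ge0 ?invr_ge0 ?exprn_ge0 ?(ltW r0) // divr_ge0 // ltW.
move=> z zy; have q1 : cabs (qexp z) < 1 by apply: cabs_qexp_lt1; exact: lt_le_trans zy.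
have qr : cabs (qexp z) <= r by rewrite cabs_qexp ler_expR lerN2 ler_pM2l ?mulr_gt0 ?pi_gt0.
set rho := cabs (qexp z) in q1 qr *; have rho0 : 0 <= rho by exact: cabs_ge0.
apply: (ccvg_le (N := 0)) (qsum_cvg ha q1) _ => N _.
apply: le_trans (cabs_sum _ _ _) _.
apply: (@le_trans _ _ (\sum_(n < N) (r ^- k * B * rho ^+ k) * x ^+ n)).
  apply: ler_sum => n _; rewrite cabs_term -/rho.
  have [nk|kn] := ltnP n k.
    by rewrite ak // normr0 mul0r !mulr_ge0 ?invr_ge0 ?exprn_ge0 ?(ltW r0).
  have -> : r ^- k * B * rho ^+ k * x ^+ n = rho ^+ k * r ^- k * (B * x ^+ n) by ring.
  apply: le_trans (_ : rho ^+ k * r ^- k * (`|a n| * r ^+ n) <= _); last first.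
    by rewrite ler_wpM2l // mulr_ge0 ?invr_ge0 ?exprn_ge0 ?(ltW r0).
  have sp (u : R) : u ^+ n = u ^+ k * u ^+ (n - k) by rewrite -exprD subnKC.
  rewrite (sp rho) (sp r).
  have -> : rho ^+ k * r ^- k * (`|a n| * (r ^+ k * r ^+ (n - k))) = rho ^+ k * (`|a n| * r ^+ (n - k)).
    by field; rewrite gt_eqF // exprn_gt0.
  rewrite mulrCA ler_wpM2l ?exprn_ge0 // ler_wpM2l // lerXn2r ?nnegrE // ltW //.
rewrite -mulr_sumr -(big_mkord xpredT (fun n => x ^+ n)).
have -> : r ^- k * (B / (1 - x)) * rho ^+ k = r ^- k * B * rho ^+ k * (1 - x)^-1 by ring.
rewrite ler_wpM2l ?mulr_ge0 ?invr_ge0 ?exprn_ge0 ?(ltW r0) //.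
by have := sum_geom_le 0 N x01; rewrite expr0 mul1r.
Qed.

Lemma pow6_expR (y : R) : 0 <= y -> y ^+ 6 * expR (- (2 * pi * y)) <= 6 ^+ 6.
Proof.
move=> y0; have h : y / 6 <= expR (y / 6) by have := expR_ge1Dx (y / 6); lra.
have e : expR y = expR (y / 6) ^+ 6 by rewrite -expRM_natl; congr expR; field.
rewrite expRN ler_pdivrMr ?expR_gt0 //.
apply: (@le_trans _ _ (6 ^+ 6 * expR y)); last first.
  rewrite ler_pM2l ?exprn_gt0 // ler_expR ler_peMl //; have := pi_ge2 R; lra.
have -> : y ^+ 6 = 6 ^+ 6 * (y / 6) ^+ 6 by field.
by rewrite ler_pM2l ?exprn_gt0 // e lerXn2r ?nnegrE ?expR_ge0 ?divr_ge0.
Qed.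

(** Weight 12 modularity under the inversion alone; invariance under translation is built into the
    expansion in q. *)
Definition cusp_inv a := forall z, 0 < complex.Im z ->
  qsum a (qexp (- z^-1)) = z ^+ 12 * qsum a (qexp z).

(** The exponent 6 is half the weight, which makes this size invariant under the modular group. *)
Let weight a z := cabs (qsum a (qexp z)) * complex.Im z ^+ 6.

Let weight_domain a : cusp_inv a -> forall z, 0 < complex.Im z ->
  exists2 w, 4 / 5 <= complex.Im w & weight a z = weight a w.
Proof.
move=> ha; apply: fundamental_domain => z; rewrite /weight.
  by move=> n _; rewrite qexpD qexp_int mulr1 cImD cIm_int addr0.
move=> z0; have zp : 0 < cabs z by rewrite cabs_gt0 upper_neq0.
rewrite ha // cabsM cabsX Im_inv; move: (cabs z) (complex.Im z) zp => k y k0.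
by field; rewrite gt_eqF.
Qed.

Lemma cusp_bound a : subexp a -> cusp_inv a -> a 0%N = 0 -> exists2 C, 0 <= C &
  forall z, 0 < complex.Im z -> weight a z <= C.
Proof.
move=> ha hi a0; have y0 : 0 < 4 / 5 :> R by lra.
have [|C C0 hC] := @qsum_decay a 1 _ ha y0; first by case.
exists (C * 6 ^+ 6); first by rewrite mulr_ge0.
move=> z z0; have [w w1 ->] := weight_domain hi z0.
have w0 : 0 <= complex.Im w by apply: le_trans w1; exact: ltW.
apply: (@le_trans _ _ (C * cabs (qexp w) * complex.Im w ^+ 6)).
  by rewrite ler_wpM2r ?exprn_ge0 // -[cabs (qexp w)]expr1 hC.
by rewrite -mulrA ler_wpM2l // mulrC cabs_qexp pow6_expR.
Qed.

Lemma expR_65 : 3 <= expR (6 / 5) :> R.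
Proof.
have -> : 6 / 5 = 8%:R * (3 / 20) :> R by field.
rewrite expRM_natl; have h := expR_ge1Dx (3 / 20 : R).
apply: (@le_trans _ _ ((23 / 20) ^+ 8)); first by lra.
rewrite lerXn2r ?nnegrE ?expR_ge0 //; lra.
Qed.

(* A form vanishing to order two contracts the bound on its own weight: the
   Cauchy estimate at height [3y/4] is worse than the decay of [q ^+ 2] is good. *)
Let weight_contract a (M : R) : subexp a -> cusp_inv a -> (forall n, (n < 2)%N -> a n = 0) ->
  (forall z, 0 < complex.Im z -> weight a z <= M) ->
  forall z, 0 < complex.Im z -> weight a z <= 19 / 20 * M.
Proof.
move=> ha hi a2 hM z z0; have [w w1 ->] := weight_domain hi z0.
set y := complex.Im w in w1; have y0 : 0 < y by lra.
have y34 : 0 < 3 / 4 * y by lra.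
have M0 : 0 <= M by apply: le_trans (hM z z0); rewrite mulr_ge0 ?cabs_ge0 ?exprn_ge0 // ltW.
have hS (v : R[i]) : complex.Im v = 3 / 4 * y -> cabs (qsum a (qexp v)) <= M / (3 / 4 * y) ^+ 6.
  move=> vy; rewrite ler_pdivlMr ?exprn_gt0 // -vy; apply: hM; by rewrite vy.
have cb n := qsum_coef_bound n ha y34 hS.
set S := M / _ in cb; have S0 : 0 <= S by rewrite divr_ge0 // exprn_ge0 // ltW.
(* The ratio of |q| at height y to |q| at height 3y/4. Since y >= 4/5 and pi >= 3, the exponent is
   at least 6/5 in absolute value, whence x <= 1/3. *)
pose x : R := expR (- (2 * pi * (y / 4))).
have x0 : 0 < x by exact: expR_gt0.
have x13 : x <= 3^-1.
  rewrite /x expRN lef_pV2 ?posrE ?expR_gt0 //; apply: le_trans expR_65 _.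
  rewrite ler_expR; have := pi_ge3 R; nra.
have q1 : cabs (qexp w) < 1 by apply: cabs_qexp_lt1.
(* The series starts at n = 2, and x^2/(1 - x) <= (1/9)/(2/3) = 1/6. *)
have key : cabs (qsum a (qexp w)) <= S * (1 / 6).
  apply: (ccvg_le (N := 2)) (qsum_cvg ha q1) _ => N N2.
  apply: le_trans (cabs_sum _ _ _) _.
  rewrite -(big_mkord xpredT (fun n => cabs ((a n)%:C%C * qexp w ^+ n))).
  rewrite (big_cat_nat (n := 2)) //= big_nat big1 ?add0r => [|n /andP[_ n2]]; last first.
    by rewrite cabs_term a2 // normr0 mul0r.
  apply: (@le_trans _ _ (\sum_(2 <= n < N) S * x ^+ n)).
    apply: ler_sum => n _; rewrite cabs_term.
    have -> : cabs (qexp w) = expR (- (2 * pi * (3 / 4 * y))) * x.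
      by rewrite cabs_qexp -/y /x -expRD; congr expR; field.
    by rewrite exprMn mulrA ler_wpM2r ?exprn_ge0 ?(ltW x0).
  rewrite -mulr_sumr ler_wpM2l //.
  apply: le_trans (sum_geom_le 2 N _) _; first by rewrite (ltW x0) /=; lra.
  rewrite ler_pdivrMr; nra.
apply: (@le_trans _ _ (S * (1 / 6) * y ^+ 6)).
  by rewrite /weight -/y ler_wpM2r // exprn_ge0 // ltW.
(* The loss (4/3)^6 from the lower height times the gain 1/6; the product is just below 19/20. *)
have -> : S * (1 / 6) * y ^+ 6 = (4096 / 4374) * M.
  by rewrite /S; move: (y) y0 => u u0; field; rewrite gt_eqF.
by rewrite ler_wpM2r //; lra.
Qed.

(** Iterating the contraction from the finite bound of [cusp_bound] forces the weight to vanish, and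
    the coefficient estimate transfers this to [a]. *)
Lemma cusp_order2_eq0 a : subexp a -> cusp_inv a -> (forall n, (n < 2)%N -> a n = 0) ->
  forall n, a n = 0.
Proof.
move=> ha hi a2; have [C C0 hC] := cusp_bound ha hi (a2 0%N isT).
have it k : forall z, 0 < complex.Im z -> weight a z <= C * (19 / 20) ^+ k.
  elim: k => [|k IH] z z0; first by rewrite expr0 mulr1 hC.
  by rewrite exprS mulrCA; exact: weight_contract IH z z0.
have w0 z : 0 < complex.Im z -> cabs (qsum a (qexp z)) <= 0.
  move=> z0; suff : weight a z <= 0.
    by rewrite /weight -[X in _ <= X](mul0r (complex.Im z ^+ 6)) ler_pM2r // exprn_gt0.
  rewrite leNgt; apply/negP => wp.
  have x01 : 0 <= (19 / 20 : R) < 1 by apply/andP; split; lra.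
  have [N hN] := geom_small C x01 wp.
  by have := hN N (leqnn _); rewrite ltNge it.
move=> n; have := @qsum_coef_bound R a 1 0 n ha ltr01.
move=> h; have {h} : `|a n| * expR (- (2 * pi * 1)) ^+ n <= 0.
  by apply: h => z z1; apply: w0; rewrite z1.
rewrite pmulr_lle0 ?exprn_gt0 ?expR_gt0 // => h; apply/eqP.
by rewrite -normr_eq0 eq_le h normr_ge0.
Qed.

Lemma tauR_cusp : cusp_inv (@tauR R).
Proof. by move=> z z0; exact: Delta_inv. Qed.

(** Parseval at height y = 1/(N+1), where |Delta| <= C y^(-6): for n <= N the weights exp(-4 pi n y)
    are at least exp(-4 pi). *)
Lemma tau_mean_square : exists2 C : R, 0 < C &
  forall N, \sum_(n < N.+1) tauR R n ^+ 2 <= C * N.+1%:R ^+ 12.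
Proof.
have t0 : tauR R 0 = 0 by rewrite /tauR tau0.
have [C C0 hC] := cusp_bound (@tauR_subexp R) tauR_cusp t0.
exists ((C + 1) ^+ 2 * expR (4 * pi)).
  by rewrite mulr_gt0 ?expR_gt0 // exprn_gt0 //; lra.
move=> N; pose y : R := N.+1%:R^-1; have y0 : 0 < y by rewrite invr_gt0.
have hS (v : R[i]) : complex.Im v = y -> cabs (qsum (@tauR R) (qexp v)) <= C / y ^+ 6.
  move=> vy; rewrite ler_pdivlMr ?exprn_gt0 // -vy; apply: hC; by rewrite vy.
have := qsum_l2_bound (@tauR_subexp R) y0 hS N.+1 => h.
have e4 : 0 < expR (- (4 * pi)) :> R by exact: expR_gt0.
rewrite -(ler_pM2r e4); apply: (@le_trans _ _ (\sum_(n < N.+1)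
     tauR R n ^+ 2 * expR (- (2 * pi * y)) ^+ n ^+ 2)).
  rewrite mulr_suml; apply: ler_sum => n _; rewrite ler_wpM2l ?sqr_ge0 //.
  rewrite -exprM -expRM_natl ler_expR natrM.
  have : n%:R * y <= 1 by rewrite /y ler_pdivrMr // mul1r ler_nat ltnW.
  have : 0 <= n%:R * y by rewrite mulr_ge0 // ltW.
  have := pi_gt0 R; nra.
apply: le_trans h _; rewrite expRN mulrAC mulfK ?gt_eqF ?expR_gt0 //.
rewrite expr_div_n -exprM /y exprVn invrK ler_wpM2r ?exprn_ge0 //.
by rewrite lerXn2r ?nnegrE //; lra.
Qed.

End Reduction.

(** * The Hecke relation *)

Lemma sum_multiples (V : nmodType) (F : nat -> V) p N : (0 < p)%N ->
  \sum_(n < p * N) (if (p %| n)%N then F n else 0) = \sum_(m < N) F (p * m)%N.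
Proof.
move=> p0; elim: N => [|N IH]; first by rewrite muln0 !big_ord0.
rewrite big_ord_recr /= -IH mulnS addnC.
rewrite -!(big_mkord xpredT (fun n => if (p %| n)%N then F n else 0)).
rewrite (big_cat_nat (n := (p * N)%N)) //= ?leq_addr //; congr (_ + _).
rewrite big_ltn; last by rewrite -[X in (X < _)%N]addn0 ltn_add2l.
rewrite dvdn_mulr // big_nat big1 ?addr0 // => n /andP[n1 n2].
rewrite ifN //; apply/negP => /dvdnP[k nk].
have h1 : (N < k)%N by rewrite -(ltn_pmul2r p0) -nk mulnC.
have h2 : (k < N.+1)%N by rewrite -(ltn_pmul2r p0) -nk mulSn addnC mulnC.
lia.
Qed.

Section Hecke.
Variables (R : realType) (p : nat).
Hypothesis pp : prime p.
Implicit Types (z w : R[i]).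

Let p0 : (0 < p)%N := prime_gt0 pp.

Let pC : p%:R != 0 :> R[i]. Proof. by rewrite pnatr_eq0 -lt0n. Qed.

(** The n-th coefficient of T_p Delta - tau(p) Delta. *)
Definition hecke_coef n : R :=
  tauR R (p * n) + (if (p %| n)%N then p%:R ^+ 11 * tauR R (n %/ p) else 0)
  - tauR R p * tauR R n.

Let hecke_coef_subexp : subexp hecke_coef.
Proof.
move=> r r01; have [r0 r1] := andP r01.
(* The p-th root of [r]: the growth of tau(p n) at radius r is that of tau at radius s. *)
pose s : R := expR (ln r / p%:R); have pR : 0 < p%:R :> R by rewrite ltr0n.
have sp : s ^+ p = r.
  by rewrite /s -expRM_natl mulrC divfK ?gt_eqF // lnK // posrE.
have s01 : 0 < s < 1.
  by rewrite expR_gt0 expR_lt1 pmulr_llt0 ?invr_gt0 // ln_lt0.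
have [B1 hB1] := @tauR_subexp R s s01; have [B2 hB2] := @tauR_subexp R r r01.
have B20 : 0 <= B2 by apply: le_trans (hB2 0%N); rewrite mulr_ge0.
exists (B1 + p%:R ^+ 11 * B2 + `|tauR R p| * B2) => n.
have rn0 : 0 <= r ^+ n by rewrite exprn_ge0 // ltW.
apply: le_trans (ler_wpM2r rn0 (ler_normB _ _)) _; rewrite mulrDl; apply: lerD.
  apply: le_trans (ler_wpM2r rn0 (ler_normD _ _)) _; rewrite mulrDl; apply: lerD.
    by apply: le_trans (hB1 (p * n)%N); rewrite exprM sp.
  case: ifPn => [/dvdnP[m ->]|_]; last by rewrite normr0 mul0r mulr_ge0 ?exprn_ge0.
  rewrite mulnK // normrM (ger0_norm (exprn_ge0 _ (ltW pR))) -mulrA ler_wpM2l ?exprn_ge0 //.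
  apply: le_trans (hB2 m); rewrite ler_wpM2l //.
  by rewrite ler_wiXn2l ?(ltW r0) ?(ltW r1) // leq_pmulr.
by rewrite normrM -mulrA ler_wpM2l.
Qed.

(** The matrices (p, 0; 0, 1) and (1, j; 0, p) with j < p represent the integral matrices of
    determinant p modulo SL(2, Z). *)
Definition hecke z : R[i] := p%:R ^+ 11 * Delta (p%:R * z)
  + p%:R^-1 * \sum_(j < p) Delta ((z + j%:R) / p%:R) - (tauR R p)%:C%C * Delta z.

Let Im_scale (t : R) z (x : R) : complex.Im ((z + x%:C%C) * t%:C%C) = complex.Im z * t.
Proof. by rewrite cImM cImD /= mulr0 add0r addr0. Qed.

Let Im_scaled_gt0 z (j : nat) : 0 < complex.Im z -> 0 < complex.Im ((z + j%:R) / p%:R).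
Proof.
move=> z0; have -> : p%:R^-1 = (p%:R^-1)%:C%C :> R[i] by rewrite fmorphV rmorph_nat.
by rewrite (complex_natE R j) Im_scale mulr_gt0 // invr_gt0 ltr0n.
Qed.

Let Im_mul_gt0 z : 0 < complex.Im z -> 0 < complex.Im (p%:R * z).
Proof. by move=> z0; rewrite cImM cRe_nat cIm_nat mul0r addr0 mulr_gt0 // ltr0n. Qed.

Let qsum_hecke z : 0 < complex.Im z -> qsum hecke_coef (qexp z) = hecke z.
Proof.
move=> z0; have q1 := cabs_qexp_lt1 z0.
have cvD w : 0 < complex.Im w -> ccvg (qpsum (@tauR R) (qexp w)) (Delta w).
  by move=> /cabs_qexp_lt1; exact: qsum_cvg (@tauR_subexp R).
have le1 n : (n <= p * n)%N by rewrite leq_pmull.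
have le2 n : (n <= p * (p * n))%N by apply: leq_trans (le1 n) (le1 _).
have c0 := ccvg_comp (f := fun N => (p * N)%N) le1 (qsum_cvg hecke_coef_subexp q1).
have c1 := ccvg_comp (f := fun N => (p * N)%N) le1 (cvD _ z0).
have c2 := cvD _ (Im_mul_gt0 z0).
have c3 : ccvg (fun N => \sum_(j < p) qpsum (@tauR R) (qexp ((z + j%:R) / p%:R)) (p * (p * N)))
   (\sum_(j < p) Delta ((z + j%:R) / p%:R)).
  apply: ccvg_sum => j; apply: (ccvg_comp (f := fun N => (p * (p * N))%N) le2).
  exact/cvD/Im_scaled_gt0.
apply: ccvg_uniq c0 _.
have := ccvgB (ccvgD (ccvgZ (p%:R ^+ 11) c2) (ccvgZ p%:R^-1 c3)) (ccvgZ (tauR R p)%:C%C c1).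
apply: (ccvg_ext (N := 0)) => N _.
have E1 : \sum_(j < p) qpsum (@tauR R) (qexp ((z + j%:R) / p%:R)) (p * (p * N))
   = p%:R * \sum_(n < p * N) (tauR R (p * n))%:C%C * qexp z ^+ n.
  rewrite /qpsum exchange_big /=.
  transitivity (\sum_(k < p * (p * N)) (if (p %| k)%N then
      (tauR R k)%:C%C * qexp (z / p%:R) ^+ k * p%:R else 0)).
    apply: eq_bigr => k _; rewrite -mulr_sumr.
    have E (j : 'I_p) : qexp ((z + j%:R) / p%:R) ^+ k = qexp (z / p%:R) ^+ k * qexp (k%:R / p%:R) ^+ j.
      by rewrite -!qexpMn -qexpD; congr qexp; field.
    under eq_bigr do rewrite E.
    rewrite -mulr_sumr sum_roots_unity //; case: ifP => _; last by rewrite !mulr0.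
    by rewrite mulrA.
  rewrite (sum_multiples (fun k => (tauR R k)%:C%C * qexp (z / p%:R) ^+ k * p%:R) _ p0) mulr_sumr.
  apply: eq_bigr => n _; rewrite exprM -qexpMn [p%:R * (z / _)]mulrC divfK //; ring.
have E2 : qpsum (@tauR R) (qexp (p%:R * z)) N =
   \sum_(n < p * N) (if (p %| n)%N then (tauR R (n %/ p))%:C%C * qexp z ^+ n else 0).
  rewrite (sum_multiples (fun n => (tauR R (n %/ p))%:C%C * qexp z ^+ n) _ p0).
  by apply: eq_bigr => m _; rewrite mulKn // exprM qexpMn.
rewrite E1 mulKf // E2 /qpsum !mulr_sumr -big_split /= -sumrB.
apply: eq_bigr => n _; rewrite /hecke_coef.
have h11 : (p%:R ^+ 11)%:C%C = p%:R ^+ 11 :> R[i] by rewrite rmorphXn rmorph_nat.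
have cM (u v : R) : (u * v)%:C%C = u%:C%C * v%:C%C by rewrite rmorphM.
have cD (u v : R) : (u + v)%:C%C = u%:C%C + v%:C%C by rewrite rmorphD.
case: ifP => _; rewrite !(real_complexB, cD, cM) ?h11 ?rmorph0; ring.
Qed.

(** The map j -> -1/j modulo p, by which inversion permutes the points (z + j)/p with j nonzero. The
    factor p - 1 stands for -1 among the naturals, and 0 is fixed so that all of ['I_p] is
    permuted. *)
Let ninv (j : 'I_p) : 'I_p :=
  if val j == 0%N then j else Ordinal (ltn_pmod (p.-1 * (egcdn j p).1) p0).

Let ninvP (j : 'I_p) : val j != 0%N -> (p %| j * ninv j + 1)%N.
Proof.
move=> j0; rewrite /ninv (negbTE j0) /=.
have j0' : (0 < j)%N by rewrite lt0n.
have cop : coprime j p.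
  rewrite coprime_sym prime_coprime //; apply/negP => /(dvdn_leq j0').
  by rewrite leqNgt ltn_ord.
case: egcdnP => // u v; rewrite (eqP cop) => uv _ /=.
rewrite /dvdn -modnDml modnMmr modnDml mulnCA -[(j * u)%N]mulnC uv mulnDr muln1 -addnA addn1 prednK //.
by rewrite mulnA modnMDl modnn.
Qed.

Let ninv_inj : injective ninv.
Proof.
move=> j k; have [j0|j0] := eqVneq (val j) 0%N; have [k0|k0] := eqVneq (val k) 0%N.
- by move=> _; apply: val_inj; rewrite j0 k0.
- move=> e; have := ninvP k0; rewrite -e {1}/ninv j0 eqxx j0 muln0 add0n dvdn1.
  by move=> /eqP p1; exfalso; have := prime_gt1 pp; rewrite p1.
- move=> e; have := ninvP j0; rewrite e {1}/ninv k0 eqxx k0 muln0 add0n dvdn1.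
  by move=> /eqP p1; exfalso; have := prime_gt1 pp; rewrite p1.
move=> e; have /dvdnP[A hA] := ninvP j0; have /dvdnP[B hB] := ninvP k0.
rewrite e in hA; apply: val_inj; set s : nat := ninv k in hA hB.
have : (k * A * p + j = j * B * p + k)%N by rewrite -!mulnA -hA -hB; ring.
move=> /(congr1 (modn^~ p)); rewrite !modnMDl !modn_small //.
Qed.

(** The matrix (j, -k; p, -s), of determinant k p - j s = 1, sends (z + s)/p to (-1/z + j)/p, with
    automorphy factor p (z + s)/p - s = z. *)
Let hecke_term z (j : 'I_p) : 0 < complex.Im z -> val j != 0%N ->
  Delta ((- z^-1 + j%:R) / p%:R) = z ^+ 12 * Delta ((z + (ninv j)%:R) / p%:R).
Proof.
move=> z0 j0; have zn := upper_neq0 z0.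
have /dvdnP[k hk] := ninvP j0; set s : nat := ninv j in hk *.
have det : j%:Z * (- s%:Z) - (- k%:Z) * p%:Z = 1.
  have hk2 : k%:Z * p%:Z = j%:Z * s%:Z + 1 by rewrite -!PoszM -hk PoszD.
  by rewrite mulrN mulNr opprK hk2; ring.
have := Delta_mobius (Im_scaled_gt0 s z0) det.
have ec : p%:Z%:~R * ((z + s%:R) / p%:R) + (- s%:Z)%:~R = z.
  by rewrite mulrNz -!pmulrn; field.
rewrite ec => <-; congr Delta.
have hk' : k%:R * p%:R = j%:R * s%:R + 1 :> R[i] by rewrite -!natrM -hk natrD.
rewrite mulrNz -!pmulrn.
have -> : k%:R = (j%:R * s%:R + 1) / p%:R :> R[i] by rewrite -hk' mulfK.
by field; rewrite zn pC.
Qed.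

Let hecke_split w : hecke w = p%:R ^+ 11 * Delta (p%:R * w) + p%:R^-1 *
  (Delta (w / p%:R) + \sum_(j < p | j != Ordinal p0) Delta ((w + j%:R) / p%:R))
  - (tauR R p)%:C%C * Delta w.
Proof.
have e0 : w + (Ordinal p0)%:R = w by exact: addr0.
by rewrite /hecke (bigD1 (Ordinal p0) isT) e0.
Qed.

Let sum_ninv (G : 'I_p -> R[i]) :
  \sum_(j < p | j != Ordinal p0) G (ninv j) = \sum_(j < p | j != Ordinal p0) G j.
Proof.
have n0 : ninv (Ordinal p0) = Ordinal p0 by rewrite /ninv eqxx.
rewrite [RHS](reindex_inj ninv_inj); apply: eq_bigl => j.
by rewrite -[in RHS]n0 (inj_eq ninv_inj).
Qed.

Let hecke_inv z : 0 < complex.Im z -> hecke (- z^-1) = z ^+ 12 * hecke z.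
Proof.
move=> z0; have zn := upper_neq0 z0; have pz0 := Im_mul_gt0 z0.
have zp0 := Im_scaled_gt0 0 z0; rewrite addr0 in zp0.
(* Inversion exchanges the two remaining terms, those at p z and z/p; the powers of p account for
   the coefficients p^11 and 1/p. *)
have f1 : Delta (p%:R * (- z^-1)) = (z / p%:R) ^+ 12 * Delta (z / p%:R).
  by rewrite -(Delta_inv zp0); congr Delta; field; rewrite zn pC.
have f2 : Delta (- z^-1 / p%:R) = (p%:R * z) ^+ 12 * Delta (p%:R * z).
  by rewrite -(Delta_inv pz0); congr Delta; field; rewrite zn pC.
have f3 : \sum_(j < p | j != Ordinal p0) Delta ((- z^-1 + j%:R) / p%:R) =
   z ^+ 12 * \sum_(j < p | j != Ordinal p0) Delta ((z + j%:R) / p%:R).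
  rewrite mulr_sumr -(sum_ninv (fun j : 'I_p => z ^+ 12 * Delta ((z + j%:R) / p%:R))).
  by apply: eq_bigr => j j0; apply: hecke_term.
have f4 := Delta_inv z0.
have alg (X Y F1 F2 F3 F4 A B D S t : R[i]) :
    X = p%:R ^+ 11 * F1 + p%:R^-1 * (F2 + F3) - t * F4 ->
    Y = p%:R ^+ 11 * B + p%:R^-1 * (A + S) - t * D ->
    F1 = (z / p%:R) ^+ 12 * A -> F2 = (p%:R * z) ^+ 12 * B ->
    F3 = z ^+ 12 * S -> F4 = z ^+ 12 * D -> X = z ^+ 12 * Y.
  by move=> -> -> -> -> -> ->; field.
exact: alg (hecke_split (- z^-1)) (hecke_split z) f1 f2 f3 f4.
Qed.

Lemma hecke_relation n : hecke_coef n = 0.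
Proof.
apply: cusp_order2_eq0 => // [z z0|m m2].
  by rewrite !qsum_hecke ?Im_inv_gt0 // hecke_inv.
case: m m2 => [|[|//]] _; rewrite /hecke_coef.
  by rewrite muln0 dvdn0 div0n /tauR tau0 !mulr0 addr0 subr0.
by rewrite muln1 dvdn1 (gtn_eqF (prime_gt1 pp)) addr0 {3}/tauR tau1 mulr1 subrr.
Qed.

End Hecke.

Lemma tau_prime_sqr (R : realType) (p : nat) : prime p -> tau (p ^ 2) = tau p ^+ 2 - p%:Z ^+ 11.
Proof.
move=> pp; have := hecke_relation R pp p.
rewrite /hecke_coef dvdnn divnn prime_gt0 // /tauR tau1 mulr1 -mulnn => h.
have : (tau (p * p) + p%:Z ^+ 11 - tau p * tau p)%:~R = 0 :> R.
  by rewrite -h intrB intrD intrM rmorphXn.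
move/eqP; rewrite intr_eq0 expr2 => /eqP e.
by rewrite -[LHS]subr0 -e; ring.
Qed.

(** * Smooth numbers *)

Section Rankin.
Variable R : realType.
Implicit Types (s : R) (L : seq nat) (q m n X Y : nat).

Definition npow s m : R := m%:R `^ (- s).

Lemma npow_gt0 s m : (0 < m)%N -> 0 < npow s m.
Proof. by move=> m0; rewrite powR_gt0 // ltr0n. Qed.

Lemma npowM s m n : npow s (m * n) = npow s m * npow s n.
Proof. by rewrite /npow natrM powRM. Qed.

Lemma npow1 s : npow s 1 = 1.
Proof. by rewrite /npow powR1. Qed.

Lemma npow_anti s m n : 0 <= s -> (0 < m <= n)%N -> npow s n <= npow s m.
Proof.
move=> s0 /andP[m0 mn]; rewrite /npow !powRN lef_pV2 ?posrE ?powR_gt0 ?ltr0n //.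
  by rewrite ge0_ler_powR ?nnegrE // ler_nat.
exact: leq_trans m0 mn.
Qed.

(** Positivity is tested separately because [primes 0] is empty. *)
Definition smooth_sum s L X : R :=
  \sum_(m < X.+1) (if (0 < m)%N && all (mem L) (primes m) then npow s m else 0).

Lemma npow_lt1 s q : 0 < s -> (1 < q)%N -> npow s q < 1.
Proof.
move=> s0 q1; rewrite /npow powRN invf_lt1 ?powR_gt0 ?ltr0n ?(ltnW q1) //.
have p1 : 1 `^ s = 1 :> R by rewrite powR1.
by rewrite -[ltLHS]p1 gt0_ltr_powR ?nnegrE // ltr1n.
Qed.

(** The Euler product by induction on L. Integers divisible by q contribute at most q^(-s) times the
    whole sum S, the others at most the sum over the shorter list, so (1 - q^(-s)) S is bounded by
    the latter. *)
Lemma smooth_sum_le s L X : 0 < s -> all (leq 2) L ->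
  smooth_sum s L X <= \prod_(q <- L) (1 - npow s q)^-1.
Proof.
move=> s0; elim: L => [|q L IH] /=.
  move=> _; rewrite big_nil /smooth_sum.
  case: X => [|X]; first by rewrite big_ord_recr big_ord0 /= add0r ler01.
  rewrite 2!big_ord_recl /= add0r npow1 big1 ?addr0 // => i _.
  by rewrite /bump /= !add1n; have := primes_eq0 i.+2; case: (primes _).
move=> /andP[q2 L2]; have q0 : (0 < q)%N by apply: leq_trans q2.
have w1 := npow_lt1 s0 q2; have w0 := npow_gt0 s q0.
have s1 : 0 < 1 - npow s q by rewrite subr_gt0.
set S := smooth_sum s (q :: L) X.
suff h : S <= smooth_sum s L X + npow s q * S.
  rewrite big_cons mulrC ler_pdivlMr //; apply: le_trans (IH L2); lra.
pose F m := if (0 < m)%N && all (mem (q :: L)) (primes m) then npow s m else 0.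
have F0 m : 0 <= F m.
  by rewrite /F; case: ifP => // /andP[m0 _]; exact: ltW (npow_gt0 s m0).
apply: (@le_trans _ _ (smooth_sum s L X + \sum_(m < X.+1) (if (q %| m)%N then F m else 0))).
  rewrite /S /smooth_sum -big_split /=; apply: ler_sum => m _; rewrite -[leLHS]/(F m).
  case: (boolP (q %| m)%N) => [_|qm].
    by rewrite lerDr; case: ifP => // /andP[m0 _]; exact: ltW (npow_gt0 s m0).
  rewrite addr0 /F; case: ifP => [/andP[m0 /allP hm]|_]; last first.
    by case: ifP => // /andP[m0 _]; exact: ltW (npow_gt0 s m0).
  rewrite m0 /= (_ : all _ _) //; apply/allP => p pm; have := hm p pm; rewrite !inE.
  case/orP => // /eqP pq; by move: pm; rewrite mem_primes pq (negbTE qm) !andbF.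
rewrite lerD2l; apply: (@le_trans _ _ (\sum_(m < q * X.+1) (if (q %| m)%N then F m else 0))).
  rewrite -!(big_mkord xpredT (fun m => if (q %| m)%N then F m else 0)).
  rewrite [leRHS](big_cat_nat (n := X.+1)) //= ?leq_pmull // lerDl.
  by apply: sumr_ge0 => m _; case: ifP.
rewrite sum_multiples // /S /smooth_sum mulr_sumr; apply: ler_sum => m _ /=.
rewrite /F muln_gt0 q0 /=; case: ifP => [/andP[m0 /allP hm]|_].
  rewrite m0 /= npowM (_ : all _ _) //; apply/allP => p pm; apply: hm.
  by rewrite primesM // pm orbT.
by case: ifP => [/andP[m0 _]|_]; rewrite ?mulr0 // mulr_ge0 ?ltW ?npow_gt0.
Qed.

Lemma euler_factor_le s q : 0 < s -> (1 < q)%N ->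
  (1 - npow s q)^-1 <= expR ((1 - npow s 2)^-1 * npow s q).
Proof.
move=> s0 q1; have w1 := npow_lt1 s0 q1; have w2 := @npow_lt1 s 2 s0 isT.
have w0 := npow_gt0 s (ltnW q1); have wq : npow s q <= npow s 2 by rewrite npow_anti // ltW.
have s1 : 0 < 1 - npow s q by rewrite subr_gt0.
have s2 : 0 < 1 - npow s 2 by rewrite subr_gt0.
apply: le_trans (expR_ge1Dx _).
have -> : (1 - npow s q)^-1 = 1 + (1 - npow s q)^-1 * npow s q by field; rewrite gt_eqF.
by rewrite lerD2l ler_pM2r // lef_pV2 ?posrE // lerD2l lerN2.
Qed.

Lemma smooth_sum_expR s L X : 0 < s -> all (leq 2) L ->
  smooth_sum s L X <= expR ((1 - npow s 2)^-1 * \sum_(q <- L) npow s q).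
Proof.
move=> s0 L2; apply: le_trans (smooth_sum_le X s0 L2) _.
elim: L L2 => [|q L IH] /=; first by rewrite !big_nil mulr0 expR0.
move=> /andP[q2 L2]; rewrite !big_cons mulrDr expRD ler_pM ?IH ?euler_factor_le //.
  by rewrite invr_ge0 subr_ge0 ltW // npow_lt1.
elim: L L2 {IH} => [|p L IH] /=; first by rewrite big_nil.
move=> /andP[p2 L2]; rewrite big_cons mulr_ge0 ?IH // invr_ge0 subr_ge0.
by rewrite ltW // npow_lt1.
Qed.

Definition smooth_set L X : {set 'I_X.+1} :=
  [set m : 'I_X.+1 | (0 < m)%N && all (mem L) (primes m)].

(** Rankin's trick: every m counted satisfies 1 <= X^s m^(-s). *)
Lemma card_smooth_set s L X : 0 < s -> all (leq 2) L ->
  #|smooth_set L X|%:R <= X%:R `^ s * expR ((1 - npow s 2)^-1 * \sum_(q <- L) npow s q).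
Proof.
move=> s0 L2; apply: le_trans (ler_wpM2l (powR_ge0 _ _) (smooth_sum_expR X s0 L2)).
rewrite /smooth_sum -sum1_card natr_sum mulr_sumr big_mkcond /=.
apply: ler_sum => m _; rewrite inE; case: ifP => [/andP[m0 _]|]; last by rewrite mulr0.
rewrite /npow powRN ler_pdivlMr ?powR_gt0 ?ltr0n // mul1r.
by rewrite ge0_ler_powR ?nnegrE ?(ltW s0) // ler_nat -ltnS.
Qed.

(** Induction on Y: for t = 1 - s, (Y/(Y+1))^t <= exp(-t/(Y+1)) <= 1 - t/(2(Y+1)). The second
    inequality is the origin of the factor 2. *)
Lemma sum_npow_le s Y : 0 < s < 1 ->
  \sum_(q < Y) npow s q.+1 <= 2 / (1 - s) * Y%:R `^ (1 - s).
Proof.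
move=> /andP[s0 s1]; set t := 1 - s; have t0 : 0 < t by rewrite /t; lra.
have t1 : t < 1 by rewrite /t; lra.
elim: Y => [|Y IH]; first by rewrite big_ord0 mulr_ge0 ?powR_ge0 // divr_ge0 // ltW.
rewrite big_ord_recr /=; apply: le_trans (lerD IH (lexx _)) _.
have y0 : 0 < Y.+1%:R :> R by rewrite ltr0n.
have y1 : 1 <= Y.+1%:R :> R by rewrite ler1n.
have h1 : Y%:R <= Y.+1%:R * expR (- Y.+1%:R^-1) :> R.
  have := expR_ge1Dx (- Y.+1%:R^-1 : R); rewrite -(ler_pM2l y0) mulrDr mulr1 mulrN divff ?gt_eqF //.
  by rewrite -natr1 addrK.
have h2 : Y%:R `^ t <= Y.+1%:R `^ t * expR (- (t / Y.+1%:R)).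
  apply: (@le_trans _ _ ((Y.+1%:R * expR (- Y.+1%:R^-1)) `^ t)).
    by rewrite ge0_ler_powR ?nnegrE ?(ltW t0) // mulr_ge0 ?expR_ge0.
  rewrite powRM ?expR_ge0 // -expRM mulNr [_^-1 * t]mulrC //.
have u01 : 0 < t / Y.+1%:R <= 1.
  by rewrite divr_gt0 //= ler_pdivrMr // mul1r (le_trans (ltW t1)).
have h3 : expR (- (t / Y.+1%:R)) <= 1 - t / Y.+1%:R / 2.
  set u := t / _ in u01 *; have [u0 u1] := andP u01.
  rewrite expRN -[leRHS]invrK lef_pV2 ?posrE ?expR_gt0 ?invr_gt0 //; last by lra.
  apply: le_trans (expR_ge1Dx u); rewrite -[leLHS]mul1r ler_pdivrMr; nra.
have h4 : npow s Y.+1 = Y.+1%:R `^ t / Y.+1%:R.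
  rewrite /npow /t powRD ?powRr1 ?(ltW y0) //; last by rewrite gt_eqF // implybT.
  by rewrite mulrAC divff ?mul1r // gt_eqF.
have p0 : 0 < Y.+1%:R `^ t by rewrite powR_gt0.
have h5 : Y%:R `^ t <= Y.+1%:R `^ t * (1 - t / Y.+1%:R / 2).
  by apply: le_trans h2 _; rewrite ler_pM2l.
rewrite h4 -(@ler_pM2r _ (t / 2)) ?divr_gt0 // mulrDl.
have -> : 2 / t * Y%:R `^ t * (t / 2) = Y%:R `^ t by field; rewrite gt_eqF.
have -> : 2 / t * Y.+1%:R `^ t * (t / 2) = Y.+1%:R `^ t by field; rewrite gt_eqF.
apply: le_trans (lerD h5 (lexx _)) _; rewrite le_eqVlt; apply/orP; left; apply/eqP.
by field; rewrite gt_eqF.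
Qed.

(** Beyond the threshold U, where u^(1 - t) reaches c/e, the linear term dominates; below it c u^t
    is at most c U^t. *)
Lemma powR_sublinear (c e t : R) : 0 <= c -> 0 < e -> 0 < t < 1 ->
  exists2 K, 0 <= K & forall u, 0 <= u -> c * u `^ t <= e * u + K.
Proof.
move=> c0 e0 /andP[t0 t1]; pose U := (c / e) `^ (1 - t)^-1.
have t10 : 0 < 1 - t by rewrite subr_gt0.
exists (c * U `^ t); first by rewrite mulr_ge0 ?powR_ge0.
move=> u u0; have [uU|Uu] := leP u U.
  rewrite -[leLHS]add0r lerD ?mulr_ge0 ?(ltW e0) // ler_wpM2l //.
  by rewrite ge0_ler_powR ?nnegrE ?powR_ge0 ?(ltW t0).
have U0 : 0 <= U by exact: powR_ge0.
have up : 0 < u by exact: le_lt_trans Uu.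
rewrite -[leLHS]addr0 lerD ?mulr_ge0 ?powR_ge0 //.
have h : c / e <= u `^ (1 - t).
  have -> : c / e = U `^ (1 - t).
    by rewrite /U -powRrM mulVf ?gt_eqF // powRr1 // divr_ge0 // ltW.
  by rewrite ge0_ler_powR ?nnegrE ?(ltW t10) // ltW.
have -> : e * u = e * u `^ (1 - t) * u `^ t.
  rewrite -mulrA -powRD ?subrK ?powRr1 // gt_eqF // implybT //.
by rewrite ler_wpM2r ?powR_ge0 // mulrC -ler_pdivrMr.
Qed.

End Rankin.

(** * Counting primes *)

Section PrimeCount.
Variable R : realType.

Definition prime_set x : {set 'I_x.+1} := [set p : 'I_x.+1 | prime p].

Lemma powR2_le (s : R) : 0 <= s <= 1 -> 2 `^ s <= 2.
Proof. by move=> /andP[s0 s1]; apply: ler1_powR => //; rewrite ler1n. Qed.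

Lemma npowX (s : R) m J : npow s (m ^ J) = npow s m ^+ J.
Proof. by elim: J => [|J IH]; rewrite ?npow1 // expnS npowM IH exprS. Qed.

(** Such a bound would make the sum of p^(-s) over all primes finite, since dyadic blocks contribute
    O(rho^J). Every integer up to N = 2^J is a product of primes below 2^(J+1), so Rankin's bound
    would give N <= N^s exp(c B), false for large J. *)
Lemma prime_count_not_sparse (K d : R) : 0 < d < 1 ->
  ~ (forall x, (0 < x)%N -> #|prime_set x|%:R <= K * x%:R `^ (1 - d)).
Proof.
move=> /andP[d0 d1] hK.
have K0 : 0 <= K by have := hK 1%N isT; rewrite powR1 mulr1; exact: le_trans.
(* Midway between 1 - d, above which the prime sum converges, and 1, below which N^s saves a power
   of N. *)
pose s := 1 - d / 2; have s0 : 0 < s by rewrite /s; lra.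
have d20 : 0 < d / 2 by lra.
pose rho : R := npow (d / 2) 2.
have r0 : 0 < rho by exact: npow_gt0. have r1 : rho < 1 by exact: npow_lt1.
have s1 : 0 < 1 - rho by rewrite subr_gt0.
have d01 : 0 <= 1 - d <= 1 by apply/andP; split; lra.
have T J : \sum_(0 <= q < 2 ^ J | prime q) npow s q <= \sum_(j < J) 2 * K * rho ^+ j.
  elim: J => [|J IH].
    rewrite big_ord0 big_nat_cond big1 // => q /andP[/andP[_ q1] qp].
    by have := prime_gt1 qp; rewrite ltnNge -ltnS ltnW.
  have J2 : (2 ^ J <= 2 ^ J.+1)%N by rewrite leq_exp2l.
  have p2 : (0 < 2 ^ J)%N by rewrite expn_gt0.
  rewrite (big_cat_nat (n := (2 ^ J)%N)) //= big_ord_recr /= lerD //.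
  have c : \sum_(2 ^ J <= q < 2 ^ J.+1 | prime q) npow s q <= \sum_(q in prime_set (2 ^ J.+1)) npow s (2 ^ J).
    rewrite big_nat_cond [leRHS](_ : _ = \sum_(0 <= q < (2 ^ J.+1).+1 | prime q) npow s (2 ^ J)); last first.
      by rewrite big_mkord; apply: eq_bigl => q; rewrite inE.
    apply: (@le_trans _ _ (\sum_(2 ^ J <= q < 2 ^ J.+1 | prime q) npow s (2 ^ J))).
      rewrite [leRHS]big_nat_cond; apply: ler_sum => q /andP[/andP[q1 _] _].
      by apply: npow_anti; rewrite ?(ltW s0) // p2.
    rewrite [leRHS](big_cat_nat (n := (2 ^ J)%N)) //=; last by rewrite leqW.
    rewrite [X in _ <= _ + X](big_cat_nat (n := (2 ^ J.+1)%N)) //= addrCA lerDl addr_ge0 //.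
      by apply: sumr_ge0 => q _; exact: ltW (npow_gt0 s p2).
    by apply: sumr_ge0 => q _; exact: ltW (npow_gt0 s p2).
  apply: le_trans c _; rewrite sumr_const -[leLHS]mulr_natl.
  have n0 := ltW (npow_gt0 s p2).
  apply: le_trans (ler_wpM2r n0 (hK _ _)) _; first by rewrite expn_gt0.
  have e : (2 ^ J.+1)%:R `^ (1 - d) = 2 `^ (1 - d) * (2 ^ J)%:R `^ (1 - d) :> R.
    by rewrite expnS natrM powRM.
  have e2 : (2 ^ J)%:R `^ (1 - d) * npow s (2 ^ J) = rho ^+ J.
    rewrite -npowX /npow -powRD; last by rewrite pnatr_eq0 -lt0n p2 implybT.
    by congr (_ `^ _); rewrite /s; field.
  rewrite e -!mulrA e2 mulrCA ler_wpM2r ?mulr_ge0 ?exprn_ge0 ?(ltW r0) //.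
  exact: powR2_le.
pose B := 2 * K / (1 - rho); pose c : R := (1 - npow s 2)^-1.
have c0 : 0 < c by rewrite invr_gt0 subr_gt0 npow_lt1.
have TB J : \sum_(0 <= q < 2 ^ J | prime q) npow s q <= B.
  apply: le_trans (T J) _; rewrite -mulr_sumr /B ler_wpM2l ?mulr_ge0 //.
  have := @sum_geom_le R rho 0 J; rewrite big_mkord expr0 mul1r; apply.
  by rewrite (ltW r0).
have x01 : 0 <= rho < 1 by rewrite (ltW r0).
have [J hJ] := geom_small (expR (c * B)) x01 ltr01.
have := hJ J (leqnn _); rewrite ltNge => /negP; apply.
pose N := (2 ^ J)%N; have N0 : (0 < N)%N by rewrite expn_gt0.
pose L := [seq q <- iota 0 (2 ^ J.+1) | prime q].
have L2 : all (leq 2) L by apply/allP => q; rewrite mem_filter => /andP[/prime_gt1].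
have hL : \sum_(q <- L) npow s q <= B.
  by rewrite big_filter; have := TB J.+1; rewrite /index_iota subn0.
have card : (N <= #|smooth_set L N|)%N.
  pose Np : {set 'I_N.+1} := [set m : 'I_N.+1 | (0 < m)%N]%SET.
  have : Np \subset smooth_set L N.
    apply/fintype.subsetP => m; rewrite !inE => m0; rewrite m0 /=; apply/allP => q; rewrite mem_primes.
    move=> /and3P[qp _ qm]; rewrite /= mem_filter qp mem_iota add0n /=.
    apply: leq_ltn_trans (dvdn_leq m0 qm) _; apply: leq_ltn_trans (_ : m <= N)%N _; first by rewrite -ltnS.
    by rewrite ltn_exp2l.
  move/subset_leq_card; apply: leq_trans.
  have -> : Np = (~: [set ord0])%SET by apply/finset.setP => m; rewrite !inE -val_eqE /= lt0n.
  by rewrite cardsC1 card_ord.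
have := card_smooth_set N s0 L2; rewrite -/c.
have Nr : 0 < N%:R `^ s :> R by rewrite powR_gt0 // ltr0n.
move=> h; have h1 : N%:R <= N%:R `^ s * expR (c * B).
  apply: le_trans (le_trans _ h) _; first by rewrite ler_nat.
  by rewrite ler_pM2l // ler_expR ler_pM2l.
have e : rho ^+ J = N%:R^-1 * N%:R `^ s :> R.
  have -> : N%:R^-1 = N%:R `^ (-1) :> R by rewrite powR_inv1.
  rewrite -npowX -/N /npow -powRD; last by rewrite pnatr_eq0 -lt0n N0 implybT.
  by congr (_ `^ _); rewrite /s; field.
by rewrite e mulrCA [expR _ * _]mulrC -ler_pdivrMl ?invr_gt0 ?ltr0n // invrK mulr1.
Qed.

End PrimeCount.

(** * From smooth values of tau to a bound on the number of primes *)

Section Main.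
Variable R : realType.

(** Otherwise tau(p)^2 = p^11, and the p-adic valuation 11 would be even. *)
Lemma tau_prime_sqr_neq0 p : prime p -> tau (p ^ 2) != 0.
Proof.
move=> pp; rewrite (tau_prime_sqr R pp) subr_eq0; apply/eqP => h.
have : (2 * logn p `|tau p|%N)%N = 11%N.
  by rewrite -lognX -abszX h abszX /= lognX logn_prime // eqxx muln1.
lia.
Qed.

Lemma prime_le_max_pdiv q n : q \in primes n -> (q <= max_pdiv n)%N.
Proof. by move=> h; apply: max_pdiv_max. Qed.

(** With u = log n >= 108, (2 u)^2 <= (u/3)^3 <= exp u; 108 is where the first inequality starts. It
    serves to show that p itself exceeds the smoothness bound. *)
Lemma log_pow_le (A : R) : 1 <= A <= 2 -> exists n1, forall n, (n1 <= n)%N ->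
  (2 * ln n%:R) `^ A <= n%:R.
Proof.
move=> /andP[A1 A2]; exists (Num.truncn (expR 108 : R)).+1 => n hn.
have e0 : 0 < expR 108 :> R by exact: expR_gt0.
have nb : expR 108 <= n%:R :> R.
  by apply: le_trans (ltW (Num.Theory.truncnS_gt _)) _; rewrite ler_nat.
have n0 : 0 < n%:R :> R by exact: lt_le_trans nb.
have u108 : 108 <= ln n%:R :> R by rewrite -(expRK 108) ler_ln ?posrE.
set u := ln n%:R in u108 *; have -> : n%:R = expR u by rewrite lnK // posrE.
apply: (@le_trans _ _ ((2 * u) `^ 2)).
  by apply: ler_powR => //; lra.
rewrite powR_mulrn; last by lra.
have e : expR u = expR (u / 3) ^+ 3 by rewrite -expRM_natl; congr expR; field.
have h : u / 3 <= expR (u / 3) by have := expR_ge1Dx (u / 3); lra.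
apply: (@le_trans _ _ ((u / 3) ^+ 3)).
  have -> : (u / 3) ^+ 3 = u / 27 * u ^+ 2 by field.
  rewrite exprMn ler_wpM2r ?sqr_ge0 //; lra.
by rewrite e lerXn2r ?nnegrE ?expR_ge0 //; lra.
Qed.

Lemma tau_prime_smooth (A : R) n0 : 1 <= A <= 2 ->
  (forall n, (n0 <= n)%N -> tau n != 0 -> (max_pdiv `|tau n|%N)%:R < ln n%:R `^ A :> R) ->
  exists n2, forall p x, prime p -> (n2 <= p <= x)%N ->
    [/\ tau p != 0, (max_pdiv `|tau p|%N)%:R <= (2 * ln x%:R) `^ A &
      (max_pdiv `|tau (p ^ 2)|%N)%:R <= (2 * ln x%:R) `^ A].
Proof.
move=> A12 H; have [n1 hn1] := log_pow_le A12; have [A1 _] := andP A12.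
have A0 : 0 <= A by apply: le_trans A1.
exists (maxn n0 n1) => p x pp /andP[]; rewrite !geq_max => /andP[pn0 pn1] px.
have p0 : 0 < p%:R :> R by rewrite ltr0n prime_gt0.
have x0 : 0 < x%:R :> R by apply: lt_le_trans p0 _; rewrite ler_nat.
have lnp0 : 0 <= ln p%:R :> R by apply: ln_ge0; rewrite ler1n prime_gt0.
have lnpx : ln p%:R <= ln x%:R :> R by rewrite ler_ln ?posrE // ler_nat.
have lnx0 := le_trans lnp0 lnpx.
have e2 : ln (p ^ 2)%:R = 2 * ln p%:R :> R by rewrite natrX lnXn // mulr_natl.
have pp2 : (n0 <= p ^ 2)%N by apply: leq_trans pn0 _; rewrite -{1}[p]expn1 leq_exp2l // prime_gt1.
have h2 := H _ pp2 (tau_prime_sqr_neq0 pp); rewrite e2 in h2.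
have m2 : (2 * ln p%:R) `^ A <= (2 * ln x%:R) `^ A.
  by apply: ge0_ler_powR; rewrite ?nnegrE ?mulr_ge0 // ler_pM2l.
have tp : tau p != 0.
  (* If tau(p) = 0, then tau(p^2) = -p^11 has the prime factor p >= (2 log p)^A, against the
     hypothesis at n = p^2. *)
  apply/eqP => tp0; move: h2; rewrite (tau_prime_sqr R pp) tp0 expr0n add0r abszN abszX /=.
  rewrite ltNge => /negP; apply; apply: le_trans (hn1 _ pn1) _; rewrite ler_nat.
  by apply: prime_le_max_pdiv; rewrite primesX // primes_prime // inE.
split=> //; last by apply: le_trans m2; exact: ltW.
apply: le_trans (ltW (H _ pn0 tp)) _.
apply: ge0_ler_powR; rewrite ?nnegrE ?mulr_ge0 //; apply: le_trans lnpx _.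
by rewrite ler_peMl // ler1n.
Qed.

Lemma card_ord_lt x n : (#|[set p : 'I_x.+1 | (p < n)%N]%SET| <= n)%N.
Proof.
rewrite cardE -(size_map val) -[X in (_ <= X)%N](size_iota 0 n); apply: uniq_leq_size.
  by rewrite map_inj_uniq ?enum_uniq //; exact: val_inj.
by move=> q /mapP[p]; rewrite mem_enum inE => pn ->; rewrite mem_iota.
Qed.

(* The mean square bound makes up for Deligne's estimate, outside a sparse set. *)
Lemma card_tau_large : exists2 C : R, 0 < C & forall x (B : R), (0 < x)%N -> 0 <= B ->
  #|[set p : 'I_x.+1 | B < `|tau p|%:~R]%SET|%:R * B ^+ 2 <= C * x%:R ^+ 12.
Proof.
have [C C0 hC] := tau_mean_square R; exists (2 ^+ 12 * C); first by rewrite mulr_gt0 // exprn_gt0.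
move=> x B x0 B0; have x1 : 1 <= x%:R :> R by rewrite ler1n.
apply: (@le_trans _ _ (C * x.+1%:R ^+ 12)).
  apply: le_trans (hC x); rewrite -sum1_card natr_sum mulr_suml big_mkcond /=.
  apply: ler_sum => n _; rewrite inE; case: ifP => [b|_]; last exact: sqr_ge0.
  rewrite mul1r /tauR -[leRHS]real_normK ?num_real // -intr_norm.
  by rewrite lerXn2r ?nnegrE ?ler0z // ltW.
have -> : 2 ^+ 12 * C * x%:R ^+ 12 = C * (2 * x%:R) ^+ 12 by rewrite exprMn mulrAC mulrC.
rewrite ler_pM2l // lerXn2r ?nnegrE ?mulr_ge0 // -natr1; lra.
Qed.

Lemma sum_npow_filter (s : R) Y : 0 < s < 1 ->
  \sum_(q <- [seq q <- iota 0 Y.+1 | (1 < q)%N]) npow s q <= 2 / (1 - s) * Y%:R `^ (1 - s).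
Proof.
move=> s01; apply: le_trans (sum_npow_le Y s01).
rewrite big_filter -(big_mkord xpredT (fun q => npow s q.+1)) /=.
rewrite big_cons /= -(big_add1 _ _ 0 Y.+1 xpredT (npow s)) /index_iota subSS subn0.
by rewrite big_mkcond; apply: ler_sum => q _; case: ifP => // _; exact: powR_ge0.
Qed.

(* By Hecke's relation tau(p)^2 - tau(p^2) = p^11, so p is determined by |tau(p)|,
   |tau(p^2)| and the sign of tau(p^2). *)
Lemma card_good_primes x X1 X2 (L : seq nat) (G : {set 'I_x.+1}) :
  (forall p : 'I_x.+1, p \in G -> [/\ prime p, tau p != 0,
     (`|tau p| <= X1)%N && (`|tau (p ^ 2)| <= X2)%N &
     all (mem L) (primes `|tau p|%N) && all (mem L) (primes `|tau (p ^ 2)|%N)]) ->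
  (#|G| <= 2 * (#|smooth_set L X1| * #|smooth_set L X2|))%N.
Proof.
move=> hG.
pose f (p : 'I_x.+1) : bool * ('I_X1.+1 * 'I_X2.+1) :=
  (0 <= tau (p ^ 2), (inord `|tau p|%N, inord `|tau (p ^ 2)|%N)).
have finj : {in G &, injective f}.
  move=> p1 p2 /hG[q1 _ /andP[a1 b1] _] /hG[q2 _ /andP[a2 b2] _] [e0 /(congr1 val) + /(congr1 val)].
  rewrite /= !inordK // => e1 e2.
  have t1 : tau p1 ^+ 2 = tau p2 ^+ 2.
    rewrite -(real_normK (num_real (tau p1))) -(real_normK (num_real (tau p2))).
    by rewrite -!abszE e1.
  have t2 : tau (p1 ^ 2) = tau (p2 ^ 2).
    move: e0 e2; have [a0|a0] := leP 0 (tau (p1 ^ 2)) => /esym.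
      by move=> b0 e2; rewrite -(gez0_abs a0) -(gez0_abs b0) e2.
    move/negbT; rewrite -ltNge => b0 e2.
    by apply: oppr_inj; rewrite -(ltz0_abs a0) -(ltz0_abs b0) e2.
  have : p1%:Z ^+ 11 = p2%:Z ^+ 11.
    have h1 := tau_prime_sqr R q1; have h2 := tau_prime_sqr R q2.
    by apply: oppr_inj; apply: (@addrI _ (tau p1 ^+ 2)); rewrite -h1 t2 h2 t1.
  move=> /eqP; rewrite eqrXn2 // => /eqP [] h.
  exact: val_inj.
rewrite -(card_in_imset finj).
pose T := finset.setX [set: bool]%SET (finset.setX (smooth_set L X1) (smooth_set L X2)).
apply: (@leq_trans #|T|); last by rewrite !cardsX cardsT card_bool.
apply: subset_leq_card; apply/fintype.subsetP => y /imsetP[p /hG[pp tp /andP[a b] /andP[c d]] ->].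
rewrite !inE /= !inordK ?ltnS // c d !absz_gt0 tp.
by rewrite tau_prime_sqr_neq0.
Qed.

(** All integers from 2 to (2 log x)^A, not only primes: the sum of q^(-s) over them is already
    O((log x)^(A (1 - s))), which is small enough. *)
Definition log_pow_seq (A : R) x :=
  [seq q <- iota 0 (Num.truncn ((2 * ln (x%:R : R)) `^ A)).+1 | (1 < q)%N].

Lemma primes_log_pow_seq (A : R) x n : (max_pdiv n)%:R <= (2 * ln (x%:R : R)) `^ A ->
  all (mem (log_pow_seq A x)) (primes n).
Proof.
move=> h; apply/allP => q qn; rewrite /= mem_filter mem_iota add0n ltnS /=.
have qp : prime q by move: qn; rewrite mem_primes => /andP[].
rewrite prime_gt1 //= Num.Theory.truncn_ge_nat ?powR_ge0 //.
by apply: le_trans h; rewrite ler_nat prime_le_max_pdiv.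
Qed.

(** The condition A (1 - s) < 1 makes the exponent in Rankin's bound sublinear in log x, so the
    exponential factor is O(x^e). *)
Lemma card_log_smooth_le (A s e : R) : 1 <= A -> 0 < s < 1 -> A * (1 - s) < 1 -> 0 < e ->
  exists2 K : R, 0 < K & forall x X, (0 < x)%N ->
    #|smooth_set (log_pow_seq A x) X|%:R <= X%:R `^ s * (K * x%:R `^ e).
Proof.
move=> A1 s01 As e0; have [s0 s1] := andP s01.
have A0 : 0 < A by lra.
have d0 : 0 < (1 - npow s 2)^-1 :> R by rewrite invr_gt0 subr_gt0 npow_lt1.
have s10 : 0 < 1 - s by lra.
have c0 : 0 <= (1 - npow s 2)^-1 * (2 / (1 - s)) by rewrite mulr_ge0 ?(ltW d0) // divr_ge0 // ltW.
have e20 : 0 < e / 2 by lra.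
have t01 : 0 < A * (1 - s) < 1 by rewrite As andbT mulr_gt0.
have [K1 K10 hK1] := powR_sublinear c0 e20 t01.
exists (expR K1); first exact: expR_gt0.
move=> x X x0; have lx0 : 0 <= 2 * ln x%:R :> R by rewrite mulr_ge0 // ln_ge0 // ler1n.
have L2 : all (leq 2) (log_pow_seq A x) by apply/allP => q; rewrite mem_filter => /andP[].
apply: le_trans (card_smooth_set X s0 L2) _; rewrite ler_wpM2l ?powR_ge0 //.
have -> : expR K1 * x%:R `^ e = expR (e / 2 * (2 * ln x%:R) + K1).
  have -> : x%:R `^ e = expR (e * ln x%:R) by rewrite /powR pnatr_eq0 -[x == _]negbK -lt0n x0.
  have ee u : e * u = e / 2 * (2 * u) by field.
  by rewrite -expRD addrC ee.
rewrite ler_expR; apply: le_trans (hK1 _ lx0); rewrite -mulrA ler_pM2l //.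
apply: le_trans (sum_npow_filter _ s01) _; rewrite ler_wpM2l ?divr_ge0 ?(ltW s10) //.
rewrite powRrM; apply: ge0_ler_powR; rewrite ?nnegrE ?powR_ge0 ?(ltW s10) //.
by rewrite Num.Theory.truncn_le // powR_ge0.
Qed.

(** The exponent is 12 - 2 (11/2 + e). *)
Lemma card_tau_gt_powR : exists2 C : R, 0 < C & forall x e, (0 < x)%N ->
  #|[set p : 'I_x.+1 | x%:R `^ (11 / 2 + e) < `|tau p|%:~R]%SET|%:R <= C * x%:R `^ (1 - 2 * e).
Proof.
have [C C0 hC] := card_tau_large; exists C => // x e x0.
have X0 : 0 < x%:R :> R by rewrite ltr0n.
have b0 : 0 < x%:R `^ (11 / 2 + e) :> R by exact: powR_gt0.
have := hC x _ x0 (ltW b0); set B := x%:R `^ _ in b0 *.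
rewrite -ler_pdivlMr ?exprn_gt0 // => /le_trans; apply.
rewrite -mulrA ler_pM2l // ler_pdivrMr ?exprn_gt0 //.
rewrite -!powR_mulrn ?(ltW b0) ?(ltW X0) // /B -powRrM -powRD ?(gt_eqF X0) ?implybT //.
by rewrite le_eqVlt; apply/orP; left; apply/eqP; congr (_ `^ _); field.
Qed.

Lemma card_log_smooth_tau_le (A s e : R) :
    1 <= A -> 0 < s < 1 -> A * (1 - s) < 1 -> 0 < e ->
  exists2 K : R, 0 < K & forall x (G : {set 'I_x.+1}), (0 < x)%N ->
    (forall p : 'I_x.+1, p \in G -> [/\ prime p, tau p != 0,
       `|tau p|%:~R <= x%:R `^ (11 / 2 + e),
       (max_pdiv `|tau p|%N)%:R <= (2 * ln (x%:R : R)) `^ A &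
       (max_pdiv `|tau (p ^ 2)|%N)%:R <= (2 * ln (x%:R : R)) `^ A]) ->
    #|G|%:R <= K * x%:R `^ ((33 / 2 + 3 * e) * s + 2 * e).
Proof.
move=> A1 s01 As e0; have [K K0 hK] := card_log_smooth_le A1 s01 As e0.
exists (4 * K ^+ 2); first by rewrite mulr_gt0 // exprn_gt0.
move=> x G x0 hG; have X1 : 1 <= x%:R :> R by rewrite ler1n.
have X0 : 0 < x%:R :> R by rewrite ltr0n.
have s0 : 0 <= s by case/andP: s01 => /ltW.
(* [B2] bounds tau(p)^2 + p^11, hence |tau(p^2)|. *)
pose B1 : R := x%:R `^ (11 / 2 + e); pose B2 : R := 2 * x%:R `^ (11 + 2 * e).
have B10 : 0 <= B1 by exact: powR_ge0.
have B20 : 0 <= B2 by rewrite mulr_ge0 // powR_ge0.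
have c := @card_good_primes x (Num.truncn B1) (Num.truncn B2) (log_pow_seq A x) G.
have /c{c} : forall p : 'I_x.+1, p \in G -> [/\ prime p, tau p != 0,
     (`|tau p| <= Num.truncn B1)%N && (`|tau (p ^ 2)| <= Num.truncn B2)%N &
     all (mem (log_pow_seq A x)) (primes `|tau p|%N) &&
       all (mem (log_pow_seq A x)) (primes `|tau (p ^ 2)|%N)].
  move=> p /hG[pp tp b m1 m2]; split=> //; last by rewrite !primes_log_pow_seq.
  rewrite !Num.Theory.truncn_ge_nat // !natr_absz b /=.
  rewrite (tau_prime_sqr R pp) intr_norm rmorphB !rmorphXn /=.
  have -> : B2 = B1 ^+ 2 + x%:R `^ (11 + 2 * e).
    rewrite /B1 -powR_mulrn // -powRrM /B2 mulr2n mulrDl mul1r; congr (_ `^ _ + _); by field.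
  apply: le_trans (ler_normB _ _) _; apply: lerD.
    by rewrite normrX lerXn2r ?nnegrE // -intr_norm.
  rewrite ger0_norm ?exprn_ge0 //; apply: (@le_trans _ _ (x%:R ^+ 11)).
    by rewrite lerXn2r ?nnegrE ?ler_nat // -ltnS.
  by rewrite -powR_mulrn ?(ltW X0) // ler_powR //; lra.
rewrite -(ler_nat R) => /le_trans; apply; rewrite !natrM.
have h1 : (Num.truncn B1)%:R `^ s <= x%:R `^ ((11 / 2 + e) * s) :> R.
  by rewrite powRrM; apply: ge0_ler_powR; rewrite ?nnegrE // Num.Theory.truncn_le.
have h2 : (Num.truncn B2)%:R `^ s <= 2 * x%:R `^ ((11 + 2 * e) * s) :> R.
  apply: (@le_trans _ _ (B2 `^ s)).
    by apply: ge0_ler_powR; rewrite ?nnegrE // Num.Theory.truncn_le.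
  rewrite powRM ?powR_ge0 // -powRrM ler_wpM2r ?powR_ge0 //; apply: powR2_le.
  by rewrite s0 /= ltW //; case/andP: s01.
have k0 : 0 <= K * x%:R `^ e by rewrite mulr_ge0 ?(ltW K0) // powR_ge0.
have g1 := le_trans (hK x (Num.truncn B1) x0) (ler_wpM2r k0 h1).
have g2 := le_trans (hK x (Num.truncn B2) x0) (ler_wpM2r k0 h2).
have -> : 4 * K ^+ 2 * x%:R `^ ((33 / 2 + 3 * e) * s + 2 * e) =
    2 * (x%:R `^ ((11 / 2 + e) * s) * (K * x%:R `^ e) *
      (2 * x%:R `^ ((11 + 2 * e) * s) * (K * x%:R `^ e))).
  have -> : (33 / 2 + 3 * e) * s + 2 * e = (11 / 2 + e) * s + (e + ((11 + 2 * e) * s + e)) by field.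
  rewrite !powRD ?(gt_eqF X0) ?implybT //.
  by move: (_ `^ e) (_ `^ (_ * s)) (_ `^ (_ * s)) => a b d; ring.
by rewrite ler_pM2l // ler_pM.
Qed.

Lemma prime_count_sparse (A : R) n0 : 1 <= A < 33 / 31 ->
  (forall n, (n0 <= n)%N -> tau n != 0 -> (max_pdiv `|tau n|%N)%:R < ln n%:R `^ A :> R) ->
  exists K d : R, 0 < d < 1 /\
    forall x, (0 < x)%N -> #|prime_set x|%:R <= K * x%:R `^ (1 - d).
Proof.
move=> /andP[A1 A2] H.
have A12 : 1 <= A <= 2 by rewrite A1 /=; lra.
have [n2 hn2] := tau_prime_smooth A12 H.
have Ai1 : A^-1 <= 1 by rewrite invf_le1 //; lra.
have Ai2 : 31 / 33 < A^-1.
  have -> : 31 / 33 = (33 / 31)^-1 :> R by rewrite invf_div.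
  by rewrite ltf_pV2 // posrE; lra.
(* The midpoint of 1 - 1/A and 2/33. The lower end is what A (1 - s) < 1 requires, the upper end
   what 33/2 s < 1 requires, and they are in this order exactly because A < 33/31. *)
pose s := (1 - A^-1 + 2 / 33) / 2.
have s01 : 0 < s < 1 by apply/andP; rewrite /s; split; lra.
have s2 : s < 2 / 33 by rewrite /s; lra.
have As : A * (1 - s) < 1.
  rewrite -[ltRHS](@divff _ A); last by lra.
  by rewrite ltr_pM2l; rewrite ?/s; lra.
(* An eighth of the slack: the final exponent 1 - 8 e + 3 e s + 2 e stays below 1 - 2 e. *)
clearbody s; pose e := (1 - 33 / 2 * s) / 8.
have e0 : 0 < e by rewrite /e; lra.
have e1 : e < 1 / 8 by case/andP: s01 => s0 _; rewrite /e; lra.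
have eE : 33 / 2 * s = 1 - 8 * e by rewrite /e; field.
clearbody e; have [C C0 hC] := card_tau_gt_powR.
have [K K0 hK] := card_log_smooth_tau_le A1 s01 As e0.
exists (n2%:R + C + K), (2 * e); split; first by apply/andP; split; lra.
move=> x x0; have X1 : 1 <= x%:R :> R by rewrite ler1n.
pose S1 := [set p : 'I_x.+1 | (p < n2)%N]%SET.
pose S2 := [set p : 'I_x.+1 | x%:R `^ (11 / 2 + e) < `|tau p|%:~R]%SET.
pose G := (prime_set x :\: (S1 :|: S2))%SET.
have cov : prime_set x \subset (S1 :|: S2 :|: G)%SET.
  by apply/fintype.subsetP => p; rewrite !inE => ->; rewrite andbT orbN.
have hG : #|G|%:R <= K * x%:R `^ (1 - 2 * e).
  apply: le_trans (hK x G x0 _) _.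
    move=> p; rewrite !inE negb_or -leqNgt -leNgt => /andP[/andP[pn b] pp].
    have px : (n2 <= p <= x)%N by rewrite pn -ltnS ltn_ord.
    by have [tp m1 m2] := hn2 p x pp px; split; [exact: pp|exact: tp|exact: b|exact: m1|exact: m2].
  rewrite ler_pM2l //; apply: ler_powR => //.
  have -> : (33 / 2 + 3 * e) * s + 2 * e = 33 / 2 * s + 3 * (e * s) + 2 * e by ring.
  have : e * s <= e * (1 / 8) by rewrite ler_pM2l //; lra.
  by rewrite eE; lra.
apply: (@le_trans _ _ (#|S1|%:R + #|S2|%:R + #|G|%:R)).
  rewrite -!natrD ler_nat; apply: leq_trans (subset_leq_card cov) _.
  by apply: leq_trans (leq_card_setU _ _) _; rewrite leq_add2r leq_card_setU.
rewrite [leRHS]mulrDl; apply: lerD; last exact: hG.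
rewrite mulrDl; apply: lerD; last exact: hC.
apply: (@le_trans _ _ n2%:R); first by rewrite ler_nat card_ord_lt.
rewrite ler_peMr // -[1 in leLHS](powRr0 x%:R) ler_powR //; lra.
Qed.

End Main.

Theorem theorem1 (R : realType) (eps : R) (eps_gt0 : 0 < eps) :
  infinite_set [set n : nat | [/\ (0 < n)%N, tau n != 0 &
    ln n%:R `^ (33 / 31 - eps) <= (max_pdiv `|tau n|%N)%:R]].
Proof.
set S := (X in infinite_set X); move=> /finite_seqP[l lE].
(* A large eps would push the exponent below 1, so it is raised to 1; this only weakens the upper
   bound on prime factors that is assumed. *)
pose A := Num.max 1 (33 / 31 - eps).
have A1 : 1 <= A by rewrite le_max lexx.
have A2 : A < 33 / 31 by rewrite gt_max; apply/andP; split; lra.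
have A12 : 1 <= A < 33 / 31 by rewrite A1.
(* From here on log n >= 1, so raising the exponent to A increases the power. *)
pose n1 := (Num.truncn (expR 1 : R)).+1.
have [n0 hn0] : exists n0, forall n, n \in l -> (n < n0)%N.
  by exists (\max_(n <- l) n).+1 => n nl; rewrite ltnS; apply: (@leq_bigmax_seq _ l xpredT id n).
have H n : (maxn n0 n1 <= n)%N -> tau n != 0 ->
    (max_pdiv `|tau n|%N)%:R < ln n%:R `^ A :> R.
  rewrite geq_max => /andP[nn0 nn1] tn.
  have ne : expR 1 <= n%:R :> R.
    by apply: le_trans (ltW (Num.Theory.truncnS_gt _)) _; rewrite ler_nat.
  have np : 0 < n%:R :> R by exact: lt_le_trans (expR_gt0 1) ne.
  have ln1 : 1 <= ln n%:R :> R by rewrite -[leLHS](expRK 1) ler_ln ?posrE ?expR_gt0.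
  have : ~ S n.
    by rewrite lE => /hn0; rewrite ltnNge nn0.
  move=> nS; apply: (@lt_le_trans _ _ (ln n%:R `^ (33 / 31 - eps))).
    by rewrite ltNge; apply/negP => h; apply: nS; split=> //; rewrite -(ltr0n R).
  by apply: ler_powR => //; rewrite le_max lexx orbT.
have [K [d [d01 hK]]] := prime_count_sparse A12 H.
exact: (@prime_count_not_sparse _ K d d01).
Qed.
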